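(* Let $k\ge 1$, $\sigma>0$, $\beta\ge 1$, and let $\mathbf q=(\phi_\eta,U,V)^\top$ be the exact solution (at a given time) of the viscous rotating shallow-water system described in the context, under the standing assumption stated there (in particular $\mathbf q\in (H^{k+1}(\Omega))^3$ and $S(\mathbf q)=S(\mathbf q_{\mathrm D})$ on $\Gamma_{\mathrm D}$). Then $\mathbf q$ satisfies the NIPG identity associated with the diffusive operator $-\Delta S(\mathbf q)$: for every $\mathbf w_h\in\mathbf V_h$, $$a_h(\mathbf q,\mathbf w_h)=-\sum_{K\in Q_h}\int_K \Delta S(\mathbf q)\cdot\mathbf w_h\,\mathrm d\mathbf x+\sum_{e\subset\Gamma_{\mathrm D}}\int_e\bigl(\nabla\mathbf w_h\,\mathbf n+\mu_e\mathbf w_h\bigr)\cdot S(\mathbf q_{\mathrm D})\,\mathrm ds .$$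
   Context: **Model.** $\Omega\subset\mathbb R^2$ is a bounded polygonal domain, $T>0$, $g>0$ the gravitational constant, $f_c$ the Coriolis parameter, $\nu_T>0$ the viscosity, $b\in W^{1,\infty}(\Omega)$ the bottom field, $\phi_b=gb$. The unknown is $\mathbf q=(\phi_\eta,U,V)^\top$, with $\phi=\phi_\eta+\phi_b>0$ (here $\phi_\eta=g\eta$, $\phi=gH$, $H=\eta+b\ge H_{\min}>0$, $U=gHu$, $V=gHv$), and solves $$\partial_t\mathbf q+\nabla\cdot\mathcal F(\mathbf q)-\Delta S(\mathbf q)=R(\mathbf q)\quad\text{in }\Omega\times(0,T],$$ $$\mathcal F(\mathbf q)=\begin{pmatrix}U&V\\ U^2/\phi+\tfrac12(\phi^2-\phi_b^2)&UV/\phi\\ UV/\phi&V^2/\phi+\tfrac12(\phi^2-\phi_b^2)\end{pmatrix},\quad S(\mathbf q)=(0,\nu_TU,\nu_TV)^\top,$$ $$R(\mathbf q)=(0,\;f_cV+\phi_\eta\partial_x\phi_b,\;-f_cU+\phi_\eta\partial_y\phi_b)^\top .$$ A compatible exterior state $\mathbf q_{\mathrm D}=(\phi_{\eta,\mathrm D},U_{\mathrm D},V_{\mathrm D})^\top$ is prescribed on $\Gamma_{\mathrm D}$, and the exact solution satisfies $S(\mathbf q)=S(\mathbf q_{\mathrm D})$ there; only the momentum components of $\mathbf q_{\mathrm D}$ enter the viscous Dirichlet data. **Mesh and spaces.** $Q_h$ is a triangulation of $\Omega$, $\mathcal E_h=\Gamma_h\cup\Gamma_{\mathrm D}$ its facets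 (interior and Dirichlet). Periodic facet pairs, if any, are treated as interior facets (regularity is then understood in the periodic sense). $V_k=\{v\in L^2(\Omega): v|_K\in\mathbb P_k(K)\ \forall K\in Q_h\}$, $\mathbf V_h=V_k^3$. On an interior facet $e=\partial K^+\cap\partial K^-$ a fixed unit normal $\mathbf n$ points from $K^+$ to $K^-$; componentwise $\{\!\{z\}\!\}=\frac12(z^++z^-)$, $[[z]]=z^+-z^-$. On $\Gamma_{\mathrm D}$, $\mathbf n$ is the outward normal, and in the form $a_h$ below jumps and averages are the interior trace ($[[z]]=z^+$, $\{\!\{\nabla z\}\!\}=\nabla z^+$). **NIPG form.** With $\mu_e=\sigma h_e^{-\beta}$, $h_e$ the diameter of $e$, $$a_h(\mathbf z,\mathbf w)=\sum_{K}\int_K\nabla S(\mathbf z):\nabla\mathbf w\,\mathrm d\mathbf x-\sum_{e\in\mathcal E_h}\int_e\{\!\{\nabla S(\mathbf z)\}\!\}\mathbf n\cdot[[\mathbf w]]\,\mathrm ds+\sum_{e\in\mathcal E_h}\int_e\{\!\{\nabla\mathbf w\}\!\}\mathbf n\cdot[[S(\mathbf z)]]\,\mathrm ds+\sum_{e\in\mathcal E_h}\int_e\mu_e[[S(\mathbf z)]]\cdot[[\mathbf w]]\,\mathrm ds .$$ **Standing assumption.** $\mathbf q\in(H^{k+1}(\Omega))^3$ for some $k\ge1$; the mesh family $Q_h$ is shape-regular and quasi-uniform; the reference depth is strictly positive, $\inf_\Omega(\eta_0+b)>0$; $\sigma>0$. *)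

(* Defs.v *)
From HB Require Import structures.
From mathcomp Require Import all_boot all_order all_algebra.
From mathcomp Require Import all_classical all_reals all_analysis.
Set Implicit Arguments.
Unset Strict Implicit.
Unset Printing Implicit Defensive.
Import Order.TTheory GRing.Theory Num.Theory.
Import numFieldNormedType.Exports.
Local Open Scope classical_set_scope.
Local Open Scope ring_scope.

(* Everything that is classically an equivalence class modulo null sets (Sobolev
   functions, weak derivatives, traces) is handled through representatives:
   total functions on the plane, whose values off the relevant set (or on a
   null set) are irrelevant. *)

Notation pt R := (R * R)%type.

Definition mu2 {R : realType} := (@lebesgue_measure R \x @lebesgue_measure R)%E.

(* the norm of the library on R * R is the sup norm *)
Definition enorm {R : realType} (v : pt R) : R :=
  Num.sqrt (v.1 ^+ 2 + v.2 ^+ 2).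

Definition evec {R : realType} (d : 'I_2) : pt R :=
  if d == 0 then (1, 0) else (0, 1).

Definition segment {R : realType} (a b : pt R) : set (pt R) :=
  [set a + s *: (b - a) | s in `[0, 1]].

Definition open_segment {R : realType} (a b : pt R) : set (pt R) :=
  [set a + s *: (b - a) | s in `]0, 1[].

Definition seg_int {R : realType} (a b : pt R) (f : pt R -> R) : R :=
  enorm (b - a) *
  \int[lebesgue_measure]_(s in `[0, 1]) f (a + s *: (b - a)).

Definition inner {R : realType} (m n : nat) (A B : 'M[R]_(m, n)) : R :=
  \sum_i \sum_j A i j * B i j.

(* classical Jacobian matrix, row i being the gradient of the i-th component *)
Definition grad {R : realType} (m : nat) (f : pt R -> 'cV[R]_m) (x : pt R) :
    'M[R]_(m, 2) :=
  \matrix_(i < m, d < 2) 'D_(evec d) (fun y => f y i 0) x.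

Fixpoint Cn {R : realType} (n : nat) (f : pt R -> R) : Prop :=
  continuous f /\
  if n is m.+1 then forall d, (forall x, derivable f x (evec d)) /\
                              Cn m ('D_(evec d) f)
  else True.

(* C_c^oo(N) *)
Definition test_fun {R : realType} (N : set (pt R)) (phi : pt R -> R) : Prop :=
  (forall n, Cn n phi) /\
  exists2 C, compact C /\ C `<=` N & forall x, ~ C x -> phi x = 0.

Definition locint {R : realType} (N : set (pt R)) (f : pt R -> R) : Prop :=
  measurable_fun N f /\
  forall C, compact C -> C `<=` N -> (\int[mu2]_(x in C) `|f x|%:E < +oo)%E.

Definition L2 {R : realType} (N : set (pt R)) (f : pt R -> R) : Prop :=
  measurable_fun N f /\ (\int[mu2]_(x in N) (f x ^+ 2)%:E < +oo)%E.

Definition Linfty {R : realType} (N : set (pt R)) (f : pt R -> R) : Prop :=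
  measurable_fun N f /\
  exists M : R, {ae mu2, forall x, N x -> `|f x| <= M}.

Definition weak_deriv {R : realType} (N : set (pt R)) (d : 'I_2)
    (f g : pt R -> R) : Prop :=
  [/\ locint N f, locint N g &
      forall phi, test_fun N phi ->
        \int[mu2]_(x in N) (f x * 'D_(evec d) phi x) =
        - \int[mu2]_(x in N) (g x * phi x)].

(* A periodic identification (a, b, tau) of Omega identifies the boundary
   segment [a, b] with its translate [a + tau, b + tau]; per may list such a
   pair in one or in both directions, and is empty if nothing is periodic. *)
Definition periodic_data {R : realType} (Omega : set (pt R))
    (per : seq (pt R * pt R * pt R)) : Prop :=
  forall p, p \in per ->
    [/\ p.1.1 != p.1.2,
        segment p.1.1 p.1.2 `<=` closure Omega `\` Omega &
        segment (p.1.1 + p.2) (p.1.2 + p.2) `<=` closure Omega `\` Omega].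

Definition glue {R : realType} (A B : set (pt R)) (tau : pt R)
    (f : pt R -> R) (x : pt R) : R :=
  if x \in A then f x else if x \in B then f (x + tau) else 0.

(* Weak derivative on Omega in the periodic sense: g is the weak derivative of
   f in Omega and, for each identification (a, b, tau), also across ]a, b[,
   where the two sides of ]a, b[ are a piece A of Omega and a piece B of
   Omega - tau. *)
Definition weak_deriv_per {R : realType} (Omega : set (pt R))
    (per : seq (pt R * pt R * pt R)) (d : 'I_2) (f g : pt R -> R) : Prop :=
  weak_deriv Omega d f g /\
  forall p, p \in per -> forall A B N : set (pt R),
    open A -> open B -> open N -> A `&` B = set0 ->
    A `<=` Omega -> (forall x, B x -> Omega (x + p.2)) ->
    N `<=` A `|` B `|` open_segment p.1.1 p.1.2 ->
    weak_deriv N d (glue A B p.2 f) (glue A B p.2 g).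

Definition weak_grad {R : realType} (Omega : set (pt R))
    (per : seq (pt R * pt R * pt R)) (f : pt R -> R)
    (g : 'I_2 -> pt R -> R) : Prop :=
  forall d, L2 Omega (g d) /\ weak_deriv_per Omega per d f (g d).

Fixpoint sobolev {R : realType} (Omega : set (pt R))
    (per : seq (pt R * pt R * pt R)) (m : nat) (f : pt R -> R) : Prop :=
  L2 Omega f /\
  if m is m'.+1 then
    exists2 g, weak_grad Omega per f g & forall d, sobolev Omega per m' (g d)
  else True.

(* l is a representative of the (L^2) Laplacian of f *)
Definition weak_laplacian {R : realType} (Omega : set (pt R))
    (per : seq (pt R * pt R * pt R)) (f l : pt R -> R) : Prop :=
  exists g : 'I_2 -> pt R -> R, exists h : 'I_2 -> 'I_2 -> pt R -> R,
    [/\ weak_grad Omega per f g,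
        forall d, weak_grad Omega per (g d) (h d) &
        forall x, Omega x -> l x = \sum_d h d d x].

(* b in W^{1,oo}(Omega), with weak gradient db *)
Definition W1infty {R : realType} (Omega : set (pt R)) (b : pt R -> R)
    (db : 'I_2 -> pt R -> R) : Prop :=
  Linfty Omega b /\
  forall d, Linfty Omega (db d) /\ weak_deriv Omega d b (db d).

(* Omega = interior (closure Omega) excludes slits *)
Definition polygonal_domain {R : realType} (Omega : set (pt R)) : Prop :=
  [/\ open Omega, connected Omega, Omega !=set0, bounded_set Omega &
      interior (closure Omega) = Omega /\
      exists2 s : seq (pt R * pt R), all (fun e => e.1 != e.2) s &
        closure Omega `\` Omega =
        [set x | exists2 e, e \in s & segment e.1 e.2 x]].

Notation triangle R := ('I_3 -> pt R).

(* closed convex hull of the vertices indexed by J *)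
Definition hull {R : realType} (v : triangle R) (J : set 'I_3) : set (pt R) :=
  [set x | exists l : 'I_3 -> R,
     [/\ forall j, 0 <= l j, forall j, ~ J j -> l j = 0,
         \sum_j l j = 1 & x = \sum_j l j *: v j]].

(* open triangle, the set on which element integrals are taken *)
Definition tri {R : realType} (v : triangle R) : set (pt R) :=
  [set x | exists l : 'I_3 -> R,
     [/\ forall j, 0 < l j, \sum_j l j = 1 & x = \sum_j l j *: v j]].

(* twice the signed area *)
Definition orient {R : realType} (v : triangle R) : R :=
  let p := v 1 - v 0 in let r := v 2 - v 0 in p.1 * r.2 - p.2 * r.1.

(* Edge i is opposite to vertex i: its end points are the vertices i + 1 and
   i + 2 modulo 3. *)
Definition src {R : realType} (v : triangle R) (i : 'I_3) : pt R := v (i + 1).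
Definition tgt {R : realType} (v : triangle R) (i : 'I_3) : pt R := v (i + 2).

Definition edge_len {R : realType} (v : triangle R) (i : 'I_3) : R :=
  enorm (tgt v i - src v i).

(* outward unit normal on edge i *)
Definition normal {R : realType} (v : triangle R) (i : 'I_3) : 'cV[R]_2 :=
  let t := tgt v i - src v i in
  (Num.sg (orient v) / edge_len v i) *:
    \col_(d < 2) (if d == 0 then t.2 else - t.1).

Definition diam {R : realType} (v : triangle R) : R :=
  Num.max (edge_len v 0) (Num.max (edge_len v 1) (edge_len v 2)).

Notation ledge n := ('I_n * 'I_3)%type.

(* A facet is the edge fplus of the element K^+, together with, for an interior
   facet, the edge of K^- and the translation mapping the former onto the
   latter (0 unless the facet is a periodic pair).  Dirichlet facets have
   fminus = None. *)
Notation facet R n := (ledge n * option (ledge n * pt R))%type.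
Definition fplus {R : realType} (n : nat) (e : facet R n) : ledge n := e.1.
Definition fminus {R : realType} (n : nat) (e : facet R n) :
    option (ledge n * pt R) := e.2.

Record mesh (R : realType) := Mesh {
  msize : nat;
  elt : 'I_msize -> triangle R;
  facets : seq (facet R msize) }.
Arguments elt {R} m K j.
Arguments facets {R} m.

Definition ledges {R : realType} (n : nat) (e : facet R n) : seq (ledge n) :=
  fplus e :: (if fminus e is Some m then [:: m.1] else [::]).

(* Conforming triangulation of Omega; the choice of fplus and fminus fixes the
   orientation of the interior facets. *)
Definition triangulation {R : realType} (Omega GammaD : set (pt R))
    (per : seq (pt R * pt R * pt R)) (M : mesh R) : Prop :=
  [/\ [/\ forall K, orient (elt M K) != 0,
          \bigcup_K hull (elt M K) setT = closure Omega,
          forall K K', K != K' -> tri (elt M K) `&` tri (elt M K') = set0 &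
          forall K K', K != K' ->
            hull (elt M K) setT `&` hull (elt M K') setT =
            hull (elt M K) [set j | exists j', elt M K' j' = elt M K j]],
      perm_eq (flatten [seq ledges e | e <- facets M])
              (enum {: 'I_(msize M) * 'I_3}) &
      forall f, f \in facets M ->
        let v := elt M (fplus f).1 in let i := (fplus f).2 in
        let E := segment (src v i) (tgt v i) in
        match fminus f with
        | None => E `<=` GammaD
        | Some ((K', i'), tau) =>
            let v' := elt M K' in
            [/\ segment (src v' i') (tgt v' i') = [set x + tau | x in E],
                normal v' i' = - normal v i &
                tau = 0 \/
                exists2 p, p \in per & tau = p.2 /\ E `<=` segment p.1.1 p.1.2]
        end].

Definition shape_regular {R : realType} (I : Type) (Q : I -> mesh R) : Prop :=
  exists2 kappa : R, 0 < kappa & forall h (K : 'I_(msize (Q h))),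
    exists c : pt R, exists2 r : R, diam (elt (Q h) K) <= kappa * r &
      [set x | enorm (x - c) < r] `<=` tri (elt (Q h) K).

Definition quasi_uniform {R : realType} (I : Type) (Q : I -> mesh R) : Prop :=
  exists2 c : R, 0 < c & forall h (K K' : 'I_(msize (Q h))),
    c * diam (elt (Q h) K) <= diam (elt (Q h) K').

(* t is (a representative in L^2(e) of) the trace on edge i of the triangle v of
   the H^1 function f with weak gradient g: the L^2(e)-limit of the restrictions
   of functions that are C^1 up to the boundary and converge to f in H^1. *)
Definition is_trace {R : realType} (v : triangle R) (i : 'I_3)
    (f : pt R -> R) (g : 'I_2 -> pt R -> R) (t : pt R -> R) : Prop :=
  let x (s : R) : pt R := src v i + s *: (tgt v i - src v i) in
  [/\ measurable_fun (`[0, 1] : set R) (t \o x),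
      (\int[lebesgue_measure]_(s in `[0%R, 1%R]) (t (x s) ^+ 2)%:E < +oo)%E &
      exists u : nat -> pt R -> R,
        [/\ forall n, Cn 1 (u n),
            (\int[mu2]_(y in tri v) ((u n y - f y) ^+ 2)%:E)%E
              @[n --> \oo] --> 0%E,
            forall d, (\int[mu2]_(y in tri v)
              (('D_(evec d) (u n) y - g d y) ^+ 2)%:E)%E
              @[n --> \oo] --> 0%E &
            (\int[lebesgue_measure]_(s in `[0%R, 1%R])
              ((u n (x s) - t (x s)) ^+ 2)%:E)%E @[n --> \oo] --> 0%E]].

(* An elementwise H^2 field: on each element its values and gradient, and on
   each edge of each element the traces of both, taken from that element. *)
Record field (R : realType) (n : nat) := Field {
  fval : 'I_n -> pt R -> 'cV[R]_3;
  fgrad : 'I_n -> pt R -> 'M[R]_(3, 2);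
  ftr : 'I_n -> 'I_3 -> pt R -> 'cV[R]_3;
  fgtr : 'I_n -> 'I_3 -> pt R -> 'M[R]_(3, 2) }.

(* z consists of representatives of q in H^2(Omega)^3 and its traces *)
Definition represents {R : realType} (Omega : set (pt R))
    (per : seq (pt R * pt R * pt R)) (M : mesh R) (q : pt R -> 'cV[R]_3)
    (z : field R (msize M)) : Prop :=
  exists G : 'I_3 -> 'I_2 -> pt R -> R,
  exists H : 'I_3 -> 'I_2 -> 'I_2 -> pt R -> R, forall c : 'I_3,
    [/\ weak_grad Omega per (fun x => q x c 0) (G c),
        forall d, weak_grad Omega per (G c d) (H c d),
        forall K x, tri (elt M K) x ->
          fval z K x = q x /\ forall d, fgrad z K x c d = G c d x,
        forall K i, is_trace (elt M K) i (fun x => q x c 0) (G c)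
                             (fun x => ftr z K i x c 0) &
        forall K i d, is_trace (elt M K) i (G c d) (H c d)
                               (fun x => fgtr z K i x c d)].

(* P_k in two variables (total degree at most k) *)
Definition polyfun {R : realType} (k : nat) (f : pt R -> R) : Prop :=
  exists a : nat -> nat -> R, forall x,
    f x = \sum_(i < k.+1) \sum_(j < k.+1 | (i + j <= k)%N)
            a i j * x.1 ^+ i * x.2 ^+ j.

(* An element of V_k^3 is given by its polynomial on each element. *)
Definition in_Vh {R : realType} (k : nat) (M : mesh R)
    (w : 'I_(msize M) -> pt R -> 'cV[R]_3) : Prop :=
  forall K c, polyfun k (fun x => w K x c 0).

Definition dg_field {R : realType} (n : nat) (w : 'I_n -> pt R -> 'cV[R]_3) :
    field R n :=
  Field w (fun K => grad (w K)) (fun K _ => w K) (fun K _ => grad (w K)).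

(* S is linear with constant coefficients; on gradients it acts columnwise, so
   that visc nuT (grad q) is the gradient of S(q). *)
Definition visc {R : realType} (nuT : R) (n : nat) (A : 'M[R]_(3, n)) :
    'M[R]_(3, n) :=
  \matrix_(i, j) (if i == 0 then 0 else nuT * A i j).

Definition visc_field {R : realType} (nuT : R) (n : nat) (z : field R n) :
    field R n :=
  Field (fun K x => visc nuT (fval z K x)) (fun K x => visc nuT (fgrad z K x))
        (fun K i x => visc nuT (ftr z K i x))
        (fun K i x => visc nuT (fgtr z K i x)).

Section Facet.
Context {R : realType} (M : mesh R).
Implicit Types (f : facet R (msize M)).

Definition fsrc f : pt R := src (elt M (fplus f).1) (fplus f).2.
Definition ftgt f : pt R := tgt (elt M (fplus f).1) (fplus f).2.
Definition facet_len f : R := edge_len (elt M (fplus f).1) (fplus f).2.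
Definition facet_normal f : 'cV[R]_2 := normal (elt M (fplus f).1) (fplus f).2.
Definition facet_int f (F : pt R -> R) : R := seg_int (fsrc f) (ftgt f) F.

Definition jump (m n : nat) (t : 'I_(msize M) -> 'I_3 -> pt R -> 'M[R]_(m, n))
    f (x : pt R) : 'M[R]_(m, n) :=
  match fminus f with
  | None => t (fplus f).1 (fplus f).2 x
  | Some ((K', i'), tau) => t (fplus f).1 (fplus f).2 x - t K' i' (x + tau)
  end.

Definition avg (m n : nat) (t : 'I_(msize M) -> 'I_3 -> pt R -> 'M[R]_(m, n))
    f (x : pt R) : 'M[R]_(m, n) :=
  match fminus f with
  | None => t (fplus f).1 (fplus f).2 x
  | Some ((K', i'), tau) =>
      2^-1 *: (t (fplus f).1 (fplus f).2 x + t K' i' (x + tau))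
  end.

Definition penalty (sigma beta : R) f : R := sigma * facet_len f `^ (- beta).

Definition nipg (sigma beta nuT : R) (z w : field R (msize M)) : R :=
  let Sz := visc_field nuT z in
  \sum_K \int[mu2]_(x in tri (elt M K)) inner (fgrad Sz K x) (fgrad w K x)
  - \sum_(e <- facets M) facet_int e (fun x =>
      inner (avg (fgtr Sz) e x *m facet_normal e) (jump (ftr w) e x))
  + \sum_(e <- facets M) facet_int e (fun x =>
      inner (avg (fgtr w) e x *m facet_normal e) (jump (ftr Sz) e x))
  + \sum_(e <- facets M) facet_int e (fun x =>
      penalty sigma beta e * inner (jump (ftr Sz) e x) (jump (ftr w) e x)).

(* S(q) = S(qD) on the Dirichlet facets, in the sense of traces *)
Definition dirichlet_cond (nuT : R) (z : field R (msize M))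
    (qD : pt R -> 'cV[R]_3) : Prop :=
  forall e, e \in facets M -> ~~ isSome (fminus e) ->
    {ae lebesgue_measure, forall s : R, s \in `[0, 1] ->
      let x := fsrc e + s *: (ftgt e - fsrc e) in
      visc nuT (ftr z (fplus e).1 (fplus e).2 x) = visc nuT (qD x)}.

End Facet.

Section ShallowWater.
Context {R : realType}.
Implicit Types (q : 'cV[R]_3) (pb : R).

(* pb is the value of phi_b, phi = phi_eta + phi_b *)
Definition flux q pb : 'M[R]_(3, 2) :=
  let U := q 1 0 in let V := q 2 0 in let phi := q 0 0 + pb in
  let P := 2^-1 * (phi ^+ 2 - pb ^+ 2) in
  \matrix_(i < 3, j < 2)
    (nth [::] [:: [:: U; V];
                  [:: U ^+ 2 / phi + P; U * V / phi];
                  [:: U * V / phi; V ^+ 2 / phi + P]] i)`_j.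

(* dpb is the value of the gradient of phi_b *)
Definition source (fc : R) q (dpb : 'I_2 -> R) : 'cV[R]_3 :=
  \col_(i < 3)
    [:: 0; fc * q 2 0 + q 0 0 * dpb 0; - fc * q 1 0 + q 0 0 * dpb 1]`_i.

(* The system in Omega x (0, T], in the weakest reading: at every time s, tested
   in space against C_c^oo(Omega), with d/dt taken within (0, T].  db is the weak
   gradient of b. *)
Definition swe_solution (Omega : set (pt R)) (T g fc nuT : R) (b : pt R -> R)
    (db : 'I_2 -> pt R -> R) (q : R -> pt R -> 'cV[R]_3) : Prop :=
  (exists2 Hmin : R, 0 < Hmin & forall s, 0 < s <= T ->
     {ae mu2, forall x, Omega x -> Hmin <= q s x 0 0 / g + b x}) /\
  forall s, 0 < s <= T -> forall c : 'I_3,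
    let F x := flux (q s x) (g * b x) in
    let S x := visc nuT (q s x) in
    let r x := source fc (q s x) (fun d => g * db d x) in
    [/\ locint Omega (fun x => q s x c 0),
        forall d, locint Omega (fun x => F x c d),
        locint Omega (fun x => r x c 0) &
        forall phi, test_fun Omega phi ->
          (s' - s)^-1 * (\int[mu2]_(x in Omega) (q s' x c 0 * phi x)
                         - \int[mu2]_(x in Omega) (q s x c 0 * phi x))
            @[s' --> within [set s' | 0 < s' <= T] s^'] -->
          \int[mu2]_(x in Omega)
            (\sum_d F x c d * 'D_(evec d) phi x
             + S x c 0 * \sum_d 'D_(evec d) ('D_(evec d) phi) x
             + r x c 0 * phi x)].

End ShallowWater.

(* Main.v *)
(* On each element, Green's formula holds for a function with weak gradient and
   its edge traces: for smooth functions it follows from the divergence theorem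
   for the radial fields x - v_i, and it passes to the L^2 limit.  Applied to the
   components of grad S(q), it turns the volume terms of a_h into -int Laplacian
   S(q) . w plus the fluxes of grad S(q) n . w through the element boundaries.
   On an interior facet the traces of q and of grad q have no jump: test the weak
   derivative across the facet with a polynomial times smooth cutoffs.  Hence the
   two fluxes combine into the consistency term and the terms with [S(q)] vanish.
   On a Dirichlet facet the flux cancels the consistency term, and S(q) = S(q_D)
   turns the remaining two terms into the boundary data. *)
Require Import Defs.
From mathcomp Require Import all_boot all_order all_algebra.
From mathcomp Require Import all_classical all_reals all_analysis.
From mathcomp Require Import measurable_realfun ring lra.
Import Order.TTheory GRing.Theory Num.Theory.
Import numFieldNormedType.Exports.
Set Implicit Arguments.
Unset Strict Implicit.
Unset Printing Implicit Defensive.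
Local Open Scope classical_set_scope.
Local Open Scope ring_scope.

(** * Smooth functions of the plane *)

Section Cn_theory.
Context {R : realType}.
Implicit Types (f g : pt R -> R) (x v : pt R) (n : nat).

(** [is_trace] supplies one approximating sequence per edge, and its restrictions are known to
    converge on that edge only. Green's formula with three boundary terms can therefore not be
    passed to the limit along a single sequence. The field x - v_i is tangential on the two edges
    through v_i, so its formula contains one trace, and the sequence of that edge suffices; constant
    fields are recovered afterwards by linear algebra from the three limits.

    No jump is shown to vanish almost everywhere, and no two weak derivatives are shown to agree
    almost everywhere. Such differences occur only in integrals against smooth functions, where it
    is enough to multiply by cutoffs, use the definition of the weak derivative, and let the cutoffs
    tend to 1. The cutoffs must be C^oo with compact support inside a triangle, or inside a
    neighbourhood of an open facet. Both regions are intersections of half-planes, so products of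
    functions exp(-1/y), with y affine and one factor per half-plane, are sufficient. *)

Lemma Cn_continuous n f : Cn n f -> continuous f.
Proof. by case: n => [|n] []. Qed.

Lemma Cn_derivable n f d x : Cn n.+1 f -> derivable f x (evec d).
Proof. by move=> [_ /(_ d)] []. Qed.

Lemma Cn_derive n f d : Cn n.+1 f -> Cn n ('D_(evec d) f).
Proof. by move=> [_ /(_ d)] []. Qed.

Lemma CnW n f : Cn n.+1 f -> Cn n f.
Proof.
elim: n f => [|n IH] f [cf df]; split => // d.
have [df1 Cdf] := df d; split => //; exact: IH.
Qed.

Lemma derive_cst0 (c : R) v : 'D_v (fun _ : pt R => c) = fun _ => 0.
Proof. by apply/funext => x; rewrite (derive_cst c). Qed.

Lemma Cn_cst n (c : R) : Cn n (fun _ : pt R => c).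
Proof.
elim: n c => [|n IH] c; split; try exact: cst_continuous.
  by [].
move=> d; split => [x|]; first exact: derivable_cst.
by rewrite derive_cst0.
Qed.

Lemma CnD n f g : Cn n f -> Cn n g -> Cn n (fun x => f x + g x).
Proof.
elim: n f g => [|n IH] f g [cf df] [cg dg]; split => //.
- by move=> x; apply: cvgD; [exact: cf|exact: cg].
- by move=> x; apply: cvgD; [exact: cf|exact: cg].
move=> d; have [df1 Cdf] := df d; have [dg1 Cdg] := dg d; split => [x|].
  exact: derivableD.
rewrite (_ : 'D_(evec d) _ = fun x => 'D_(evec d) f x + 'D_(evec d) g x).
  exact: IH.
by apply/funext => x; rewrite -deriveD.
Qed.

Lemma CnM n f g : Cn n f -> Cn n g -> Cn n (fun x => f x * g x).
Proof.
elim: n f g => [|n IH] f g Cf Cg; have [cf df] := Cf; have [cg dg] := Cg;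
    split => //.
- by move=> x; apply: cvgM; [exact: cf|exact: cg].
- by move=> x; apply: cvgM; [exact: cf|exact: cg].
move=> d; have [df1 Cdf] := df d; have [dg1 Cdg] := dg d; split => [x|].
  exact: derivableM.
rewrite (_ : 'D_(evec d) _ =
  fun x => f x * 'D_(evec d) g x + g x * 'D_(evec d) f x).
  by apply: CnD; apply: IH => //; exact: CnW.
by apply/funext => x; rewrite -[in RHS]deriveM.
Qed.

Lemma Cn_sum n (I : Type) (r : seq I) (P : pred I) (F : I -> pt R -> R) :
  (forall i, Cn n (F i)) -> Cn n (fun x => \sum_(i <- r | P i) F i x).
Proof.
move=> CF; elim: r => [|i r IH].
  under eq_fun do rewrite big_nil; exact: Cn_cst.
under eq_fun do rewrite big_cons.
by case: (P i) => //; exact: CnD.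
Qed.

Lemma CnX n f k : Cn n f -> Cn n (fun x => f x ^+ k).
Proof.
move=> Cf; elim: k => [|k IH].
  under eq_fun do rewrite expr0; exact: Cn_cst.
under eq_fun do rewrite exprS; exact: CnM.
Qed.

(** Bridge to one real variable: on the line through [x] a directional derivative is an ordinary
    one, to which the chain rule applies. *)
Lemma is_derive_line f x v (l : R) :
  is_derive (0 : R) 1 (fun h : R => f (h *: v + x)) l -> is_derive x v f l.
Proof.
move=> [dfx <-]; split; first exact/derivable1P.
rewrite /derive; set g1 := fun h => h^-1 *: _; set g2 := fun h => h^-1 *: _.
suff -> : g1 = g2 by []; apply/funext => h; rewrite /g1 /g2 /=.
by rewrite addr0 scale0r add0r [_%:A]mulr1.
Qed.

Lemma is_derive_lineE f x v (l : R) :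
  is_derive x v f l -> is_derive (0 : R) 1 (fun h : R => f (h *: v + x)) l.
Proof.
move=> [dfx <-]; split; first exact: (derivable1P _ _ _).1.
rewrite /derive; set g1 := fun h => h^-1 *: _; set g2 := fun h => h^-1 *: _.
suff -> : g1 = g2 by []; apply/funext => h; rewrite /g1 /g2 /=.
by rewrite addr0 scale0r add0r [_%:A]mulr1.
Qed.

Lemma Cn_shift n f (tau : pt R) : Cn n f -> Cn n (fun x => f (x + tau)).
Proof.
have D (h : pt R -> R) v x (l : R) : is_derive (x + tau) v h l ->
    is_derive x v (fun y => h (y + tau)) l.
  move=> /is_derive_lineE hl; apply: is_derive_line.
  by under eq_fun do rewrite -addrA.
elim: n f => [|n IH] f Cf; have [cf df] := Cf; split => //.
- by move=> x; apply: continuous_comp; [exact: cvgD cvg_id (cvg_cst _)|exact: cf].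
- by move=> x; apply: continuous_comp; [exact: cvgD cvg_id (cvg_cst _)|exact: cf].
move=> d; have [df1 Cdf] := df d; split => [x|].
  by have [] := D f (evec d) x _ (derivableP (df1 (x + tau))).
rewrite (_ : 'D_(evec d) _ = fun x => 'D_(evec d) f (x + tau)).
  exact: (IH _ Cdf).
apply/funext => x.
by have [] := D f (evec d) x _ (derivableP (df1 (x + tau))).
Qed.

End Cn_theory.

(** * Smooth functions built from exp(-1/x) *)

Section flat.
Context {R : realType}.
Implicit Types (p : {poly R}) (x y : R).

(* A family of C^oo functions vanishing on the negative half-line and closed
   under differentiation. *)
Definition flat p x : R := if 0 < x then p.[x^-1] * expR (- x^-1) else 0.

(** The exponential series gives y^i <= i! exp y for each monomial; the bound sums these
    inequalities, weighted by the coefficients. *)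
Lemma horner_expRN_bounded p :
  exists M : R, forall y, 0 <= y -> `|p.[y] * expR (- y)| <= M.
Proof.
exists (\sum_(i < size p) `|p`_i| * i`!%:R) => y y0.
rewrite horner_coef mulr_suml (le_trans (ler_norm_sum _ _ _))// ler_sum// => i _.
rewrite !normrM -mulrA ler_wpM2l//.
rewrite (ger0_norm (exprn_ge0 _ _))// (ger0_norm (expR_ge0 _)).
rewrite expRN ler_pdivrMr ?expR_gt0// mulrC -ler_pdivrMr ?ltr0n ?fact_gt0//.
case: (nat_of_ord i) => [|n].
  by rewrite expr0 fact0 invr1 mulr1 -expR0 ler_expR.
by rewrite (le_trans _ (expR_ge1Dxn n y0))// lerDr.
Qed.

(** This is the previous bound for [p * 'X ^+ 2] at 1/x. Its purpose is the derivative of [flat p]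
    at 0, where a quadratic bound makes the difference quotient tend to 0. *)
Lemma flat_sqr_bounded p : exists M : R, forall x, `|flat p x| <= M * x ^+ 2.
Proof.
have [M pM] := horner_expRN_bounded (p * 'X ^+ 2).
exists M => x; rewrite /flat; case: ltrP => x0; last first.
  rewrite normr0 mulr_ge0 ?sqr_ge0//.
  by rewrite (le_trans _ (pM 0 (lexx 0))).
have := pM x^-1; rewrite invr_ge0 (ltW x0) => /(_ isT).
rewrite hornerM hornerXn mulrAC -[X in _ <= X -> _]mulr1 normrM exprVn.
rewrite (ger0_norm (_ : 0 <= x ^- 2)) ?invr_ge0 ?sqr_ge0//.
by rewrite ler_pdivrMr ?exprn_gt0// mulr1.
Qed.

(** With y = 1/x, differentiating p(y) exp(-y) with respect to y and multiplying by dy/dx = -y^2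
    produces the polynomial y^2 (p - p'). *)
Lemma is_derive_flat p x :
  is_derive x 1 (flat p) (flat ('X ^+ 2 * (p - p^`())) x).
Proof.
have [x0|x0|->] := ltrgtP x 0.
- rewrite {2}/flat ltNge (ltW x0)/=.
  apply: (@near_eq_is_derive _ _ _ (cst 0)).
  near=> y; rewrite /flat ltNge; suff -> : y <= 0 by [].
  by apply/ltW; near: y; exact: lt_nbhsl.
- rewrite {2}/flat x0.
  pose F : R -> R := (horner p \o GRing.inv) * (expR \o (fun y => - y^-1)).
  apply: (@near_eq_is_derive _ _ _ F).
    near=> y; rewrite /flat; suff -> : 0 < y by [].
    by near: y; exact: lt_nbhsr.
  have dV : is_derive x 1 (fun y : R => y^-1) (- x ^- 2).
    have /= := @is_deriveV R id x 1 1; rewrite gt_eqF// => /(_ isT _).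
      by rewrite /GRing.scale/= mulr1.
  have d1 : is_derive x 1 (horner p \o GRing.inv) (p^`().[x^-1] * - x ^- 2).
    exact: is_derive1_comp.
  have d2 : is_derive x 1 (expR \o (fun y : R => - y^-1))
      (expR (- x^-1) * - - x ^- 2).
    by apply: is_derive1_comp; exact: is_deriveN.
  apply: is_derive_eq.
  rewrite /GRing.scale/= hornerM hornerXn hornerD hornerN /= exprVn.
  ring.
have [M pM] := flat_sqr_bounded p.
rewrite {2}/flat ltxx.
suff H : h^-1 *: (flat p (h *: 1 + 0) - flat p 0) @[h --> (0:R)^'] --> (0 : R).
  by split; [apply/cvg_ex; exists 0|exact: cvg_lim H].
apply/cvgrPdist_le => /= e e0.
have M0 : 0 < `|M| + 1 by rewrite ltr_wpDl.
near=> h.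
have h0 : h != 0 by near: h; exact: nbhs_dnbhs_neq.
rewrite sub0r normrN addr0 [h *: 1]mulr1 {2}/flat ltxx subr0.
rewrite /GRing.scale/= normrM normfV ler_pdivrMl ?normr_gt0//.
rewrite (le_trans (pM h))// -[h ^+ 2]ger0_norm ?sqr_ge0// normrX.
rewrite mulrC expr2 -mulrA ler_wpM2l//.
have he : `|h| <= e / (`|M| + 1).
  near: h; apply: dnbhs0_le; exact: divr_gt0.
rewrite (@le_trans _ _ (`|h| * (`|M| + 1)))// ?ler_wpM2l//.
  by rewrite (le_trans (ler_norm M))// lerDl.
by rewrite -ler_pdivlMr.
Unshelve. all: by end_near. Qed.

Lemma continuous_flat p : continuous (flat p).
Proof.
move=> x; apply: differentiable_continuous; apply/derivable1_diffP.
by have [] := is_derive_flat p x.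
Qed.

Lemma flat1_ge0 x : 0 <= flat 1 x.
Proof. by rewrite /flat; case: ltrP => // _; rewrite hornerC mul1r expR_ge0. Qed.

Lemma flat1_le1 x : flat 1 x <= 1.
Proof.
rewrite /flat; case: ltrP => // x0.
by rewrite hornerC mul1r expR_le1 oppr_le0 invr_ge0 ltW.
Qed.

Lemma flat_le0 p x : x <= 0 -> flat p x = 0.
Proof. by move=> x0; rewrite /flat ltNge x0. Qed.

(** The argument tends to infinity, so the limit is exp 0. The shift by 1 makes the function zero
    for x <= 1/n, which will give the cutoffs compact support. *)
Lemma cvg_flat1 x : 0 < x -> flat 1 (n%:R * x - 1) @[n --> \oo] --> (1 : R).
Proof.
move=> x0; rewrite -[X in _ --> X]expR0 -[X in expR X]oppr0.
pose y n := (n%:R * x - 1 : R).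
have yoo : y @ \oo --> +oo.
  apply/cvgryPge => A; near=> n.
  rewrite /y lerBrDr -ler_pdivrMr//; near: n; exact: nbhs_infty_ger.
have : expR (- (y n)^-1) @[n --> \oo] --> expR (- 0).
  apply: continuous_cvg; first exact: continuous_expR.
  apply: cvgN; apply/gtr0_cvgV0 => //.
  by move/cvgryPgt : yoo => /(_ 0).
apply: cvg_trans; apply: near_eq_cvg; near=> n.
rewrite /flat -/(y n); suff -> : 0 < y n by rewrite hornerC mul1r.
by near: n; move/cvgryPgt : yoo => /(_ 0).
Unshelve. all: by end_near. Qed.

End flat.

Lemma continuous_pt {R : realType} (T : topologicalType) (f g : T -> R) :
  continuous f -> continuous g -> continuous (fun x => (f x, g x) : pt R).
Proof.
move=> cf cg x.
exact: (@cvg_pair _ _ _ (nbhs x) (nbhs (f x)) (nbhs (g x)) _ _ _ f g (cf x) (cg x)).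
Qed.

(** * Affine arguments, polynomials and differentiability of C^1 functions *)

Section directional.
Context {R : realType}.
Implicit Types (f : pt R -> R) (x v : pt R) (n : nat).

Lemma pt_eqP x y : x.1 = y.1 -> x.2 = y.2 -> x = y.
Proof. by case: x y => [? ?] [? ?] /= -> ->. Qed.

Lemma continuous_affine (a b c : R) :
  continuous (fun x : pt R => a + b * x.1 + c * x.2).
Proof.
move=> x; apply: cvgD; last by apply: cvgMl_tmp; exact: cvg_snd.
by apply: cvgD; [exact: cvg_cst|apply: cvgMl_tmp; exact: cvg_fst].
Qed.

Lemma is_derive_comp_affine (g : R -> R) (dg a b c : R) x v :
  is_derive (a + b * x.1 + c * x.2) 1 g dg ->
  is_derive x v (fun y => g (a + b * y.1 + c * y.2))
    (dg * (b * v.1 + c * v.2)).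
Proof.
move=> g'; apply: is_derive_line.
pose l h := h * (b * v.1 + c * v.2) + (a + b * x.1 + c * x.2).
rewrite (_ : (fun _ => _) = g \o l); last first.
  by apply/funext => h; rewrite /l/= /GRing.scale/=; congr g; ring.
apply: is_derive1_comp; first by rewrite /l mul0r add0r.
rewrite /l; apply: is_derive_eq.
by rewrite addr0 scaler0 add0r [_%:A]mulr1.
Qed.

(** The induction runs over all [p] at once: a partial derivative replaces [p] by another polynomial
    and adds only a constant factor. *)
Lemma Cn_flat_affine (p : {poly R}) n (a b c : R) :
  Cn n (fun x => flat p (a + b * x.1 + c * x.2)).
Proof.
have cf q : continuous (fun x : pt R => flat q (a + b * x.1 + c * x.2)).
  move=> x; apply: (@continuous_comp _ _ _
    (fun x : pt R => a + b * x.1 + c * x.2) (flat q)).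
    exact: continuous_affine.
  exact: continuous_flat.
elim: n p => [|n IH] p; split => // d.
have D x := is_derive_comp_affine (evec d) (is_derive_flat p (a + b * x.1 + c * x.2)).
split=> [x|]; first by have [] := D x.
rewrite (_ : 'D_(evec d) _ = fun x =>
  flat ('X ^+ 2 * (p - p^`())) (a + b * x.1 + c * x.2) *
  (b * (evec d).1 + c * (evec d).2)).
  by apply: CnM => //; exact: Cn_cst.
by apply/funext => x; have [] := D x.
Qed.

Lemma Cn_affine n (a b c : R) : Cn n (fun x : pt R => a + b * x.1 + c * x.2).
Proof.
case: n => [|n]; split; try exact: continuous_affine.
  by [].
move=> d.
have D x := is_derive_comp_affine (evec d) (is_derive_id (a + b * x.1 + c * x.2) 1).
split=> [x|]; first by have [] := D x.
rewrite (_ : 'D_(evec d) _ = fun _ => b * (evec d).1 + c * (evec d).2).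
  exact: Cn_cst.
by apply/funext => x; have [_ ->] := D x; rewrite mul1r.
Qed.

Lemma Cn_fst n : Cn n (fun x : pt R => x.1).
Proof.
rewrite (_ : (fun _ => _) = fun x => 0 + 1 * x.1 + 0 * x.2); first exact: Cn_affine.
by apply/funext => x /=; ring.
Qed.

Lemma Cn_snd n : Cn n (fun x : pt R => x.2).
Proof.
rewrite (_ : (fun _ => _) = fun x => 0 + 0 * x.1 + 1 * x.2); first exact: Cn_affine.
by apply/funext => x /=; ring.
Qed.

Lemma polyfun_Cn k n f : polyfun k f -> Cn n f.
Proof.
move=> [a fE]; rewrite (_ : f = fun x => \sum_(i < k.+1)
    \sum_(j < k.+1 | (i + j <= k)%N) a i j * x.1 ^+ i * x.2 ^+ j); last first.
  exact/funext.
apply: Cn_sum => i; apply: Cn_sum => j.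
apply: CnM; first apply: CnM; first exact: Cn_cst.
  by apply: CnX; exact: Cn_fst.
by apply: CnX; exact: Cn_snd.
Qed.

Lemma derive_MVT f (d : 'I_2) (x : pt R) (k : R) :
  (forall y, derivable f y (evec d)) ->
  exists2 s, s \in `[0, 1] &
    f (x + k *: evec d) - f x = k * 'D_(evec d) f (x + (s * k) *: evec d).
Proof.
move=> df.
(* Rescaling to the parameter interval [0, 1] treats every sign of [k], including k = 0, in one
   go. *)
pose g s := f ((s * k) *: evec d + x).
have dg (s : R) : is_derive s 1 g (k * 'D_(evec d) f (x + (s * k) *: evec d)).
  have /is_derive_lineE D := derivableP (df (x + (s * k) *: evec d)).
  pose l t : R := t * k - s * k.
  rewrite (_ : g = (fun h => f (h *: evec d + (x + (s * k) *: evec d))) \o l).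
    rewrite [X in is_derive _ _ _ X]mulrC.
    apply: is_derive1_comp; first by rewrite /l subrr.
    rewrite /l; apply: is_derive_eq.
    by rewrite subr0 scaler0 add0r [_%:A]mulr1.
  by apply/funext => t; rewrite /g /l /= addrCA addrC -scalerDl subrK.
have [s s01 gE] := MVT_segment ler01 (fun s _ => dg s)
  (continuous_subspaceT (fun s => differentiable_continuous
    ((derivable1_diffP _ _).1 (@ex_derive _ _ _ _ _ _ _ (dg s))))).
exists s => //.
by move: gE; rewrite /g mul1r mul0r scale0r add0r subr0 mulr1 [X in f X - _]addrC.
Qed.

(* C^1 functions are differentiable: by the mean value theorem along the two
   axes, the difference quotient is a combination of values of the partial
   derivatives at points tending to x. *)
Lemma is_derive_C1 f x v : Cn 1 f ->
  is_derive x v f (v.1 * 'D_(evec 0) f x + v.2 * 'D_(evec 1) f x).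
Proof.
move=> Cf.
have df d y : derivable f y (evec d) by exact: Cn_derivable Cf.
have cd d : continuous ('D_(evec d) f).
  exact: Cn_continuous (Cn_derive d Cf).
suff H : h^-1 *: (f (h *: v + x) - f x) @[h --> (0:R)^'] -->
    (v.1 * 'D_(evec 0) f x + v.2 * 'D_(evec 1) f x).
  by split; [apply/cvg_ex; eexists; exact: H|exact: cvg_lim H].
have ex (h : R) : exists st : R * R, [/\ st.1 \in `[0, 1], st.2 \in `[0, 1] &
    f (h *: v + x) - f x =
    (h * v.1) * 'D_(evec 0) f (x + (h * v.2) *: evec 1 + (st.1 * (h * v.1)) *: evec 0) +
    (h * v.2) * 'D_(evec 1) f (x + (st.2 * (h * v.2)) *: evec 1)].
  have [s s01 fs] := derive_MVT (x + (h * v.2) *: evec 1) (h * v.1) (df 0).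
  have [t t01 ft] := derive_MVT x (h * v.2) (df 1).
  exists (s, t); split => //=; rewrite -fs -ft.
  rewrite addrA subrK; congr (f _ - _).
  case: x v {fs ft} => [x1 x2] [v1 v2]; rewrite /evec /=.
  by apply: pt_eqP; rewrite /= /GRing.scale/=; ring.
have [st stP] := choice ex.
(* The intermediate parameters come from a choice and have no regularity in [h]; that [w] takes
   values in [0, 1] already forces convergence to [x]. *)
have st_lim (w : R -> R) (k : R) (d : 'I_2) (y : R -> pt R) :
    (forall h, w h \in `[0, 1]) -> y h @[h --> (0:R)^'] --> x ->
    y h + (w h * (h * k)) *: evec d @[h --> (0:R)^'] --> x.
  move=> w01 yx; rewrite -[X in _ --> X]addr0; apply: cvgD => //.
  rewrite -[X in _ --> X](scale0r (evec d)); apply: cvgZr_tmp.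
  apply/cvgr0Pnorm_le => /= e e0; near=> h.
  rewrite normrM (@le_trans _ _ `|h * k|)//.
    rewrite ler_piMl//; have := w01 h; rewrite in_itv/= => /andP[w0 w1].
    by rewrite ger0_norm.
  near: h.
  have : h * k @[h --> (0:R)^'] --> 0 * k.
    by apply: cvgMr_tmp; apply: cvg_within_filter; exact: cvg_id.
  by rewrite mul0r => /cvgr0Pnorm_le; apply.
apply: (@cvg_trans _ (v.1 * 'D_(evec 0) f (x + (h * v.2) *: evec 1 +
    ((st h).1 * (h * v.1)) *: evec 0) +
    v.2 * 'D_(evec 1) f (x + ((st h).2 * (h * v.2)) *: evec 1) @[h --> (0:R)^'])).
  apply: near_eq_cvg; near=> h.
  have h0 : h != 0 by near: h; exact: nbhs_dnbhs_neq.
  have [_ _ ->] := stP h.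
  by rewrite /GRing.scale /= mulrDr -!mulrA !mulKf.
apply: cvgD; apply: cvgMl_tmp.
  apply: (@cvg_comp _ _ _ _ ('D_(evec 0) f) _ (nbhs x)); last exact: cd.
  apply: (st_lim) => [h|]; first by have [] := stP h.
  rewrite (_ : (fun h => _) = fun h => x + (1 * (h * v.2)) *: evec 1); last first.
    by apply/funext => h; rewrite mul1r.
  apply: (st_lim); first by move=> _; rewrite in_itv/= ler01 lexx.
  exact: cvg_cst.
apply: (@cvg_comp _ _ _ _ ('D_(evec 1) f) _ (nbhs x)); last exact: cd.
apply: (st_lim) => [h|]; first by have [] := stP h.
exact: cvg_cst.
Unshelve. all: by end_near. Qed.

End directional.

(** * Measure and integration in the plane *)

Section plane_measurability.
Context {R : realType}.

(* An open set of the plane is the union of the countably many rational boxes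
   that it contains. *)
Lemma open_measurable_plane (A : set (pt R)) : open A -> measurable A.
Proof.
move=> oA.
pose I := ((rat * rat) * (rat * rat))%type.
pose B (i : I) : set (pt R) :=
  `]ratr i.1.1, ratr i.1.2[%classic `*` `]ratr i.2.1, ratr i.2.2[%classic.
pose F (i : I) := if `[< B i `<=` A >] then B i else set0.
have -> : A = \bigcup_i F i.
  apply/seteqP; split => [[x y] Axy|z [i _]]; last first.
    by rewrite /F; case: asboolP => // BA; exact: BA.
  have [e /= e0 eA] : nbhs_ball (x, y) A by apply/nbhs_ballP; exact: oA.
  have rat_near (t : R) : exists p : rat * rat, (ratr p.1 < t < ratr p.2) /\
      (forall s : R, ratr p.1 < s < ratr p.2 -> `|t - s| < e).
    have [|p] := @rat_in_itvoo R (t - e / 2) t; first by rewrite ltrBlDr ltrDl divr_gt0.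
    have [|q] := @rat_in_itvoo R t (t + e / 2); first by rewrite ltrDl divr_gt0.
    rewrite !in_itv /= => /andP[q1 q2] /andP[p1 p2]; exists (p, q) => /=.
    rewrite p2 q1; split => // s /andP[s1 s2].
    rewrite ltr_norml; apply/andP; split; lra.
  have [p [xp pe]] := rat_near x; have [q [yq qe]] := rat_near y.
  exists (p, q) => //; rewrite /F; case: asboolP => [_|].
    by split; rewrite /= in_itv.
  case=> -[s t] [/=]; rewrite !in_itv/= => /pe sp /qe tq; apply: eA.
  by split => /=; rewrite /ball/= .
apply: countable_bigcupT_measurable => [|i]; first exact: countableP.
rewrite /F; case: asboolP => _ //.
by apply: measurableX; exact: measurable_itv.
Qed.

Lemma continuous_measurable_plane (f : pt R -> R) :
  continuous f -> measurable_fun setT f.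
Proof.
move=> /continuousP cf; apply: (measurability _ (RGenOpens.measurableE R)).
move=> _ [_ [a [b ->] <-]]; rewrite setTI; apply: open_measurable_plane.
exact/cf/interval_open.
Qed.

End plane_measurability.

(** * Change of variables for maps that scale a measure by a constant *)

Section transfer.
Context d1 d2 (X : measurableType d1) (Y : measurableType d2) (R : realType).
Variables (m1 : {measure set X -> \bar R}) (m2 : {measure set Y -> \bar R}).
Variables (T : X -> Y) (c : R).
Hypotheses (mT : measurable_fun setT T) (c0 : 0 <= c).
Hypothesis m12 : forall A, measurable A -> m1 (T @^-1` A) = (c%:E * m2 A)%E.

Lemma ge0_integral_transfer D (f : Y -> \bar R) : measurable D ->
  measurable_fun D f -> (forall y, D y -> (0 <= f y)%E) ->
  (\int[m1]_(x in T @^-1` D) f (T x) = c%:E * \int[m2]_(y in D) f y)%E.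
Proof.
move=> mD mf f0.
rewrite -(ge0_integral_mscale m2 mD (NngNum c0) mf f0).
rewrite -(@ge0_integral_pushforward _ _ _ _ _ _ mT m1 D f) //; last first.
  by move=> y; rewrite inE => /f0.
apply: eq_measure_integral => A mA _; exact: m12.
Qed.

Lemma integrable_transfer D (f : Y -> \bar R) : measurable D ->
  m2.-integrable D f -> m1.-integrable (T @^-1` D) (fun x => f (T x)).
Proof.
move=> mD /integrableP[mf foo]; apply/integrableP; split.
  apply: (measurable_comp mD) => //.
    by move=> _ [x Dx <-].
  exact: measurable_funTS.
rewrite (@ge0_integral_transfer D (abse \o f))//.
  by rewrite lte_mul_pinfty// lee_fin.
- exact: measurableT_comp.
- by move=> y _; exact: abse_ge0.
Qed.

Lemma Rintegral_transfer D (f : Y -> R) : measurable D ->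
  m2.-integrable D (EFin \o f) ->
  \int[m1]_(x in T @^-1` D) f (T x) = c * \int[m2]_(y in D) f y.
Proof.
move=> mD fi; have /integrableP[mf _] := fi.
have fp := integrable_pos_fin_num mD fi.
have fn := integrable_neg_fin_num mD fi.
rewrite /Rintegral [in LHS]integralE [in RHS]integralE.
have Ep := @ge0_integral_transfer D _ mD (measurable_funepos mf)
  (fun y _ => funepos_ge0 _ y).
have En := @ge0_integral_transfer D _ mD (measurable_funeneg mf)
  (fun y _ => funeneg_ge0 _ y).
transitivity (fine (c%:E * \int[m2]_(y in D) ((EFin \o f)^\+)%E y -
    c%:E * \int[m2]_(y in D) ((EFin \o f)^\-)%E y)).
  rewrite -Ep -En; congr (fine (_ - _)%E); apply: eq_integral => x _.
    by rewrite !funeposE.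
  by rewrite !funenegE.
rewrite -[X in c * fine (X - _)]/(\int[m2]_(x in D) ((EFin \o f)^\+ x))%E.
rewrite -[X in c * fine (_ - X)]/(\int[m2]_(x in D) ((EFin \o f)^\- x))%E.
by rewrite -(fineK fp) -(fineK fn) -!EFinM -!EFinB /= mulrBr.
Qed.

End transfer.

(** * Effect of affine maps on Lebesgue measure *)

Section affine_change_of_variables.
Context {R : realType}.
Notation mu := (@lebesgue_measure R).

Lemma measurable_line_map (k c : R) :
  measurable_fun setT (fun y : measurableTypeR R => k * y + c : measurableTypeR R).
Proof.
apply: continuous_measurable_fun => y.
by apply: cvgD; [apply: cvgMl_tmp; exact: cvg_id|exact: cvg_cst].
Qed.

(** By uniqueness of Lebesgue measure it is enough that |k| times the image measure gives half-open
    intervals their length. For k < 0 the preimage of such an interval is closed at the other end,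
    which does not affect its length. *)
Lemma lebesgue_measure_affine (k c : R) (A : set R) : k != 0 -> measurable A ->
  mu ((fun y => k * y + c) @^-1` A) = (`|k|^-1%:E * mu A)%E.
Proof.
move=> k0 mA.
have k0' : (0 <= `|k|) by [].
pose f : measurableTypeR R -> measurableTypeR R := fun y => k * y + c.
have H : mu A = (`|k|%:E * mu (f @^-1` A))%E.
  pose m' : {measure set (measurableTypeR R) -> \bar R} :=
    mscale (NngNum k0') (pushforward mu f).
  apply: (lebesgue_measure_unique (mu := m' (measurable_line_map k c)) _ mA).
  move=> _ [[a b] _ <-].
  rewrite -[RHS]/(`|k|%:E * mu (f @^-1` `]a, b]%classic))%E.
  have [kn|kp|k00] := ltrgtP k 0; last by rewrite k00 eqxx in k0.
    rewrite (_ : f @^-1` _ = `[(b - c) / k, (a - c) / k[%classic); last first.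
      apply/funext => y; rewrite /= /f !in_itv/=; congr is_true.
      by rewrite ler_ndivrMr// ltr_ndivlMr// ![y * k]mulrC lerBrDr ltrBlDr andbC.
    rewrite !lebesgue_measure_itv/= !lte_fin ltr_nM2r ?invr_lt0// ltrD2r.
    case: ifPn => ab; last by rewrite mule0.
    rewrite -!EFinB -EFinM; congr EFin; rewrite ltr0_norm//.
    by field.
  rewrite (_ : f @^-1` _ = `](a - c) / k, (b - c) / k]%classic); last first.
    apply/funext => y; rewrite /= /f !in_itv/=; congr is_true.
    by rewrite ler_pdivlMr// ltr_pdivrMr// ![y * k]mulrC lerBrDr ltrBlDr.
  rewrite !lebesgue_measure_itv/= !lte_fin ltr_pM2r ?invr_gt0// ltrD2r.
  case: ifPn => ab; last by rewrite mule0.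
  rewrite -!EFinB -EFinM; congr EFin; rewrite gtr0_norm//.
  by field.
by rewrite H muleA -EFinM mulVf ?normr_eq0// mul1e.
Qed.

Lemma mu2_swap (A : set (pt R)) : measurable A ->
  mu2 ((fun x => (x.2, x.1)) @^-1` A) = mu2 A.
Proof.
move=> mA; pose T := (measurableTypeR R * measurableTypeR R)%type.
pose f : T -> T := fun x => (x.2, x.1).
have mf : measurable_fun setT f.
  by apply/measurable_fun_pairP; split; [exact: measurable_snd|exact: measurable_fst].
pose m' : {measure set T -> \bar R} := pushforward (mu \x mu)%E f.
apply: esym.
apply: (@product_measure_unique _ _ _ _ R mu mu (m' mf) _ A mA) => B C mB mC.
rewrite /= /pushforward (_ : f @^-1` _ = C `*` B).
  by rewrite product_measure1E// muleC.
by apply/seteqP; split => -[x y] [].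
Qed.

(** The product measure integrates the measures of vertical sections, and each section undergoes a
    one-dimensional affine map. *)
Lemma mu2_shear (k c e : R) (A : set (pt R)) : k != 0 -> measurable A ->
  mu2 ((fun x => (x.1, k * x.2 + c * x.1 + e)) @^-1` A) = (`|k|^-1%:E * mu2 A)%E.
Proof.
move=> k0 mA; rewrite /mu2 /product_measure1 -ge0_integralZl//; last first.
- exact: measurable_fun_xsection.
apply: eq_integral => x _ /=.
rewrite -(lebesgue_measure_affine (c * x + e) k0); last exact: measurable_xsection.
by congr (mu _); apply/seteqP; split => y; rewrite /xsection/= !inE/= addrA.
Qed.

Lemma measurable_affine (a b c : R) :
  measurable_fun setT (fun x : pt R => a + b * x.1 + c * x.2).
Proof. by apply: continuous_measurable_plane; exact: continuous_affine. Qed.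

Lemma measurable_affine_map (p u v : pt R) :
  measurable_fun setT (fun x : pt R => p + x.1 *: u + x.2 *: v).
Proof.
apply/measurable_fun_pairP; split.
  rewrite (_ : _ \o _ = fun x : pt R => p.1 + u.1 * x.1 + v.1 * x.2).
    exact: measurable_affine.
  by apply/funext => x; rewrite /= /GRing.scale/=; ring.
rewrite (_ : _ \o _ = fun x : pt R => p.2 + u.2 * x.1 + v.2 * x.2).
  exact: measurable_affine.
by apply/funext => x; rewrite /= /GRing.scale/=; ring.
Qed.

(** If u.1 is nonzero, the map factors, up to swaps of the coordinates, into two shears with factors
    u.1 and det / u.1. If u.1 = 0, then v.1 is nonzero, and swapping the coordinates of the argument
    exchanges [u] and [v]. *)
Lemma mu2_affine (p u v : pt R) (A : set (pt R)) :
  u.1 * v.2 - u.2 * v.1 != 0 -> measurable A ->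
  mu2 ((fun x => p + x.1 *: u + x.2 *: v) @^-1` A) =
  (`|u.1 * v.2 - u.2 * v.1|^-1%:E * mu2 A)%E.
Proof.
move: u v => [u1 u2] [v1 v2] /=.
wlog u10 : u1 u2 v1 v2 / u1 != 0 => [H det mA|det mA].
  have [u10|u10] := eqVneq u1 0; last exact: H.
  have v10 : v1 != 0.
    by apply/eqP => v10; move/eqP : det; apply; rewrite u10 v10; ring.
  rewrite (_ : u1 * v2 - u2 * v1 = - (v1 * u2 - v2 * u1)); last by ring.
  have det' : v1 * u2 - v2 * u1 != 0.
    by rewrite -oppr_eq0 opprB mulrC [v1 * _]mulrC.
  rewrite normrN -H// -mu2_swap.
    by congr (mu2 _); apply/seteqP; split => x /=; rewrite -!addrA [X in p + X]addrC.
  rewrite -[X in measurable X]setTI; apply: measurable_affine_map => //.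
pose d := (u1 * v2 - u2 * v1) / u1.
have d0 : d != 0 by rewrite mulf_neq0 ?invr_eq0.
pose S2 (x : pt R) : pt R := (x.1, d * x.2 + u2 / u1 * x.1 + (p.2 - u2 / u1 * p.1)).
have mS2 : measurable (S2 @^-1` A).
  rewrite -[X in measurable X]setTI.
  have : measurable_fun setT S2; last exact.
  apply/measurable_fun_pairP; split; first exact: measurable_fst.
  rewrite (_ : _ \o _ = fun x : pt R => (p.2 - u2 / u1 * p.1) + u2 / u1 * x.1 + d * x.2).
    exact: measurable_affine.
  by apply/funext => x; rewrite /=; ring.
have swapm (B : set (pt R)) : measurable B ->
    measurable ((fun x : pt R => (x.2, x.1)) @^-1` B).
  move=> mB; rewrite -[X in measurable X]setTI.
  have : measurable_fun setT (fun x : pt R => (x.2, x.1)); last exact.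
  by apply/measurable_fun_pairP; split; [exact: measurable_snd|exact: measurable_fst].
transitivity (`|u1|^-1%:E * mu2 (S2 @^-1` A))%E.
  rewrite -(mu2_swap mS2).
  rewrite -(mu2_shear v1 p.1 u10) ; last exact: swapm.
  rewrite -mu2_swap.
    congr (mu2 _); apply/funext => -[x y]; rewrite /= /S2/=; congr (A _).
    by apply: pt_eqP; rewrite /= /GRing.scale/= /d; field.
  rewrite -[X in measurable X]setTI; exact: measurable_affine_map.
rewrite mu2_shear// muleA -EFinM; congr (_%:E * _)%E.
by rewrite -invfM -normrM /d mulrC divfK.
Qed.

End affine_change_of_variables.

(** * Integration over the reference triangle *)

Section reference_triangle.
Context {R : realType}.
Notation mu := (@lebesgue_measure R).
Implicit Types (D : set (pt R)) (f : pt R -> R).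

Lemma bounded_subbox D : bounded_set D ->
  exists M : R, D `<=` `[- M, M]%classic `*` `[- M, M]%classic.
Proof.
move=> /ex_strict_bound_gt0 [M _ DM]; exists M => -[x y] /DM /=.
rewrite /Num.norm/= gt_max => /andP[xM yM].
by split; rewrite /= in_itv/= -ler_norml ltW.
Qed.

Lemma mu2_bounded_lty D : measurable D -> bounded_set D -> (mu2 D < +oo)%E.
Proof.
move=> mD /bounded_subbox[M DM].
have mB : measurable (`[- M, M]%classic `*` `[- M, M]%classic : set (pt R)).
  by apply: measurableX; exact: measurable_itv.
apply: (@le_lt_trans _ _ (mu2 (`[- M, M]%classic `*` `[- M, M]%classic))).
  by apply: le_measure; rewrite ?inE.
rewrite /mu2 product_measure1E//= !lebesgue_measure_itv/=.
by case: ifP => _; rewrite ?mule0// -EFinB -EFinM ltry.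
Qed.

Lemma bounded_continuous_image D f : bounded_set D -> continuous f ->
  exists M : R, forall x, D x -> `|f x| <= M.
Proof.
move=> /bounded_subbox[M DM] cf.
have cB : compact (`[- M, M]%classic `*` `[- M, M]%classic : set (pt R)).
  by apply: compact_setX; exact: segment_compact.
have /compact_bounded /ex_strict_bound_gt0 [N _ fN] :=
  continuous_compact (continuous_subspaceT cf) cB.
by exists N => x /DM Bx; apply/ltW/fN; exists x.
Qed.

Lemma bounded_continuous_integrable D f : measurable D -> bounded_set D ->
  continuous f -> mu2.-integrable D (EFin \o f).
Proof.
move=> mD bD cf; apply: measurable_bounded_integrable => //.
- exact: mu2_bounded_lty.
- by apply: measurable_funTS; exact: continuous_measurable_plane.
have [M fM] := bounded_continuous_image bD cf.
exists M; split; first exact: num_real.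
by move=> N MN x Dx /=; rewrite (le_trans (fM _ Dx))// ltW.
Qed.

Definition ref_tri : set (pt R) := [set x | [/\ 0 < x.1, 0 < x.2 & x.1 + x.2 < 1]].

Lemma open_affine_gt0 (a b c : R) : open [set x : pt R | 0 < a + b * x.1 + c * x.2].
Proof.
apply: (@open_comp _ _ (fun x : pt R => a + b * x.1 + c * x.2) [set y | 0 < y]).
  by move=> x _; exact: continuous_affine.
exact: open_gt.
Qed.

Lemma measurable_ref_tri : measurable ref_tri.
Proof.
rewrite (_ : ref_tri = [set x | 0 < 0 + 1 * x.1 + 0 * x.2] `&`
  [set x | 0 < 0 + 0 * x.1 + 1 * x.2] `&` [set x | 0 < 1 + -1 * x.1 + -1 * x.2]).
  by do 2?apply: measurableI; apply: open_measurable_plane; exact: open_affine_gt0.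
apply/seteqP; split => -[x y]; rewrite /ref_tri /=.
  by move=> [? ? ?]; split; [split|]; lra.
by move=> [[? ?] ?]; split; lra.
Qed.

Lemma bounded_ref_tri : bounded_set ref_tri.
Proof.
exists 1; split; first exact: num_real.
move=> M M1 z [z1 z2 z12]; rewrite /= /Num.norm/= ge_max !gtr0_norm//.
by apply/andP; split; lra.
Qed.

Lemma ref_tri_swap (x : pt R) : ref_tri (x.2, x.1) = ref_tri x.
Proof. by apply/propext; split => -[? ? /=]; rewrite addrC. Qed.

Lemma Rintegral_ref_slices (f : pt R -> R) (h : R -> R) : continuous f ->
  (forall y : R, 0 < y < 1 ->
    (\int[mu]_(x in `]0%R, (1 - y)%R[) (f (x, y))%:E)%E = (h y)%:E) ->
  \int[mu2]_(x in ref_tri) f x = \int[mu]_(y in `]0, 1[) h y.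
Proof.
move=> cf fh.
have fi := bounded_continuous_integrable measurable_ref_tri bounded_ref_tri cf.
rewrite [LHS]Rintegral_mkcond [RHS]Rintegral_mkcond /Rintegral; congr fine.
have gi : mu2.-integrable setT (EFin \o (f \_ ref_tri)).
  by rewrite -restrict_EFin; apply/(@integrable_mkcond _ _ _ mu2 _ _ measurable_ref_tri).
rewrite -[LHS](@integral21_prod_meas1 _ _ _ _ R mu mu _ gi); apply: eq_integral => y _.
rewrite /fubini_G /= [in RHS]patchE mem_setE in_itv/=.
case: ifPn => [y01|y01].
  rewrite -fh// [in RHS]integral_mkcond; apply: eq_integral => x _.
  rewrite !patchE !mem_setE in_itv/=.
  case: ifPn => [|xy].
    by rewrite inE => -[/= ? ? ?]; case: ifPn => // /negP[]; apply/andP; split; lra.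
  case: ifPn => // /andP[? ?]; case/negP : xy; rewrite inE; split => /=; lra.
rewrite integral0_eq// => x _; rewrite patchE; case: ifPn => //.
by rewrite inE => -[/= ? ? ?]; case/negP : y01; apply/andP; split; lra.
Qed.

Lemma itvoo_FTC (F dF : R -> R) (a b : R) : a < b ->
  (forall x : R, is_derive x (1 : R) F (dF x)) -> continuous dF ->
  (\int[mu]_(x in `]a, b[) (dF x)%:E)%E = (F b - F a)%:E.
Proof.
move=> ab F' cdF.
have mdF : measurable_fun setT (EFin \o dF).
  by apply/measurable_EFinP; exact: continuous_measurable_fun.
have cF : continuous F.
  by move=> x; apply/differentiable_continuous/derivable1_diffP; case: (F' x).
rewrite integral_itv_obnd_cbnd; last exact: measurable_funTS.
rewrite integral_itv_bndo_bndc; last exact: measurable_funTS.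
rewrite (@continuous_FTC2 _ _ F)//.
- exact: continuous_subspaceT.
- split => [x _| |]; first by case: (F' x).
    by apply: cvg_at_right_filter; exact: cF.
  by apply: cvg_at_left_filter; exact: cF.
- by move=> x _; rewrite derive1E; case: (F' x).
Qed.

Lemma continuous_slice1 f (y : R) : continuous f -> continuous (fun x => f (x, y)).
Proof.
move=> cf x; apply: (@continuous_comp _ _ _ (fun x : R => (x, y)) f); last exact: cf.
by apply: continuous_pt => ?; [exact: cvg_id|exact: cvg_cst].
Qed.

(** The integrand is the derivative of x.1 W in the first variable. This product vanishes on the leg
    x.1 = 0, so each horizontal slice leaves only its end point on the hypotenuse. *)
Lemma Rintegral_ref_div1 W : Cn 1 W ->
  \int[mu2]_(x in ref_tri) (W x + x.1 * 'D_(evec 0) W x) =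
  \int[mu]_(y in `]0, 1[) ((1 - y) * W (1 - y, y)).
Proof.
move=> CW; have cW := Cn_continuous CW.
have cdW := Cn_continuous (Cn_derive 0 CW).
apply: Rintegral_ref_slices => [x|y /andP[y0 y1]].
  apply: cvgD; first exact: cW.
  by apply: cvgM; [exact: cvg_fst|exact: cdW].
apply: (etrans (@itvoo_FTC (fun x => x * W (x, y))
  (fun x => W (x, y) + x * 'D_(evec 0) W (x, y)) 0 (1 - y) _ _ _)).
- by rewrite subr_gt0.
- move=> x; have dW : is_derive x 1 (fun x => W (x, y)) ('D_(evec 0) W (x, y)).
    have /is_derive_lineE D := derivableP (@Cn_derivable _ _ _ 0 (x, y) CW).
    rewrite (_ : (fun _ => _) = (fun h : R => W (h *: evec 0 + (x, y))) \o (fun t => t - x)).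
      rewrite -['D_(evec 0) W (x, y)]mulr1; apply: is_derive1_comp.
        by rewrite subrr.
      by apply: is_derive_eq; rewrite subr0.
    apply/funext => t /=; congr W; apply: pt_eqP; rewrite /= /GRing.scale/=; ring.
  apply: is_derive_eq; rewrite /GRing.scale/= mulr1; ring.
- move=> x; apply: cvgD; first exact: continuous_slice1.
  by apply: cvgM; [exact: cvg_id|exact: (continuous_slice1 cdW)].
- by rewrite mul0r subr0.
Qed.

Lemma Rintegral01_flip (h : R -> R) : mu.-integrable `[0, 1] (EFin \o h) ->
  \int[mu]_(y in `[0, 1]) h (1 - y) = \int[mu]_(y in `[0, 1]) h y.
Proof.
move=> hi; rewrite -[RHS]mul1r.
have m1 : measurable_fun setT (fun y : measurableTypeR R => -1 * y + 1 : measurableTypeR R).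
  exact: measurable_line_map.
have H A : measurable A ->
    mu ((fun y : measurableTypeR R => -1 * y + 1) @^-1` A) = (1%:E * mu A)%E.
  by move=> mA; rewrite lebesgue_measure_affine ?oppr_eq0 ?oner_eq0// normrN1 invr1.
rewrite -(Rintegral_transfer m1 ler01 H _ hi)//.
rewrite (_ : _ @^-1` _ = `[0, 1]%classic); last first.
  by apply/funext => y /=; rewrite !in_itv/=; congr is_true; apply/andP/andP; split; lra.
by apply: eq_Rintegral => y _; congr h; ring.
Qed.

Lemma Rintegral_ref_swap f : continuous f ->
  \int[mu2]_(x in ref_tri) f (x.2, x.1) = \int[mu2]_(x in ref_tri) f x.
Proof.
move=> cf; rewrite -[RHS]mul1r.
have m1 : measurable_fun setT (fun x : pt R => (x.2, x.1)).
  by apply/measurable_fun_pairP; split; [exact: measurable_snd|exact: measurable_fst].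
have H A : measurable A -> mu2 ((fun x : pt R => (x.2, x.1)) @^-1` A) = (1%:E * mu2 A)%E.
  by move=> mA; rewrite mu2_swap// mul1e.
rewrite -(@Rintegral_transfer _ _ _ _ R mu2 mu2 _ 1 m1 ler01 H _ f measurable_ref_tri); last first.
  exact: bounded_continuous_integrable measurable_ref_tri bounded_ref_tri cf.
by congr Rintegral; apply/funext => x; rewrite /= ref_tri_swap.
Qed.

Lemma Rintegral_ref_div2 W : Cn 1 W ->
  \int[mu2]_(x in ref_tri) (W x + x.2 * 'D_(evec 1) W x) =
  \int[mu]_(y in `]0, 1[) ((1 - y) * W (y, 1 - y)).
Proof.
move=> CW; have cW := Cn_continuous CW.
have cdW := Cn_continuous (Cn_derive 1 CW).
have cswap : continuous (fun x : pt R => (x.2, x.1)).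
  by apply: continuous_pt => ?; [exact: cvg_snd|exact: cvg_fst].
rewrite -Rintegral_ref_swap; last first.
  move=> x; apply: cvgD; first exact: cW.
  by apply: cvgM; [exact: cvg_snd|exact: cdW].
apply: Rintegral_ref_slices => [x|y /andP[y0 y1]] /=.
  apply: cvgD.
    by apply: (@continuous_comp _ _ _ (fun x : pt R => (x.2, x.1)) W); [exact: cswap|exact: cW].
  apply: cvgM; first exact: cvg_fst.
  by apply: (@continuous_comp _ _ _ (fun x : pt R => (x.2, x.1)) ('D_(evec 1) W));
    [exact: cswap|exact: cdW].
apply: (etrans (@itvoo_FTC (fun x => x * W (y, x))
  (fun x => W (y, x) + x * 'D_(evec 1) W (y, x)) 0 (1 - y) _ _ _)).
- by rewrite subr_gt0.
- move=> x; have dW : is_derive x 1 (fun x => W (y, x)) ('D_(evec 1) W (y, x)).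
    have /is_derive_lineE D := derivableP (@Cn_derivable _ _ _ 1 (y, x) CW).
    rewrite (_ : (fun _ => _) = (fun h : R => W (h *: evec 1 + (y, x))) \o (fun t => t - x)).
      rewrite -['D_(evec 1) W (y, x)]mulr1; apply: is_derive1_comp.
        by rewrite subrr.
      by apply: is_derive_eq; rewrite subr0.
    apply/funext => t /=; congr W; apply: pt_eqP; rewrite /= /GRing.scale/=; ring.
  apply: is_derive_eq; rewrite /GRing.scale/= mulr1; ring.
- have cslice f : continuous f -> continuous (fun x => f (y, x)).
    move=> cf x; apply: (@continuous_comp _ _ _ (fun x : R => (y, x)) f); last exact: cf.
    by apply: continuous_pt => ?; [exact: cvg_cst|exact: cvg_id].
  move=> x; apply: cvgD; first exact: cslice.
  by apply: cvgM; [exact: cvg_id|exact: (cslice _ cdW)].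
- by rewrite mul0r subr0.
Qed.

Lemma continuous_itv_integrable (h : R -> R) : continuous h ->
  mu.-integrable `[0, 1] (EFin \o h).
Proof.
move=> ch; apply: continuous_compact_integrable; first exact: segment_compact.
exact: continuous_subspaceT.
Qed.

(* The divergence theorem on the reference triangle for the field x W(x), whose
   normal component vanishes on the two legs. *)
Lemma Rintegral_ref_radial W : Cn 1 W ->
  \int[mu2]_(x in ref_tri)
    (2 * W x + (x.1 * 'D_(evec 0) W x + x.2 * 'D_(evec 1) W x)) =
  \int[mu]_(s in `[0, 1]) W (1 - s, s).
Proof.
move=> CW; have cW := Cn_continuous CW.
have cd d := Cn_continuous (Cn_derive d CW).
have ci f : continuous f -> mu2.-integrable ref_tri (EFin \o f).
  exact: bounded_continuous_integrable measurable_ref_tri bounded_ref_tri.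
pose p1 s : R := (1 - s) * W (1 - s, s).
pose p2 s : R := s * W (1 - s, s).
have cWs : continuous (fun s : R => W (1 - s, s)).
  move=> s; apply: (@continuous_comp _ _ _ (fun s : R => (1 - s, s)) W); last exact: cW.
  by apply: continuous_pt => ?; [apply: cvgB; [exact: cvg_cst|exact: cvg_id]|exact: cvg_id].
have ip1 : mu.-integrable `[0, 1] (EFin \o p1).
  apply: continuous_itv_integrable => s; apply: cvgM; last exact: cWs.
  by apply: cvgB; [exact: cvg_cst|exact: cvg_id].
have ip2 : mu.-integrable `[0, 1] (EFin \o p2).
  by apply: continuous_itv_integrable => s; apply: cvgM; [exact: cvg_id|exact: cWs].
have oc (h : R -> R) : mu.-integrable `[0, 1] (EFin \o h) ->
    \int[mu]_(s in `]0, 1[) h s = \int[mu]_(s in `[0, 1]) h s.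
  move=> hi; rewrite Rintegral_itv_obnd_cbnd ?Rintegral_itv_bndo_bndc//.
    by apply: integrableS hi => // s /=; rewrite !in_itv/= => /andP[-> /ltW ->].
  by apply: integrableS hi => // s /=; rewrite !in_itv/= => /andP[/ltW -> /ltW ->].
transitivity (\int[mu2]_(x in ref_tri) (W x + x.1 * 'D_(evec 0) W x) +
   \int[mu2]_(x in ref_tri) (W x + x.2 * 'D_(evec 1) W x)).
  rewrite -RintegralD; first by apply: eq_Rintegral => x _; ring.
  - exact: measurable_ref_tri.
  - by apply: ci => x; apply: cvgD; [exact: cW|apply: cvgM; [exact: cvg_fst|exact: cd]].
  - by apply: ci => x; apply: cvgD; [exact: cW|apply: cvgM; [exact: cvg_snd|exact: cd]].
rewrite Rintegral_ref_div1// Rintegral_ref_div2// oc//.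
(* The second integral runs along the hypotenuse in the opposite direction. The substitution y -> 1
   - y aligns it with the first, and the weights 1 - s and s then add up to 1. *)
rewrite [X in _ + X](_ : _ = \int[mu]_(s in `[0, 1]) p2 s).
  by rewrite -RintegralD//; apply: eq_Rintegral => s _; rewrite /p1 /p2; ring.
rewrite -(Rintegral01_flip ip2) -oc.
  by apply: eq_Rintegral => s _; rewrite /p2 subKr.
apply: continuous_itv_integrable => s; apply: cvgM.
  by apply: cvgB; [exact: cvg_cst|exact: cvg_id].
apply: (@continuous_comp _ _ _ (fun s : R => 1 - s) (fun s => W (1 - s, s))); last exact: cWs.
by apply: cvgB; [exact: cvg_cst|exact: cvg_id].
Qed.

End reference_triangle.

(** * Green's formula on a triangle *)

Section barycentric.
Context {R : realType}.
Implicit Types (v : triangle R) (i j : 'I_3) (x u : pt R).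

Lemma I3P (P : 'I_3 -> Prop) : P 0 -> P 1 -> P 2 -> forall i, P i.
Proof.
move=> P0 P1 P2 [[|[|[|//]]] ilt].
- by rewrite (_ : Ordinal ilt = 0)//; exact: val_inj.
- by rewrite (_ : Ordinal ilt = 1)//; exact: val_inj.
- by rewrite (_ : Ordinal ilt = 2)//; exact: val_inj.
Qed.

Lemma I3E : (((0 + 1)%R = 1%R :> 'I_3) *
  ((0 + 2)%R = 2%R :> 'I_3) *
  ((1 + 1)%R = 2%R :> 'I_3) *
  ((1 + 2)%R = 0%R :> 'I_3) *
  ((2 + 1)%R = 0%R :> 'I_3) *
  ((2 + 2)%R = 1%R :> 'I_3))%type.
Proof. by do !split; exact: val_inj. Qed.

Lemma sum_I3 (V : nmodType) (F : 'I_3 -> V) : \sum_i F i = F 0 + F 1 + F 2.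
Proof.
rewrite !big_ord_recl big_ord0 addr0 addrA.
by congr (F _ + F _ + F _); exact: val_inj.
Qed.

Lemma I2P (P : 'I_2 -> Prop) : P 0 -> P 1 -> forall d, P d.
Proof.
move=> P0 P1 [[|[|//]] ilt].
- by rewrite (_ : Ordinal ilt = 0)//; exact: val_inj.
- by rewrite (_ : Ordinal ilt = 1)//; exact: val_inj.
Qed.

Definition cross (x u : pt R) : R := x.1 * u.2 - x.2 * u.1.

(** The i-th barycentric coordinate, as a quotient of signed areas: the triangle spanned by [x] and
    edge i over [v] itself. The signs cancel, so it is positive inside for either orientation of
    [v]. *)
Definition bary v i x : R := cross (tgt v i - src v i) (x - src v i) / orient v.

Lemma bary_affine v i : exists a b c : R, forall x, bary v i x = a + b * x.1 + c * x.2.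
Proof.
pose t := tgt v i - src v i.
exists (- (t.1 * (src v i).2 - t.2 * (src v i).1) / orient v), (- t.2 / orient v), (t.1 / orient v).
by move=> x; rewrite /bary /cross -/t /=; ring.
Qed.

Lemma sum_bary v x : orient v != 0 -> \sum_i bary v i x = 1.
Proof.
rewrite sum_I3 /bary /cross /src /tgt !I3E /orient /=.
by move=> o0; field.
Qed.

Lemma sum_bary_vertex v x : orient v != 0 -> \sum_i bary v i x *: v i = x.
Proof.
rewrite sum_I3 /bary /cross /src /tgt !I3E /orient /= => o0.
by apply: pt_eqP; rewrite /= /GRing.scale/=; field.
Qed.

Lemma bary_sum v (l : 'I_3 -> R) i : orient v != 0 -> \sum_j l j = 1 ->
  bary v i (\sum_j l j *: v j) = l i.
Proof.
move=> o0; rewrite !sum_I3 => l1.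
have l0 : l 0 = 1 - l 1 - l 2 by rewrite -l1; ring.
move: i; apply: I3P; rewrite /bary /cross /src /tgt !I3E /= /GRing.scale/= l0;
  move: o0; rewrite /orient /= => o0; field => //.
Qed.

(** This replaces the existential weights in [tri] by explicit affine functions, so that an open
    triangle becomes an intersection of half-planes. *)
Lemma tri_bary v x : orient v != 0 -> tri v x <-> forall i, 0 < bary v i x.
Proof.
move=> o0; split => [[l [l0 l1 ->]] i|bx]; first by rewrite bary_sum.
by exists (bary v ^~ x); split => //; rewrite ?sum_bary ?sum_bary_vertex.
Qed.

Lemma hull_bary v x : orient v != 0 -> hull v setT x <-> forall i, 0 <= bary v i x.
Proof.
move=> o0; split => [[l [l0 _ l1 ->]] i|bx]; first by rewrite bary_sum.
by exists (bary v ^~ x); split => //; rewrite ?sum_bary ?sum_bary_vertex// => j [].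
Qed.

Lemma open_tri v : orient v != 0 -> open (tri v).
Proof.
move=> o0; have ob i : open [set x | 0 < bary v i x].
  have [a [b [c E]]] := bary_affine v i.
  rewrite (_ : [set x | _] = [set x | 0 < a + b * x.1 + c * x.2]).
    exact: open_affine_gt0.
  by apply/funext => x /=; rewrite E.
rewrite (_ : tri v = [set x | 0 < bary v 0 x] `&` [set x | 0 < bary v 1 x] `&`
    [set x | 0 < bary v 2 x]).
  by do 2?apply: openI.
apply/seteqP; split => x; first by move/(tri_bary _ o0) => bx; do 2?split; apply: bx.
by move=> [[b0 b1] b2]; apply/tri_bary => //; exact: I3P.
Qed.

Lemma measurable_tri v : orient v != 0 -> measurable (tri v).
Proof. by move=> o0; apply: open_measurable_plane; exact: open_tri. Qed.

Lemma bounded_hull v (J : set 'I_3) : bounded_set (hull v J).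
Proof.
exists (\sum_i `|v i|); split; first exact: num_real.
move=> M vM x [l [l0 _ l1 ->]] /=.
rewrite (le_trans _ (ltW vM))// (le_trans (ler_norm_sum _ _ _))// ler_sum// => i _.
rewrite normrZ ler_piMl// ger0_norm// -l1 (bigD1 i)//= lerDl sumr_ge0//.
Qed.

Lemma tri_hull v : tri v `<=` hull v setT.
Proof. by move=> x [l [l0 l1 ->]]; exists l; split => // j; [exact: ltW|case]. Qed.

Lemma bounded_tri v : bounded_set (tri v).
Proof. by apply: sub_boundedr (bounded_hull v setT) => A; apply: subset_trans; exact: tri_hull. Qed.

Lemma orientE v i : orient v = cross (src v i - v i) (tgt v i - v i).
Proof.
by move: i; apply: I3P; rewrite /orient /cross /src /tgt !I3E /=; ring.
Qed.

(** Convertible to the parametrizations inside [seg_int] and [is_trace], which are folded into this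
    name. *)
Definition edge_pt v i (s : R) : pt R := src v i + s *: (tgt v i - src v i).

(** The origin goes to vertex i and the hypotenuse to edge i, so that the field x on the reference
    triangle becomes the radial field around [v i]. *)
Definition ref_map v i x : pt R :=
  v i + x.1 *: (src v i - v i) + x.2 *: (tgt v i - v i).

Lemma ref_map_tri v i : orient v != 0 -> ref_map v i @^-1` tri v = ref_tri.
Proof.
move=> o0; apply/funext => x; apply/propext.
have b1 : bary v (i + 1) (ref_map v i x) = x.1.
  rewrite /bary /cross /ref_map /orient in o0 *; move: i.
  apply: I3P; rewrite /bary /cross /src /tgt !I3E /= /GRing.scale/=; by field.
have b2 : bary v (i + 2) (ref_map v i x) = x.2.
  rewrite /bary /cross /ref_map /orient in o0 *; move: i {b1}.
  apply: I3P; rewrite /bary /cross /src /tgt !I3E /= /GRing.scale/=; by field.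
have b0 : bary v i (ref_map v i x) = 1 - x.1 - x.2.
  have := sum_bary (ref_map v i x) o0; rewrite sum_I3 -b1 -b2 => <-.
  by move: (i) {b1 b2}; apply: I3P; rewrite !I3E; ring.
split => [/(tri_bary _ o0) bx|[x1 x2 x12]].
  have := bx i; have := bx (i + 1); have := bx (i + 2); rewrite b0 b1 b2.
  by move=> ? ? ?; split => //; lra.
apply/tri_bary => // j; have : j = i \/ j = i + 1 \/ j = i + 2.
  by move: i j {b0 b1 b2}; apply: I3P; apply: I3P; rewrite !I3E; auto.
by move=> [->|[->|->]]; rewrite ?b0 ?b1 ?b2//; lra.
Qed.

End barycentric.

(** * Divergence theorem for radial fields *)

Section radial.
Context {R : realType}.
Notation mu := (@lebesgue_measure R).
Implicit Types (v : triangle R) (i : 'I_3) (F : pt R -> R).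

Lemma continuous_affine_map (p u w : pt R) :
  continuous (fun x : pt R => p + x.1 *: u + x.2 *: w).
Proof.
rewrite (_ : (fun _ => _) = fun x : pt R =>
    (p.1 + u.1 * x.1 + w.1 * x.2, p.2 + u.2 * x.1 + w.2 * x.2)).
  by apply: continuous_pt; exact: continuous_affine.
by apply/funext => x; apply: pt_eqP; rewrite /= /GRing.scale/=; ring.
Qed.

Lemma continuous_comp_affine_map F (p u w : pt R) : continuous F ->
  continuous (fun x : pt R => F (p + x.1 *: u + x.2 *: w)).
Proof.
move=> cF x; apply: (@continuous_comp _ _ _ (fun x : pt R => p + x.1 *: u + x.2 *: w) F).
  exact: continuous_affine_map.
exact: cF.
Qed.

Lemma is_derive_comp_affine_map F (p u w x : pt R) (d : 'I_2) : Cn 1 F ->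
  let T (y : pt R) : pt R := p + y.1 *: u + y.2 *: w in
  let e := if d == 0 then u else w in
  is_derive x (evec d) (fun y => F (T y))
    (e.1 * 'D_(evec 0) F (T x) + e.2 * 'D_(evec 1) F (T x)).
Proof.
move=> CF T e; apply: is_derive_line.
have /is_derive_lineE := is_derive_C1 (T x) e CF.
congr is_derive; apply/funext => h; congr F; rewrite /T /e /evec.
case: ifP => _; apply: pt_eqP; rewrite /= /GRing.scale/=; ring.
Qed.

Lemma C1_comp_affine_map F (p u w : pt R) : Cn 1 F ->
  Cn 1 (fun x : pt R => F (p + x.1 *: u + x.2 *: w)).
Proof.
move=> CF; have D x d := is_derive_comp_affine_map p u w x d CF.
have cd d := Cn_continuous (Cn_derive d CF).
split; first exact: continuous_comp_affine_map (Cn_continuous CF).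
move=> d; split => [x|]; first by case: (D x d).
split => //; rewrite (_ : 'D_(evec d) _ = fun x =>
   (if d == 0 then u else w).1 * 'D_(evec 0) F (p + x.1 *: u + x.2 *: w) +
   (if d == 0 then u else w).2 * 'D_(evec 1) F (p + x.1 *: u + x.2 *: w)).
  move=> x; apply: cvgD; apply: cvgMl_tmp.
    exact: (@continuous_comp_affine_map _ p u w (cd 0) x).
  exact: (@continuous_comp_affine_map _ p u w (cd 1) x).
by apply/funext => x; case: (D x d).
Qed.

(** The integrand is the divergence of (x - v i) F. This field is tangential on the two edges
    through [v i]; on edge i the normal component of x - v i is the height of the triangle, and
    height times edge length is [|orient v|]. *)
Lemma Rintegral_tri_radial v i F : orient v != 0 -> Cn 1 F ->
  \int[mu2]_(x in tri v) (2 * F x + ((x.1 - (v i).1) * 'D_(evec 0) F x +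
    (x.2 - (v i).2) * 'D_(evec 1) F x)) =
  `|orient v| * \int[mu]_(s in `[0, 1]) F (edge_pt v i s).
Proof.
move=> o0 CF; have cF := Cn_continuous CF.
have cd d := Cn_continuous (Cn_derive d CF).
have o0' : `|orient v| != 0 by rewrite normr_eq0.
set G := fun x : pt R => _ + _.
have cG : continuous G.
  move=> x; apply: cvgD; first by apply: cvgMl_tmp; exact: cF.
  by apply: cvgD; apply: cvgM; try exact: cd; apply: cvgB;
    [exact: cvg_fst|exact: cvg_cst|exact: cvg_snd|exact: cvg_cst].
have H A : measurable A ->
    mu2 (ref_map v i @^-1` A) = (`|orient v|^-1%:E * mu2 A)%E.
  move=> mA; rewrite mu2_affine//; last by move: o0; rewrite (orientE v i).
  by rewrite (orientE v i).
have := @Rintegral_transfer _ _ _ _ R mu2 mu2 (ref_map v i) `|orient v|^-1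
  (measurable_affine_map _ _ _) _ H (tri v) G (measurable_tri o0)
  (bounded_continuous_integrable (measurable_tri o0) (bounded_tri v) cG).
rewrite invr_ge0 normr_ge0 => /(_ isT); rewrite ref_map_tri// => E.
apply: (mulfI (x := `|orient v|^-1)); first by rewrite invr_eq0.
rewrite -E mulKf//.
pose W x := F (ref_map v i x).
have CW : Cn 1 W by exact: C1_comp_affine_map.
transitivity (\int[mu]_(s in `[0, 1]) W (1 - s, s)); last first.
  apply: eq_Rintegral => s _; rewrite /W /ref_map /edge_pt; congr F.
  by apply: pt_eqP; rewrite /= /GRing.scale/=; ring.
rewrite -[RHS](Rintegral_ref_radial CW); apply: eq_Rintegral => x _.
have D d : 'D_(evec d) W x = _ :=
  derive_val (is_derive := is_derive_comp_affine_map (v i) (src v i - v i) (tgt v i - v i) x d CF).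
rewrite !D /G /W /= -/(ref_map v i x).
rewrite (_ : (ref_map v i x).1 - (v i).1 =
    x.1 * ((src v i).1 - (v i).1) + x.2 * ((tgt v i).1 - (v i).1)).
  rewrite (_ : (ref_map v i x).2 - (v i).2 =
      x.1 * ((src v i).2 - (v i).2) + x.2 * ((tgt v i).2 - (v i).2)).
    ring.
  by rewrite /ref_map /= /GRing.scale/=; ring.
by rewrite /ref_map /= /GRing.scale/=; ring.
Qed.

End radial.

(** * From L^2 convergence to convergence of integrals *)

Section L2_convergence.
Context d (T : measurableType d) (R : realType) (m : {measure set T -> \bar R}).
Variables (D : set T) (mD : measurable D) (Doo : (m D < +oo)%E).
Implicit Types f psi : T -> R.

(** A linear substitute for Cauchy-Schwarz: integrated over a set of finite measure, it bounds the
    L^1 norm by the integral of the square, with a free parameter [e] and no square root of an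
    extended real. *)
Lemma le_Young (e y : R) : 0 < e -> `|y| <= e + e^-1 * y ^+ 2.
Proof.
move=> e0; have ei : 0 < e^-1 by rewrite invr_gt0.
have [ye|ey] := leP `|y| e.
  by rewrite (le_trans ye)// lerDl mulr_ge0 ?sqr_ge0// ltW.
apply: (@le_trans _ _ (e^-1 * y ^+ 2)); last by rewrite lerDr ltW.
by rewrite ler_pdivlMl// -real_normK ?num_real// expr2 ler_wpM2r// ltW.
Qed.

Lemma le_L1_L2 f (e : R) : 0 < e -> measurable_fun D f ->
  (\int[m]_(x in D) `|f x|%:E <=
   e%:E * m D + e^-1%:E * \int[m]_(x in D) (f x ^+ 2)%:E)%E.
Proof.
move=> e0 mf; have ei : 0 <= e^-1 by rewrite invr_ge0 ltW.
have mf2 : measurable_fun D (fun x => (f x ^+ 2)%:E).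
  by apply/measurable_EFinP; exact: measurable_funX.
rewrite -integral_cst// -ge0_integralZl//=; last by move=> x _; rewrite lee_fin sqr_ge0.
rewrite -ge0_integralD//=; last 3 first.
- by move=> x _; rewrite lee_fin ltW.
- by move=> x _; rewrite -EFinM lee_fin mulr_ge0// sqr_ge0.
- exact: measurable_funeM.
apply: ge0_le_integral => //=.
- by apply/measurable_EFinP; exact: measurableT_comp.
- by apply: emeasurable_funD; [exact: measurable_cst|exact: measurable_funeM].
- by move=> x _; rewrite -EFinM -EFinD lee_fin; exact: le_Young.
Qed.

Lemma L2_integrable f : measurable_fun D f ->
  (\int[m]_(x in D) (f x ^+ 2)%:E < +oo)%E -> m.-integrable D (EFin \o f).
Proof.
move=> mf f2; apply/integrableP; split; first exact/measurable_EFinP.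
apply: (le_lt_trans (le_L1_L2 ltr01 mf)).
by rewrite invr1 !mul1e lte_add_pinfty.
Qed.

Lemma Rintegral_cvg_L2 (u : nat -> T -> R) f psi (M : R) :
  (forall n, m.-integrable D (EFin \o u n)) ->
  m.-integrable D (EFin \o f) ->
  (\int[m]_(x in D) ((u n x - f x) ^+ 2)%:E)%E @[n --> \oo] --> 0%E ->
  measurable_fun D psi -> (forall x, D x -> `|psi x| <= M) ->
  \int[m]_(x in D) (u n x * psi x) @[n --> \oo] --> \int[m]_(x in D) (f x * psi x).
Proof.
move=> ui fi uf mpsi psiM.
have bpsi : [bounded psi x | x in D].
  exists M; split; first exact: num_real.
  by move=> N MN x Dx /=; rewrite (le_trans (psiM _ Dx))// ltW.
have ipsi g : m.-integrable D (EFin \o g) ->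
    m.-integrable D (EFin \o (fun x => g x * psi x)).
  by move=> gi; apply: (integrableMl mD gi mpsi bpsi).
have M1 : 0 < `|M| + 1 by rewrite ltr_wpDl.
have [mu0 muE] : 0 <= fine (m D) /\ m D = (fine (m D))%:E.
  by split; [rewrite fine_ge0|rewrite fineK// ge0_fin_numE].
set c := fine (m D) in mu0 muE.
apply/cvgrPdist_le => /= e e0.
(* [k] and the tolerance for the L^2 error below are chosen so that each of the two terms of
   [le_L1_L2] is at most e / (2 (|M| + 1)). Adding 1 to |M| and to [c] keeps the denominators
   positive. *)
pose k := e / (2 * (`|M| + 1) * (c + 1)).
have c1 : 0 < c + 1 by rewrite ltr_wpDl.
have k0 : 0 < k by rewrite divr_gt0// !mulr_gt0.
have /fine_cvgP[ufin /cvgr0Pnorm_le ufine] := uf.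
near=> n.
have a_fin : (\int[m]_(x in D) ((u n x - f x) ^+ 2)%:E)%E \is a fin_num.
  by near: n.
have a_le : `|fine (\int[m]_(x in D) ((u n x - f x) ^+ 2)%:E)| <= e * k / (2 * (`|M| + 1)).
  by near: n; apply: (ufine); apply: divr_gt0; apply: mulr_gt0.
set a := fine _ in a_le.
have iuf : m.-integrable D (EFin \o (fun x => u n x - f x)).
  have := integrableB mD (ui n) fi; apply: eq_integrable => // x _.
have muf : measurable_fun D (fun x => u n x - f x).
  by apply/measurable_EFinP; have /integrableP[] := iuf.
rewrite distrC -RintegralB//; [|exact: ipsi..].
under eq_Rintegral do rewrite -mulrBl.
apply: (le_trans (le_normr_Rintegral mD (ipsi _ iuf))).
have iabs : m.-integrable D (EFin \o (fun x => `|u n x - f x|)).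
  by have := integrable_norm iuf.
apply: (@le_trans _ _ (\int[m]_(x in D) ((`|M| + 1) * `|u n x - f x|))).
  apply: le_Rintegral => //.
  - by have := integrable_norm (ipsi _ iuf).
  - by have := integrableZl mD (`|M| + 1) iabs.
  - move=> x Dx; rewrite normrM mulrC ler_wpM2r// (le_trans (psiM _ Dx))//.
    by rewrite (le_trans (ler_norm _))// lerDl.
rewrite RintegralZl// -ler_pdivlMl//.
have := le_L1_L2 k0 muf; rewrite muE -[X in (_ <= _ + _ * X)%E -> _]fineK//.
rewrite -/a -!EFinM -EFinD -[X in (X <= _)%E -> _]fineK; last first.
  exact: integrable_fin_num iabs.
rewrite lee_fin -/(Rintegral _ _ _) => /le_trans; apply.
apply: (@le_trans _ _ (k * (c + 1) + k^-1 * (e * k / (2 * (`|M| + 1))))).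
  apply: lerD; first by rewrite ler_wpM2l ?lerDl// ltW.
  by rewrite ler_wpM2l ?invr_ge0 ?(ltW k0)// (le_trans (ler_norm _)).
rewrite le_eqVlt; apply/orP; left; apply/eqP; rewrite /k.
field; rewrite !gt_eqF//=.
Unshelve. all: by end_near. Qed.

End L2_convergence.

(** * Passage to functions with L^2 weak gradients *)

Section green.
Context {R : realType}.
Notation mu := (@lebesgue_measure R).
Implicit Types (v : triangle R) (i : 'I_3) (f : pt R -> R) (phi : pt R -> R).

Lemma L2_bounded_integrable (D : set (pt R)) f : measurable D -> bounded_set D ->
  L2 D f -> mu2.-integrable D (EFin \o f).
Proof.
move=> mD bD [mf f2].
exact: (@L2_integrable _ _ R mu2 D mD (mu2_bounded_lty mD bD) f mf f2).
Qed.

Lemma L2_bounded_integrableM (D : set (pt R)) f phi : measurable D -> bounded_set D ->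
  L2 D f -> continuous phi -> mu2.-integrable D (EFin \o (fun x => f x * phi x)).
Proof.
move=> mD bD Lf cphi.
have [M phiM] := bounded_continuous_image bD cphi.
apply: (@integrableMl _ _ R mu2 D mD (EFin \o f) phi (L2_bounded_integrable mD bD Lf)).
  by apply: measurable_funTS; exact: continuous_measurable_plane.
exists M; split; first exact: num_real.
by move=> N MN x Dx /=; rewrite (le_trans (phiM _ Dx))// ltW.
Qed.

Lemma L2_tri_integrableM v f phi : orient v != 0 -> L2 (tri v) f -> continuous phi ->
  mu2.-integrable (tri v) (EFin \o (fun x => f x * phi x)).
Proof.
move=> o0; exact: L2_bounded_integrableM (measurable_tri o0) (bounded_tri v).
Qed.

Lemma Rintegral_tri_cvg v (u : nat -> pt R -> R) f phi : orient v != 0 ->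
  (forall n, continuous (u n)) -> L2 (tri v) f -> continuous phi ->
  (\int[mu2]_(x in tri v) ((u n x - f x) ^+ 2)%:E)%E @[n --> \oo] --> 0%E ->
  \int[mu2]_(x in tri v) (u n x * phi x) @[n --> \oo] -->
  \int[mu2]_(x in tri v) (f x * phi x).
Proof.
move=> o0 cu Lf cphi uf.
have [M phiM] := bounded_continuous_image (bounded_tri v) cphi.
apply: (@Rintegral_cvg_L2 _ _ R mu2 (tri v) (measurable_tri o0)
  (mu2_bounded_lty (measurable_tri o0) (bounded_tri v)) u f phi M _ _ uf _ phiM).
- by move=> n; exact: bounded_continuous_integrable (measurable_tri o0) (bounded_tri v) (cu n).
- exact: L2_bounded_integrable (measurable_tri o0) (bounded_tri v) Lf.
- by apply: measurable_funTS; exact: continuous_measurable_plane.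
Qed.

Lemma continuous_edge_pt v i : continuous (edge_pt v i).
Proof.
rewrite (_ : edge_pt v i = fun s => ((src v i).1 + ((tgt v i).1 - (src v i).1) * s,
   (src v i).2 + ((tgt v i).2 - (src v i).2) * s)).
  by apply: continuous_pt => s; (apply: cvgD; first exact: cvg_cst);
     apply: cvgMl_tmp; exact: cvg_id.
by apply/funext => s; apply: pt_eqP; rewrite /edge_pt /= /GRing.scale/=; ring.
Qed.

Definition edge_L2 (t : R -> R) : Prop := measurable_fun (`[0, 1] : set R) t /\
  (\int[mu]_(s in `[0%R, 1%R]) (t s ^+ 2)%:E < +oo)%E.

Lemma mu01_lty : (mu `[0%R, 1%R] < +oo)%E.
Proof. by rewrite lebesgue_measure_itv/= lte_fin ltr01 -EFinB ltry. Qed.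

Lemma edge_L2_integrable (t : R -> R) : edge_L2 t -> mu.-integrable `[0, 1] (EFin \o t).
Proof.
by move=> [mt t2]; exact: (@L2_integrable _ _ R mu `[0, 1]%classic _ mu01_lty t mt t2).
Qed.

Lemma edge_L2_integrableM (t h : R -> R) : edge_L2 t -> continuous h ->
  mu.-integrable `[0, 1] (EFin \o (fun s => t s * h s)).
Proof.
move=> Lt ch.
apply: (@integrableMl _ _ R mu `[0, 1]%classic _ (EFin \o t) h) => //.
- exact: edge_L2_integrable.
- by apply: measurable_funTS; exact: continuous_measurable_fun.
have /compact_bounded /ex_strict_bound_gt0 [N _ hN] :=
  continuous_compact (continuous_subspaceT ch) (@segment_compact R 0 1).
exists N; split; first exact: num_real.
by move=> M NM x Dx /=; rewrite (le_trans _ (ltW NM))// ltW// hN//; exists x.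
Qed.

(** The smooth radial identity for the product [u n] times [phi], with the product rule expanded,
    passes to the limit term by term: the factors next to [u n] and its derivatives are fixed
    continuous functions, hence bounded on the triangle and on the edge. *)
Lemma is_trace_radial v i f (g : 'I_2 -> pt R -> R) t phi : orient v != 0 ->
  L2 (tri v) f -> (forall d, L2 (tri v) (g d)) -> is_trace v i f g t -> Cn 1 phi ->
  \int[mu2]_(x in tri v) (f x * (2 * phi x + ((x.1 - (v i).1) * 'D_(evec 0) phi x +
    (x.2 - (v i).2) * 'D_(evec 1) phi x))) +
  \int[mu2]_(x in tri v) (g 0 x * ((x.1 - (v i).1) * phi x)) +
  \int[mu2]_(x in tri v) (g 1 x * ((x.2 - (v i).2) * phi x)) =
  `|orient v| * \int[mu]_(s in `[0, 1]) (t (edge_pt v i s) * phi (edge_pt v i s)).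
Proof.
move=> o0 Lf Lg [mt t2 [u [Cu uf ug ut]]] Cphi.
have cphi := Cn_continuous Cphi.
have cd d := Cn_continuous (Cn_derive d Cphi).
have cu n := Cn_continuous (Cu n).
have cdu n d := Cn_continuous (Cn_derive d (Cu n)).
pose A x := 2 * phi x + ((x.1 - (v i).1) * 'D_(evec 0) phi x +
    (x.2 - (v i).2) * 'D_(evec 1) phi x).
pose B0 x := (x.1 - (v i).1) * phi x.
pose B1 x := (x.2 - (v i).2) * phi x.
have c1 : continuous (fun x : pt R => x.1 - (v i).1).
  by move=> x; apply: cvgB; [exact: cvg_fst|exact: cvg_cst].
have c2 : continuous (fun x : pt R => x.2 - (v i).2).
  by move=> x; apply: cvgB; [exact: cvg_snd|exact: cvg_cst].
have cA : continuous A.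
  move=> x; apply: cvgD; first by apply: cvgMl_tmp; exact: cphi.
  by apply: cvgD; apply: cvgM; [exact: c1|exact: cd|exact: c2|exact: cd].
have cB0 : continuous B0 by move=> x; apply: cvgM; [exact: c1|exact: cphi].
have cB1 : continuous B1 by move=> x; apply: cvgM; [exact: c2|exact: cphi].
have lhs : \int[mu2]_(x in tri v) (u n x * A x) +
    \int[mu2]_(x in tri v) ('D_(evec 0) (u n) x * B0 x) +
    \int[mu2]_(x in tri v) ('D_(evec 1) (u n) x * B1 x) @[n --> \oo] -->
    \int[mu2]_(x in tri v) (f x * A x) +
    \int[mu2]_(x in tri v) (g 0 x * B0 x) + \int[mu2]_(x in tri v) (g 1 x * B1 x).
  apply: cvgD; first apply: cvgD.
  - exact: Rintegral_tri_cvg.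
  - by apply: (Rintegral_tri_cvg o0 _ (Lg 0) cB0 (ug 0)).
  - by apply: (Rintegral_tri_cvg o0 _ (Lg 1) cB1 (ug 1)).
have cxphi : continuous (fun s => phi (edge_pt v i s)).
  move=> s; apply: (@continuous_comp _ _ _ (edge_pt v i) phi); last exact: cphi.
  exact: continuous_edge_pt.
have rhs : `|orient v| * \int[mu]_(s in `[0, 1]) (u n (edge_pt v i s) * phi (edge_pt v i s))
    @[n --> \oo] -->
    `|orient v| * \int[mu]_(s in `[0, 1]) (t (edge_pt v i s) * phi (edge_pt v i s)).
  apply: cvgMl_tmp.
  have /compact_bounded /ex_strict_bound_gt0 [N _ hN] :=
    continuous_compact (continuous_subspaceT cxphi) (@segment_compact R 0 1).
  apply: (@Rintegral_cvg_L2 _ _ R mu `[0, 1]%classic _ mu01_lty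
    (fun n s => u n (edge_pt v i s)) (fun s => t (edge_pt v i s)) _ N) => //.
  - move=> n; apply: continuous_itv_integrable => s.
    apply: (@continuous_comp _ _ _ (edge_pt v i) (u n)); last exact: cu.
    exact: continuous_edge_pt.
  - exact: edge_L2_integrable.
  - by apply: measurable_funTS; exact: continuous_measurable_fun.
  - by move=> s s01; apply/ltW/hN; exists s.
suff uE n : \int[mu2]_(x in tri v) (u n x * A x) +
    \int[mu2]_(x in tri v) ('D_(evec 0) (u n) x * B0 x) +
    \int[mu2]_(x in tri v) ('D_(evec 1) (u n) x * B1 x) =
    `|orient v| * \int[mu]_(s in `[0, 1]) (u n (edge_pt v i s) * phi (edge_pt v i s)).
  by move: rhs; rewrite -(funext uE) => rhs; exact: cvg_unique lhs rhs.
have ci h : continuous h -> mu2.-integrable (tri v) (EFin \o h).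
  exact: bounded_continuous_integrable (measurable_tri o0) (bounded_tri v).
have cuA : continuous (fun x => u n x * A x).
  by move=> x; apply: cvgM; [exact: cu|exact: cA].
have cu0 : continuous (fun x => 'D_(evec 0) (u n) x * B0 x).
  by move=> x; apply: cvgM; [exact: cdu|exact: cB0].
have cu1 : continuous (fun x => 'D_(evec 1) (u n) x * B1 x).
  by move=> x; apply: cvgM; [exact: cdu|exact: cB1].
have mtri : measurable (tri v) by exact: measurable_tri.
have cu01 : continuous (fun x => u n x * A x + 'D_(evec 0) (u n) x * B0 x).
  by move=> x; apply: cvgD; [exact: cuA|exact: cu0].
rewrite -(Rintegral_tri_radial i o0 (CnM (Cu n) Cphi)).
rewrite -(@RintegralD _ _ R mu2 (tri v) _ _ mtri (ci _ cuA) (ci _ cu0)).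
rewrite -(@RintegralD _ _ R mu2 (tri v) _ _ mtri (ci _ cu01) (ci _ cu1)).
apply: eq_Rintegral => x _.
have D d : 'D_(evec d) (fun y => u n y * phi y) x =
    u n x * 'D_(evec d) phi x + phi x * 'D_(evec d) (u n) x.
  exact: (deriveM (@Cn_derivable _ _ _ d x (Cu n)) (@Cn_derivable _ _ _ d x Cphi)).
rewrite !D /A /B0 /B1; ring.
Qed.

Lemma orient_edge_neq v i : orient v != 0 -> tgt v i != src v i.
Proof.
apply: contraNN => /eqP E; move: E; rewrite (orientE v i) => ->.
by rewrite /cross [X in _ - X]mulrC subrr.
Qed.

Lemma enorm_gt0 (x : pt R) : x != 0 -> 0 < enorm x.
Proof.
move=> x0; rewrite /enorm sqrtr_gt0 lt_neqAle addr_ge0 ?sqr_ge0// andbT eq_sym.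
apply: contraNN x0; rewrite paddr_eq0 ?sqr_ge0// !sqrf_eq0 => /andP[/eqP x1 /eqP x2].
by apply/eqP/pt_eqP.
Qed.

Lemma edge_len_gt0 v i : orient v != 0 -> 0 < edge_len v i.
Proof. by move=> o0; rewrite enorm_gt0// subr_eq0 orient_edge_neq. Qed.

(* A constant field e_d is a combination of the three fields x - v i, each of
   which has a nonzero normal component on edge i only; this reduces the
   divergence theorem to its radial form. *)
Lemma green v f (g : 'I_2 -> pt R -> R) (t : 'I_3 -> pt R -> R) phi d :
  orient v != 0 -> L2 (tri v) f -> (forall d, L2 (tri v) (g d)) ->
  (forall i, is_trace v i f g (t i)) -> Cn 1 phi ->
  \int[mu2]_(x in tri v) (f x * 'D_(evec d) phi x) +
  \int[mu2]_(x in tri v) (g d x * phi x) =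
  \sum_i normal v i d 0 * seg_int (src v i) (tgt v i) (fun x => t i x * phi x).
Proof.
move=> o0 Lf Lg tr Cphi.
have cphi := Cn_continuous Cphi.
have cd e := Cn_continuous (Cn_derive e Cphi).
pose X e := \int[mu2]_(x in tri v) (f x * 'D_(evec e) phi x) +
  \int[mu2]_(x in tri v) (g e x * phi x).
pose I i := \int[mu]_(s in `[0, 1]) (t i (edge_pt v i s) * phi (edge_pt v i s)).
(* [X e] is the volume side for the constant field e, and [K] the one for the field x, which does
   not depend on a vertex. Subtracting the constant field [v i] gives the relations [KX], one for
   each edge, from which the constant fields are recovered. *)
pose K := \int[mu2]_(x in tri v) (f x * (2 * phi x + (x.1 * 'D_(evec 0) phi x +
    x.2 * 'D_(evec 1) phi x))) + \int[mu2]_(x in tri v) (g 0 x * (x.1 * phi x)) +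
    \int[mu2]_(x in tri v) (g 1 x * (x.2 * phi x)).
have mtri : measurable (tri v) by exact: measurable_tri.
have cphi1 : continuous (fun x : pt R => x.1 * phi x).
  by move=> x; apply: cvgM; [exact: cvg_fst|exact: cphi].
have cphi2 : continuous (fun x : pt R => x.2 * phi x).
  by move=> x; apply: cvgM; [exact: cvg_snd|exact: cphi].
have cK : continuous (fun x : pt R =>
    2 * phi x + (x.1 * 'D_(evec 0) phi x + x.2 * 'D_(evec 1) phi x)).
  move=> x; apply: cvgD; first by apply: cvgMl_tmp; exact: cphi.
  by apply: cvgD; apply: cvgM; [exact: cvg_fst|exact: cd|exact: cvg_snd|exact: cd].
have split_int h a b (r : R) : L2 (tri v) h -> continuous a -> continuous b ->
    \int[mu2]_(x in tri v) (h x * (a x - r * b x)) =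
    \int[mu2]_(x in tri v) (h x * a x) - r * \int[mu2]_(x in tri v) (h x * b x).
  move=> Lh ca cb.
  have ia := L2_tri_integrableM o0 Lh ca; have ib := L2_tri_integrableM o0 Lh cb.
  rewrite -(@RintegralZl _ _ R mu2 (tri v) _ r mtri ib).
  have irb := @integrableZl _ _ R mu2 (tri v) mtri r _ ib.
  rewrite -(@RintegralB _ _ R mu2 (tri v) (fun x => h x * a x)
    (fun x => r * (h x * b x)) mtri ia irb).
  by apply: eq_Rintegral => x _; ring.
have KX i : K - (v i).1 * X 0 - (v i).2 * X 1 = `|orient v| * I i.
  rewrite -(is_trace_radial o0 Lf Lg (tr i) Cphi).
  have -> : \int[mu2]_(x in tri v) (f x * (2 * phi x + ((x.1 - (v i).1) * 'D_(evec 0) phi x +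
    (x.2 - (v i).2) * 'D_(evec 1) phi x))) =
    \int[mu2]_(x in tri v) (f x * (((2 * phi x +
      (x.1 * 'D_(evec 0) phi x + x.2 * 'D_(evec 1) phi x)) -
      (v i).1 * 'D_(evec 0) phi x) - (v i).2 * 'D_(evec 1) phi x)).
    by apply: eq_Rintegral => x _; congr (f x * _); ring.
  rewrite split_int//; last first.
    by move=> x; apply: cvgB; [exact: cK|apply: cvgMl_tmp; exact: cd].
  rewrite split_int//.
  have gE d' (pr : pt R -> R) (r : R) : continuous (fun x => pr x * phi x) ->
      \int[mu2]_(x in tri v) (g d' x * ((pr x - r) * phi x)) =
      \int[mu2]_(x in tri v) (g d' x * (pr x * phi x)) -
      r * \int[mu2]_(x in tri v) (g d' x * phi x).
    move=> cpr; rewrite -split_int//; apply: eq_Rintegral => x _.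
    by rewrite mulrBl.
  rewrite (gE 0 fst)// (gE 1 snd)//.
  have alg (A E0 E1 G0 H0 G1 H1 a b : R) :
    (A + G0 + G1) - a * (E0 + H0) - b * (E1 + H1) =
    A - a * E0 - b * E1 + (G0 - a * H0) + (G1 - b * H1) by ring.
  exact: alg.
have len_neq i : edge_len v i != 0 by rewrite gt_eqF// edge_len_gt0.
have sgE : Num.sg (orient v) = `|orient v| / orient v.
  have [on|op|o00] := ltrgtP (orient v) 0; last by rewrite o00 eqxx in o0.
    by rewrite ltr0_sg// ltr0_norm// mulNr divff.
  by rewrite gtr0_sg// gtr0_norm// divff.
have segE i : seg_int (src v i) (tgt v i) (fun x => t i x * phi x) = edge_len v i * I i.
  by [].
rewrite -/(X d); clearbody K X I.
have nE i : normal v i d 0 * seg_int (src v i) (tgt v i) (fun x => t i x * phi x) =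
    (if d == 0 then (tgt v i - src v i).2 else - (tgt v i - src v i).1) / orient v *
    (K - (v i).1 * X 0 - (v i).2 * X 1).
  rewrite KX segE /normal !mxE sgE; field.
  by rewrite o0 len_neq.
(* The edge vectors add up to 0, which eliminates [K]; the coefficients of [X 0] and [X 1] divided
   by [orient v] leave exactly [X d]. *)
rewrite (eq_bigr _ (fun i _ => nE i)) sum_I3 /src /tgt !I3E.
move: o0 {nE sgE KX}; rewrite /orient /= => o0.
by move: (d); apply: I2P => /=; field.
Qed.

End green.

(** * Jumps across a facet *)

Section cutoff.
Context {R : realType}.

Lemma prod_flat_bounds (J : finType) (y : J -> R) :
  0 <= \prod_j flat 1 (y j) <= 1.
Proof.
apply/andP; split; first by apply: prodr_ge0 => j _; exact: flat1_ge0.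
by apply: prodr_ile1 => j _; rewrite flat1_ge0 flat1_le1.
Qed.

(** Dominated convergence with bound |h|: the cutoffs lie in [0, 1] and tend to 1 wherever all [b j]
    are positive. *)
Lemma Rintegral_cutoff_cvg d (T : measurableType d) (m : {measure set T -> \bar R})
    (D : set T) (J : finType) (b : J -> T -> R) (h : T -> R) :
  measurable D -> m.-integrable D (EFin \o h) ->
  (forall j, measurable_fun D (b j)) -> (forall j x, D x -> 0 < b j x) ->
  \int[m]_(x in D) (h x * \prod_j flat 1 (n%:R * b j x - 1)) @[n --> \oo] -->
  \int[m]_(x in D) h x.
Proof.
move=> mD hi mb b0; have /integrableP[mh _] := hi.
pose u n x := h x * \prod_j flat 1 (n%:R * b j x - 1).
have mu_ n : measurable_fun D (EFin \o u n).
  apply/measurable_EFinP; apply: measurable_funM; first exact/measurable_EFinP.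
  apply: measurable_prod => j _.
  apply: (measurableT_comp (f := flat 1)).
    by apply: continuous_measurable_fun; exact: continuous_flat.
  apply: measurable_funB; last exact: measurable_cst.
  by apply: measurable_funM; [exact: measurable_cst|exact: mb].
have [|||_ _ H] := @dominated_convergence _ T R m D mD (fun n => EFin \o u n) (EFin \o h)
    (abse \o (EFin \o h)) mu_ mh.
- apply/aeW => x Dx /=; apply: cvg_EFin; first by near=> n.
  rewrite -[X in _ --> X]mulr1 /u; apply: cvgMl_tmp.
  rewrite [X in _ --> X](_ : 1 = \prod_(j : J) (1 : R)); last by rewrite big1.
  elim: (index_enum J) => [|j r IH].
    by under eq_fun do rewrite big_nil; rewrite big_nil; exact: cvg_cst.
  under eq_fun do rewrite big_cons.
  by rewrite big_cons; apply: cvgM => //; apply: cvg_flat1; exact: b0.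
- exact: integrable_abse.
- apply/aeW => x n Dx /=; rewrite lee_fin /u normrM ler_piMr//.
  by have /andP[p0 p1] := prod_flat_bounds (fun j => n%:R * b j x - 1); rewrite ger0_norm.
apply: fine_cvg; rewrite fineK; last exact: integrable_fin_num hi.
exact: H.
Unshelve. all: by end_near. Qed.

Lemma Cn_prod n (J : finType) (F : J -> pt R -> R) :
  (forall j, Cn n (F j)) -> Cn n (fun x => \prod_j F j x).
Proof.
move=> CF; elim: (index_enum J) => [|i r IH].
  under eq_fun do rewrite big_nil; exact: Cn_cst.
by under eq_fun do rewrite big_cons; exact: CnM.
Qed.

Definition is_affine (b : pt R -> R) : Prop :=
  exists a b1 b2 : R, forall x, b x = a + b1 * x.1 + b2 * x.2.

Lemma is_affine_continuous b : is_affine b -> continuous b.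
Proof.
move=> [a [b1 [b2 E]]]; rewrite (_ : b = fun x => a + b1 * x.1 + b2 * x.2).
  exact: continuous_affine.
exact/funext.
Qed.

(** The product is zero unless n b_j >= 1 for all j. These inequalities define a closed subset of
    the bounded region where all [b j] are positive, hence a compact set inside [N]. *)
Lemma test_fun_cutoff (N : set (pt R)) (J : finType) (b : J -> pt R -> R)
    (P : pt R -> R) n :
  (forall j, is_affine (b j)) -> (forall n, Cn n P) ->
  bounded_set [set x | forall j, 0 < b j x] ->
  [set x | forall j, 0 < b j x] `<=` N ->
  test_fun N (fun x => P x * \prod_j flat 1 (n%:R * b j x - 1)).
Proof.
move=> ab CP bd bN; split => [k|].
  apply: CnM => //; apply: Cn_prod => j; have [a [b1 [b2 E]]] := ab j.
  rewrite (_ : (fun x => _) =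
      fun x => flat 1 ((n%:R * a - 1) + n%:R * b1 * x.1 + n%:R * b2 * x.2)).
    exact: Cn_flat_affine.
  by apply/funext => x; rewrite E; congr flat; ring.
pose C := \bigcap_(j in [set: J]) [set x | 1 <= n%:R * b j x].
have CN : C `<=` [set x | forall j, 0 < b j x].
  move=> x Cx j; have /= := Cx j I; rewrite ltNge => nb; apply/negP => b0.
  have : n%:R * b j x <= 0 by rewrite mulr_ge0_le0.
  by move=> /(le_trans nb); rewrite ler10.
have cC : closed C.
  apply: closed_bigI => j _.
  apply: (@preimage_closed _ _ (fun x => n%:R * b j x) [set y | 1 <= y]); last exact: closed_ge.
  by move=> x _; apply: cvgMl_tmp; exact: is_affine_continuous.
exists C.
  split; last exact: subset_trans CN bN.
  have [M BM] := bounded_subbox bd.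
  apply: (subclosed_compact cC _ (subset_trans CN BM)).
  by apply: compact_setX; exact: segment_compact.
move=> x Cx.
have [j jx] : exists j, n%:R * b j x < 1.
  apply/not_existsP => H; apply: Cx => j _ /=.
  by rewrite leNgt; apply/negP; exact: H.
rewrite (bigD1 j)//= flat_le0; first by rewrite mul0r mulr0.
by rewrite subr_le0 ltW.
Qed.

End cutoff.

(** * Relative position of two elements that share a facet *)

Section facet_geometry.
Context {R : realType}.
Implicit Types (v : triangle R) (i j : 'I_3) (x a b c d tau : pt R).

Lemma segment_shift a b tau :
  segment (a + tau) (b + tau) = [set x + tau | x in segment a b].
Proof.
rewrite /segment image_comp; apply: eq_imagel => s _ /=.
by rewrite opprD addrACA subrr addr0 addrAC.
Qed.

(** [triangulation] matches facets as point sets only, so the end points have to be recovered. Here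
    [s] and [s'] are the parameters of [c] and [d] on [a, b]; both lie in [0, 1], and the values
    between them include 0 and 1, which leaves two possibilities. *)
Lemma segment_ends a b c d : a != b -> segment c d = segment a b ->
  (c = a /\ d = b) \/ (c = b /\ d = a).
Proof.
move=> ab E.
have ends (e f : pt R) : segment e f e /\ segment e f f.
  split; [exists 0|exists 1]; rewrite /= ?in_itv/= ?lexx ?ler01//.
    by rewrite scale0r addr0.
  by rewrite scale1r addrC subrK.
have [cE dE] := ends c d; rewrite E in cE dE.
have [aE bE] := ends a b; rewrite -E in aE bE.
move: cE dE aE bE => [s s01 cE] [s' s'01 dE] [r r01 aE] [r' r'01 bE].
move: s01 s'01 r01 r'01; rewrite /= !in_itv/=.
move=> /andP[s0 s1] /andP[s'0 s'1] /andP[r0 r1] /andP[r'0 r'1].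
have inj (k l : R) : a + k *: (b - a) = a + l *: (b - a) -> k = l.
  move/addrI/eqP; rewrite -subr_eq0 -scalerBl scaler_eq0 !subr_eq0 [b == a]eq_sym (negbTE ab) orbF.
  by move/eqP.
have r_eq : s + r * (s' - s) = 0.
  by apply: inj; rewrite -[in RHS]aE -cE -dE; apply: pt_eqP; rewrite /= /GRing.scale/=; ring.
have r'_eq : s + r' * (s' - s) = 1.
  apply: inj; rewrite scale1r [RHS]addrC subrK -[in RHS]bE -cE -dE.
  by apply: pt_eqP; rewrite /= /GRing.scale/=; ring.
have [s00|s00] := eqVneq s 0.
  have s'1' : s' = 1 by nra.
  by left; rewrite -cE -dE s00 s'1' scale0r addr0 scale1r addrC subrK.
have {}s00 : 0 < s by rewrite lt_neqAle eq_sym s00.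
have s'00 : s' = 0 by nra.
have s1' : s = 1 by nra.
by right; rewrite -cE -dE s'00 s1' scale0r addr0 scale1r addrC subrK.
Qed.

Lemma edge_pt_bary v i s : orient v != 0 ->
  [/\ bary v i (edge_pt v i s) = 0, bary v (i + 1) (edge_pt v i s) = 1 - s &
      bary v (i + 2) (edge_pt v i s) = s].
Proof.
rewrite /bary /edge_pt /cross /orient; move: i.
by apply: I3P; rewrite /src /tgt !I3E /= /GRing.scale/= => o0; split; field.
Qed.

Lemma bary0_edge_pt v i x : orient v != 0 -> bary v i x = 0 ->
  x = edge_pt v i (bary v (i + 2) x).
Proof.
move=> o0 b0; have s1 := sum_bary x o0.
rewrite -[LHS](sum_bary_vertex x o0).
move: i s1 b0; apply: I3P; rewrite !sum_I3 /edge_pt /src /tgt !I3E => s1 b0; rewrite b0 in s1 *.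
- have -> : bary v 1 x = 1 - bary v 2 x by lra.
  by apply: pt_eqP; rewrite /= /GRing.scale/=; ring.
- have -> : bary v 2 x = 1 - bary v 0 x by lra.
  by apply: pt_eqP; rewrite /= /GRing.scale/=; ring.
- have -> : bary v 0 x = 1 - bary v 1 x by lra.
  by apply: pt_eqP; rewrite /= /GRing.scale/=; ring.
Qed.

(** The coordinate is minus the signed distance from the line of edge i, in units of the height over
    that edge. This form brings in the outward normal, which is what [triangulation] controls on a
    facet. *)
Lemma bary_normal v i x : orient v != 0 -> bary v i x =
  - (edge_len v i / `|orient v|) * (normal v i 0 0 * (x.1 - (src v i).1) +
    normal v i 1 0 * (x.2 - (src v i).2)).
Proof.
move=> o0; have l0 := edge_len_gt0 i o0.
have sgE : Num.sg (orient v) = `|orient v| / orient v.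
  have [on|op|o00] := ltrgtP (orient v) 0; last by rewrite o00 eqxx in o0.
    by rewrite ltr0_sg// ltr0_norm// mulNr divff.
  by rewrite gtr0_sg// gtr0_norm// divff.
rewrite /bary /cross /normal !mxE sgE /=; field.
by rewrite o0 normr_eq0 o0 gt_eqF.
Qed.

Lemma normal_tangent v i : normal v i 0 0 * ((tgt v i).1 - (src v i).1) +
  normal v i 1 0 * ((tgt v i).2 - (src v i).2) = 0.
Proof. by rewrite /normal !mxE /=; ring. Qed.

Lemma normal_neq0 v i : orient v != 0 -> exists k, normal v i k 0 != 0.
Proof.
move=> o0; apply: contrapT => H.
have n0 k : normal v i k 0 = 0.
  by apply/eqP/negP => nk; apply: H; exists k; exact/negP.
have bi : bary v i (v i) = 1.
  rewrite /bary (_ : cross _ _ = orient v) ?divff//.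
  by rewrite (orientE v i) /cross /=; ring.
by move: bi; rewrite bary_normal// !n0 !mul0r addr0 mulr0 => /esym/eqP; rewrite oner_eq0.
Qed.

End facet_geometry.

Section facet.
Context {R : realType} (v v' : triangle R) (i i' : 'I_3) (tau : pt R).
Context (o0 : orient v != 0) (o0' : orient v' != 0).
Context (Hseg : segment (src v' i') (tgt v' i') =
  [set x + tau | x in segment (src v i) (tgt v i)]).
Context (Hn : normal v' i' = - normal v i).

Lemma facet_ends : (src v' i' = src v i + tau /\ tgt v' i' = tgt v i + tau) \/
  (src v' i' = tgt v i + tau /\ tgt v' i' = src v i + tau).
Proof.
apply: segment_ends; last by rewrite segment_shift.
by rewrite (inj_eq (addIr _)) eq_sym orient_edge_neq.
Qed.

(** The local numberings of the two elements are unrelated, so their parametrizations of the common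
    facet may agree or run in opposite directions. *)
Lemma facet_edge_pt :
  (forall s, edge_pt v' i' s = edge_pt v i s + tau) \/
  (forall s, edge_pt v' i' s = edge_pt v i (1 - s) + tau).
Proof.
have [[sE tE]|[sE tE]] := facet_ends; [left|right] => s; rewrite /edge_pt sE tE;
  by apply: pt_eqP; rewrite /= /GRing.scale/=; ring.
Qed.

Lemma facet_edge_len : edge_len v' i' = edge_len v i.
Proof.
rewrite /edge_len /enorm; congr Num.sqrt.
by have [[-> ->]|[-> ->]] := facet_ends; rewrite /=; ring.
Qed.

(** Both coordinates measure the distance from the same line, up to the translation. Since the
    normals are opposite, so are the signs: the second element, moved back by [tau], lies on the
    other side of the facet. *)
Lemma facet_bary x : bary v' i' (x + tau) = - (`|orient v| / `|orient v'|) * bary v i x.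
Proof.
have nE d : normal v' i' d 0 = - normal v i d 0 by rewrite Hn !mxE.
have l0 := edge_len_gt0 i o0.
rewrite !bary_normal// facet_edge_len !nE.
have T := normal_tangent v i.
have -> : - normal v i 0 0 * ((x + tau).1 - (src v' i').1) +
    - normal v i 1 0 * ((x + tau).2 - (src v' i').2) =
    - (normal v i 0 0 * (x.1 - (src v i).1) + normal v i 1 0 * (x.2 - (src v i).2)).
  have [[-> _]|[-> _]] := facet_ends; rewrite /=; first by ring.
  by rewrite -[RHS]addr0 -[X in _ = _ + X]T; ring.
by field; rewrite !normr_eq0 o0 o0'.
Qed.

(* Four affine functions, positive exactly on a neighbourhood of the open facet
   inside the union of the two elements (the second one translated by - tau):
   the barycentric coordinates that vanish on the other edges. *)
Definition facet_cutoff (p : bool * bool) (x : pt R) : R :=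
  if p.1 then bary v' (if p.2 then i' + 1 else i' + 2) (x + tau)
  else bary v (if p.2 then i + 1 else i + 2) x.

Definition facet_nbhd : set (pt R) := [set x | forall p, 0 < facet_cutoff p x].

Lemma facet_cutoff_affine p : is_affine (facet_cutoff p).
Proof.
rewrite /facet_cutoff; case: p => [[] e] /=; last exact: bary_affine.
have [a [b1 [b2 E]]] := bary_affine v' (if e then i' + 1 else i' + 2).
exists (a + b1 * tau.1 + b2 * tau.2), b1, b2 => x.
by rewrite E /=; ring.
Qed.

Lemma facet_cutoff_edge p s : 0 < s < 1 -> 0 < facet_cutoff p (edge_pt v i s).
Proof.
move=> /andP[s0 s1]; have [_ b1 b2] := edge_pt_bary i s o0.
rewrite /facet_cutoff; case: p => [[] []] /=; rewrite ?b1 ?b2 ?subr_gt0//.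
- have [E|E] := facet_edge_pt.
    by rewrite -E; have [_ -> _] := edge_pt_bary i' s o0'; rewrite subr_gt0.
  have := E (1 - s); rewrite subKr => <-.
  by have [_ -> _] := edge_pt_bary i' (1 - s) o0'; rewrite subKr.
- have [E|E] := facet_edge_pt.
    by rewrite -E; have [_ _ ->] := edge_pt_bary i' s o0'.
  have := E (1 - s); rewrite subKr => <-.
  by have [_ _ ->] := edge_pt_bary i' (1 - s) o0'; rewrite subr_gt0.
Qed.

Lemma I3_cases (P : 'I_3 -> Prop) j : P j -> P (j + 1) -> P (j + 2) -> forall k, P k.
Proof. by move: j; apply: I3P; rewrite !I3E => *; apply: I3P. Qed.

(** The sign of [bary v i x] decides. Positive means inside [v], negative means inside [v'] by
    [facet_bary], and zero means on the line of the facet, where the other two coordinates of [v]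
    are positive with sum 1. *)
Lemma facet_nbhdP x : facet_nbhd x ->
  [\/ tri v x, tri v' (x + tau) |
      bary v i x = 0 /\ open_segment (src v i) (tgt v i) x].
Proof.
move=> Nx; have c : 0 < `|orient v| / `|orient v'| by rewrite divr_gt0 ?normr_gt0.
have N11 := Nx (false, true); have N12 := Nx (false, false).
have N21 := Nx (true, true); have N22 := Nx (true, false).
rewrite /facet_cutoff /= in N11 N12 N21 N22.
have [bn|bp|b0] := ltrgtP (bary v i x) 0.
- apply: Or32; apply/tri_bary => //; apply: (I3_cases (j := i')) => //.
  by rewrite facet_bary mulNr oppr_gt0 pmulr_rlt0.
- by apply: Or31; apply/tri_bary => //; apply: (I3_cases (j := i)).
- apply: Or33; split => //; have s := bary0_edge_pt o0 b0.
  exists (bary v (i + 2) x); last by rewrite -/(edge_pt v i _) -s.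
  have := sum_bary x o0; rewrite (bigD1 i)//= b0 add0r => sb.
  rewrite /= in_itv/= N12/=.
  suff : bary v (i + 1) x + bary v (i + 2) x = 1 by lra.
  have := sum_bary x o0; rewrite sum_I3.
  by move: (i) b0; apply: I3P; rewrite !I3E => ->; lra.
Qed.

Lemma tri_facet_disjoint x : tri v x -> ~ tri v' (x + tau).
Proof.
move=> /(tri_bary _ o0) /(_ i) bp /(tri_bary _ o0') /(_ i').
rewrite facet_bary mulNr oppr_gt0 pmulr_rlt0 ?divr_gt0 ?normr_gt0//.
by move=> /(lt_trans bp); rewrite ltxx.
Qed.

Lemma facet_nbhd_hull x : facet_nbhd x -> hull v setT x \/ hull v' setT (x + tau).
Proof.
move=> Nx; have [/tri_hull|/tri_hull|[b0 _]] := facet_nbhdP Nx; [by left|by right|].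
left; apply/hull_bary => //; apply: (I3_cases (j := i)).
- by rewrite b0.
- by have := Nx (false, true); rewrite /facet_cutoff/= => /ltW.
- by have := Nx (false, false); rewrite /facet_cutoff/= => /ltW.
Qed.

Lemma open_facet_nbhd : open facet_nbhd.
Proof.
have o p : open [set x | 0 < facet_cutoff p x].
  have [a [b1 [b2 E]]] := facet_cutoff_affine p.
  rewrite (_ : [set x | _] = [set x | 0 < a + b1 * x.1 + b2 * x.2]).
    exact: open_affine_gt0.
  by apply/funext => x /=; rewrite E.
rewrite (_ : facet_nbhd = [set x | 0 < facet_cutoff (true, true) x] `&`
    [set x | 0 < facet_cutoff (true, false) x] `&`
    [set x | 0 < facet_cutoff (false, true) x] `&`
    [set x | 0 < facet_cutoff (false, false) x]).
  by do 3?apply: openI.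
apply/seteqP; split => x; first by move=> Nx; do 3?split; exact: Nx.
by move=> [[[? ?] ?] ?] [[] []].
Qed.

Lemma bounded_facet_nbhd : bounded_set facet_nbhd.
Proof.
have /ex_strict_bound_gt0 [M1 M10 h1] := bounded_hull v setT.
have /ex_strict_bound_gt0 [M2 M20 h2] := bounded_hull v' setT.
exists (M1 + M2 + `|tau|); split; first exact: num_real.
move=> M MM x /facet_nbhd_hull[/h1 /= xM|/h2 /= xM];
  apply: le_trans (ltW MM).
  by rewrite (le_trans (ltW xM))// -addrA lerDl addr_ge0// ltW.
rewrite -[x](addrK tau) (le_trans (ler_normB _ _))// lerD2r.
by rewrite (le_trans (ltW xM))// lerDr ltW.
Qed.

Lemma integrable01_flip (h : R -> R) :
  lebesgue_measure.-integrable `[0, 1] (EFin \o h) ->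
  lebesgue_measure.-integrable `[0, 1] (EFin \o (fun s => h (1 - s))).
Proof.
move=> hi.
have H A : measurable A -> lebesgue_measure
    ((fun y : measurableTypeR R => -1 * y + 1) @^-1` A) = (1%:E * lebesgue_measure A)%E.
  by move=> mA; rewrite lebesgue_measure_affine ?oppr_eq0 ?oner_eq0// normrN1 invr1.
have := @integrable_transfer _ _ _ _ R lebesgue_measure lebesgue_measure
  (fun y : measurableTypeR R => -1 * y + 1) 1 (measurable_line_map _ _) ler01 H
  `[0, 1]%classic (EFin \o h) _ hi.
rewrite (_ : _ @^-1` _ = `[0, 1]%classic); last first.
  by apply/funext => y /=; rewrite !in_itv/=; congr is_true; apply/andP/andP; split; lra.
move=> /(_ (measurable_itv _)); apply: eq_integrable => //= y _.
by rewrite mulN1r addrC.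
Qed.

Lemma facet_integrable (F : pt R -> R) :
  lebesgue_measure.-integrable `[0, 1] (EFin \o (fun s => F (edge_pt v' i' s))) ->
  lebesgue_measure.-integrable `[0, 1] (EFin \o (fun s => F (edge_pt v i s + tau))).
Proof.
have [E|E] := facet_edge_pt.
  by apply: eq_integrable => //= s _; rewrite E.
move=> /integrable01_flip; apply: eq_integrable => //= s _.
by rewrite E subKr.
Qed.

Lemma facet_seg_int (F : pt R -> R) :
  lebesgue_measure.-integrable `[0, 1] (EFin \o (fun s => F (edge_pt v' i' s))) ->
  seg_int (src v' i') (tgt v' i') F = seg_int (src v i) (tgt v i) (fun x => F (x + tau)).
Proof.
move=> Fi; rewrite /seg_int.
have -> : enorm (tgt v' i' - src v' i') = enorm (tgt v i - src v i).
  exact: facet_edge_len.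
congr (_ * _); have [E|E] := facet_edge_pt.
  by apply: eq_Rintegral => s _; rewrite -/(edge_pt v' i' s) E.
rewrite -(Rintegral01_flip Fi); apply: eq_Rintegral => s _.
by rewrite E subKr.
Qed.

End facet.

(** * Splitting integrals over the two sides of a facet *)

Section weak_split.
Context {R : realType}.
Notation mu := (@lebesgue_measure R).

Lemma measurable_line (a b c : R) :
  measurable [set x : pt R | a + b * x.1 + c * x.2 = 0].
Proof.
rewrite (_ : [set x | _] = (fun x : pt R => a + b * x.1 + c * x.2) @^-1` [set 0]) //.
by rewrite -[X in measurable X]setTI; apply: measurable_affine => //; exact: measurable_set1.
Qed.

(** This allows the line through a facet to be removed from [Omega] under the integral. *)
Lemma mu2_line (a b c : R) : (b != 0) || (c != 0) ->
  mu2 [set x : pt R | a + b * x.1 + c * x.2 = 0] = 0%E.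
Proof.
move: a b c.
have H (a b c : R) : c != 0 -> mu2 [set x : pt R | a + b * x.1 + c * x.2 = 0] = 0%E.
  move=> c0; rewrite /mu2 /product_measure1 integral0_eq// => x _ /=.
  rewrite (_ : xsection _ x = [set - (a + b * x) / c]) ?lebesgue_measure_set1//.
  apply/seteqP; split => y; rewrite /xsection /= inE /=.
    by move=> E; apply: (mulIf c0); rewrite divfK// -[RHS]addr0 -E; ring.
  by move=> ->; field.
move=> a b c /orP[b0|]; last exact: H.
rewrite -mu2_swap; last exact: measurable_line.
rewrite -[RHS](H a c b b0); congr (mu2 _).
by apply/funext => x /=; rewrite addrAC.
Qed.

Lemma mu2_shift (tau : pt R) (A : set (pt R)) : measurable A ->
  mu2 ((fun x => x + tau) @^-1` A) = (1%:E * mu2 A)%E.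
Proof.
move=> mA; have det : (1 : R) * 1 - 0 * 0 = 1 by ring.
have := @mu2_affine R tau (1, 0) (0, 1) A; rewrite /= det oner_eq0 => /(_ isT mA).
rewrite normr1 invr1 => <-; congr (mu2 _); apply/funext => x /=; congr (A _).
by apply: pt_eqP; rewrite /= /GRing.scale/=; ring.
Qed.

Lemma measurable_shift (tau : pt R) : measurable_fun setT (fun x : pt R => x + tau).
Proof.
rewrite (_ : (fun _ => _) = fun x : pt R => tau + x.1 *: (1, 0) + x.2 *: (0, 1)).
  exact: measurable_affine_map.
by apply/funext => x; apply: pt_eqP; rewrite /= /GRing.scale/=; ring.
Qed.

Lemma Rintegral_split (D A B : set (pt R)) (F F1 F2 : pt R -> R) :
  measurable A -> measurable B ->
  mu2.-integrable A (EFin \o F1) -> mu2.-integrable B (EFin \o F2) ->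
  (forall x, (F \_ D) x = (F1 \_ A) x + (F2 \_ B) x) ->
  \int[mu2]_(x in D) F x = \int[mu2]_(x in A) F1 x + \int[mu2]_(x in B) F2 x.
Proof.
move=> mA mB i1 i2 E; rewrite (Rintegral_mkcond mu2 D) (Rintegral_mkcond mu2 A).
rewrite (Rintegral_mkcond mu2 B).
rewrite -(@RintegralD _ _ R mu2 setT (F1 \_ A) (F2 \_ B))//.
- by apply: eq_Rintegral => x _.
- by rewrite -restrict_EFin; apply/(@integrable_mkcond _ _ _ mu2 _ _ mA).
- by rewrite -restrict_EFin; apply/(@integrable_mkcond _ _ _ mu2 _ _ mB).
Qed.

Lemma L2S (D E : set (pt R)) (f : pt R -> R) : measurable D -> measurable E ->
  E `<=` D -> L2 D f -> L2 E f.
Proof.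
move=> mD mE ED [mf f2]; split; first exact: measurable_funS mf.
apply: le_lt_trans f2; apply: (@ge0_subset_integral _ _ R mu2 _ _ mE mD) => //.
  by apply/measurable_EFinP; exact: measurable_funX.
by move=> x _; rewrite lee_fin sqr_ge0.
Qed.

End weak_split.

Section facet_weak.
Context {R : realType} (v v' : triangle R) (i i' : 'I_3) (tau : pt R).
Context (o0 : orient v != 0) (o0' : orient v' != 0).
Context (Hseg : segment (src v' i') (tgt v' i') =
  [set x + tau | x in segment (src v i) (tgt v i)]).
Context (Hn : normal v' i' = - normal v i).
Notation mu := (@lebesgue_measure R).
Notation N := (facet_nbhd v v' i i' tau).
Let B : set (pt R) := (fun x => x + tau) @^-1` tri v'.

(** The part of [D] beyond the facet is [tri v'] moved by -tau; a translation brings its integral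
    back to [tri v'] and puts the shift on [psi]. [D] is a parameter because the periodic case
    integrates over [N] and the case tau = 0 over [Omega] without a line. *)
Lemma Rintegral_facet_split (D : set (pt R)) (F h psi : pt R -> R) :
  L2 (tri v) h -> L2 (tri v') h -> continuous psi ->
  (forall x, (F \_ D) x =
    ((fun x => h x * psi x) \_ (tri v)) x + ((fun x => h (x + tau) * psi x) \_ B) x) ->
  \int[mu2]_(x in D) F x = \int[mu2]_(x in tri v) (h x * psi x) +
    \int[mu2]_(x in tri v') (h x * psi (x - tau)).
Proof.
move=> Lh Lh' cpsi FE.
have mt := measurable_tri o0; have mt' := measurable_tri o0'.
have cpsi' : continuous (fun x : pt R => psi (x - tau)).
  move=> x; apply: (@continuous_comp _ _ _ (fun x : pt R => x - tau) psi); last exact: cpsi.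
  by apply: cvgB; [exact: cvg_id|exact: cvg_cst].
have ih' := L2_tri_integrableM o0' Lh' cpsi'.
have psiE x : h (x + tau) * psi x = h (x + tau) * psi (x + tau - tau) by rewrite addrK.
have iB : mu2.-integrable B (EFin \o (fun x => h (x + tau) * psi x)).
  have := @integrable_transfer _ _ _ _ R mu2 mu2 (fun x => x + tau) 1
    (measurable_shift tau) ler01 (@mu2_shift R tau) (tri v')
    (EFin \o (fun x => h x * psi (x - tau))) mt' ih'.
  apply: eq_integrable => [|x _]; last by rewrite /= -psiE.
  by rewrite -[X in measurable X]setTI; exact: measurable_shift.
have mB : measurable B.
  by rewrite -[X in measurable X]setTI; exact: measurable_shift.
rewrite (Rintegral_split mt mB (L2_tri_integrableM o0 Lh cpsi) iB FE); congr (_ + _).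
rewrite -[RHS]mul1r -(@Rintegral_transfer _ _ _ _ R mu2 mu2 (fun x => x + tau) 1
    (measurable_shift tau) ler01 (@mu2_shift R tau) (tri v')
    (fun x => h x * psi (x - tau)) mt' ih').
by apply: eq_Rintegral => x _; exact: psiE.
Qed.

Lemma Rintegral_glue_split (h psi : pt R -> R) :
  L2 (tri v) h -> L2 (tri v') h -> continuous psi -> (forall x, ~ N x -> psi x = 0) ->
  \int[mu2]_(x in N) (Defs.glue (tri v) B tau h x * psi x) =
  \int[mu2]_(x in tri v) (h x * psi x) + \int[mu2]_(x in tri v') (h x * psi (x - tau)).
Proof.
move=> Lh Lh' cpsi psi0; apply: Rintegral_facet_split => // x.
have dj := tri_facet_disjoint o0 o0' Hseg Hn (x := x).
rewrite !patchE /Defs.glue -[point]/(0 : R).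
case: (boolP (x \in tri v)) => [xA|_].
  have /negbTE -> : x \notin B by rewrite notin_setE; move: xA; rewrite inE => /dj.
  rewrite addr0; case: (boolP (x \in N)) => // xN.
  by rewrite psi0 ?mulr0//; move: xN; rewrite notin_setE.
case: (boolP (x \in B)) => xB; last by rewrite mul0r addr0; case: ifP.
rewrite add0r; case: (boolP (x \in N)) => // xN.
by rewrite psi0 ?mulr0//; move: xN; rewrite notin_setE.
Qed.

(** Unlike [glue], which is 0 off the two open elements, [h] may be nonzero on the facet itself. The
    null line [L] through it is therefore removed first; elsewhere [psi] vanishes outside the two
    elements. *)
Lemma Rintegral_inner_split (Omega : set (pt R)) (h psi : pt R -> R) : tau = 0 ->
  open Omega -> bounded_set Omega -> tri v `<=` Omega -> tri v' `<=` Omega ->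
  L2 Omega h -> continuous psi -> (forall x, ~ N x -> psi x = 0) ->
  \int[mu2]_(x in Omega) (h x * psi x) =
  \int[mu2]_(x in tri v) (h x * psi x) + \int[mu2]_(x in tri v') (h x * psi (x - tau)).
Proof.
move=> t0 oO bO vO vO' Lh cpsi psi0.
have mO : measurable Omega by exact: open_measurable_plane.
pose L := [set x | bary v i x = 0].
have [mL L0] : measurable L /\ mu2 L = 0%E.
  pose t := tgt v i - src v i.
  have LE : L = [set x | - (t.1 * (src v i).2 - t.2 * (src v i).1) / orient v +
     (- t.2 / orient v) * x.1 + (t.1 / orient v) * x.2 = 0].
    by apply/funext => x; rewrite /L /bary /cross -/t /=; congr (_ = 0); ring.
  split.
    by rewrite LE; exact: measurable_line.
  rewrite LE; apply: mu2_line; rewrite !mulf_eq0 !invr_eq0 oppr_eq0 (negbTE o0) !orbF.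
  rewrite -negb_and; apply/negP => /andP[/eqP t2 /eqP t1].
  have := orient_edge_neq i o0; rewrite -subr_eq0 -/t => /eqP; apply.
  exact: pt_eqP.
have Lh1 := L2S mO (measurable_tri o0) vO Lh.
have Lh2 := L2S mO (measurable_tri o0') vO' Lh.
transitivity (\int[mu2]_(x in Omega `\` L) (h x * psi x)).
  have ih := L2_bounded_integrableM mO bO Lh cpsi.
  by rewrite /Rintegral (@negligible_integral _ _ R mu2 Omega L _ mL mO ih L0).
apply: Rintegral_facet_split => // x.
have dj := tri_facet_disjoint o0 o0' Hseg Hn (x := x).
rewrite !patchE -[point]/(0 : R).
case: (boolP (x \in tri v)) => [xA|xA].
  have /negbTE -> : x \notin B by rewrite notin_setE; move: xA; rewrite inE => /dj.
  rewrite addr0 ifT// inE; move: xA; rewrite inE => xA; split; first exact: vO.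
  by move/(tri_bary _ o0) : xA => /(_ i) + bx0; rewrite bx0 ltxx.
case: (boolP (x \in B)) => xB.
  rewrite add0r t0 addr0 ifT// inE; move: xB; rewrite inE => xB.
  split; first by apply: vO'; move: xB; rewrite /B /= t0 addr0.
  move=> bx0; move/(tri_bary _ o0') : xB => /(_ i').
  by rewrite (facet_bary o0 o0' Hseg Hn) bx0 mulr0 ltxx.
rewrite addr0; case: ifPn => //; rewrite inE => -[_ bx0].
rewrite psi0 ?mulr0// => Nx.
have [xv|xv|[bx _]] := facet_nbhdP o0 o0' Hseg Hn Nx; last exact: bx0.
- by move: xA; rewrite notin_setE => /(_ xv).
- by move: xB; rewrite notin_setE => /(_ xv).
Qed.

End facet_weak.

(** * Vanishing of jumps against smooth functions *)

Section jump_free.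
Context {R : realType}.
Notation mu := (@lebesgue_measure R).

Lemma derive_comp_shift (f : pt R -> R) (tau w x : pt R) : derivable f (x + tau) w ->
  'D_w (fun y => f (y + tau)) x = 'D_w f (x + tau).
Proof.
move=> /derivableP /is_derive_lineE H.
apply: derive_val; apply: is_derive_line.
by under eq_fun do rewrite -addrA.
Qed.

Lemma test_fun_notin (N : set (pt R)) (phi : pt R -> R) x : test_fun N phi ->
  ~ N x -> phi x = 0 /\ forall w, 'D_w phi x = 0.
Proof.
move=> [Cphi [C [cC CN] phi0]] Nx; have nCx : ~ C x by move=> /CN.
split; first exact: phi0.
move=> w; rewrite -[RHS](derive_cst (0 : R) x w).
apply: near_eq_derive.
have oC : open (~` C).
  by apply: closed_openC; apply: compact_closed cC; exact: norm_hausdorff.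
have : nbhs x (~` C) by exact: open_nbhs_nbhs.
by apply: filterS => y /phi0.
Qed.

(** The elements are only known to cover the closure of [Omega]; an open triangle in the closure
    lies in its interior, which is [Omega] again because slits are excluded. *)
Lemma tri_sub (Omega : set (pt R)) (v : triangle R) : interior (closure Omega) = Omega ->
  orient v != 0 -> hull v setT `<=` closure Omega -> tri v `<=` Omega.
Proof.
move=> intO o0 vO; rewrite -intO.
rewrite -open_subsetE; last exact: open_tri.
by apply: subset_trans vO; exact: tri_hull.
Qed.

Context (v v' : triangle R) (i i' : 'I_3) (tau : pt R).
Context (o0 : orient v != 0) (o0' : orient v' != 0).
Context (Hseg : segment (src v' i') (tgt v' i') =
  [set x + tau | x in segment (src v i) (tgt v i)]).
Context (Hn : normal v' i' = - normal v i).
Notation N := (facet_nbhd v v' i i' tau).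
Context (Omega : set (pt R)) (per : seq (pt R * pt R * pt R)).
Context (oO : open Omega) (bO : bounded_set Omega)
  (intO : interior (closure Omega) = Omega).
Context (vO : hull v setT `<=` closure Omega) (vO' : hull v' setT `<=` closure Omega).
Context (Htau : tau = 0 \/ exists2 p, p \in per &
  tau = p.2 /\ segment (src v i) (tgt v i) `<=` segment p.1.1 p.1.2).

Let tO : tri v `<=` Omega. Proof. exact: tri_sub. Qed.
Let tO' : tri v' `<=` Omega. Proof. exact: tri_sub. Qed.

Lemma open_segment_sub (a b c d : pt R) : a != b ->
  segment a b `<=` segment c d -> open_segment a b `<=` open_segment c d.
Proof.
move=> ab E x [s /=]; rewrite in_itv/= => /andP[s0 s1] <-.
have /E [p + pE] : segment a b a.
  by exists 0; rewrite /= ?in_itv/= ?lexx ?ler01// scale0r addr0.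
have /E [r + rE] : segment a b b.
  by exists 1; rewrite /= ?in_itv/= ?lexx ?ler01// scale1r addrC subrK.
rewrite /= !in_itv/= => /andP[p0 p1] /andP[r0 r1].
have pr : p != r by apply: contraNneq ab => pr; rewrite -rE -pE pr.
exists (p + s * (r - p)); last first.
  by rewrite -pE -rE; apply: pt_eqP; rewrite /= /GRing.scale/=; ring.
rewrite /= in_itv/=; have [lt|lt|E'] := ltrgtP p r.
- by apply/andP; split; nra.
- by apply/andP; split; nra.
- by rewrite E' eqxx in pr.
Qed.

(** For tau = 0 the facet neighbourhood lies in [Omega], so [phi] is a test function there.
    Otherwise the periodic clause of [weak_deriv_per] applies, with the element [v] and the
    translated element [v'] as the two glued pieces. *)
Lemma facet_weak_zero (f g phi : pt R -> R) d : L2 Omega f -> L2 Omega g ->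
  weak_deriv_per Omega per d f g -> test_fun N phi ->
  (\int[mu2]_(x in tri v) (f x * 'D_(evec d) phi x) +
   \int[mu2]_(x in tri v) (g x * phi x)) +
  (\int[mu2]_(x in tri v') (f x * 'D_(evec d) phi (x - tau)) +
   \int[mu2]_(x in tri v') (g x * phi (x - tau))) = 0.
Proof.
move=> Lf Lg [wO wper] tphi.
have mO : measurable Omega by exact: open_measurable_plane.
have mt := measurable_tri o0; have mt' := measurable_tri o0'.
have Cphi := tphi.1.
have cphi : continuous phi := Cn_continuous (Cphi 0%N).
have cdphi : continuous ('D_(evec d) phi) := Cn_continuous (Cn_derive d (Cphi 1%N)).
have phi0 x (Nx : ~ N x) : phi x = 0 := (test_fun_notin tphi Nx).1.
have dphi0 x (Nx : ~ N x) : 'D_(evec d) phi x = 0 := (test_fun_notin tphi Nx).2 _.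
have Lf1 := L2S mO mt tO Lf; have Lf2 := L2S mO mt' tO' Lf.
have Lg1 := L2S mO mt tO Lg; have Lg2 := L2S mO mt' tO' Lg.
rewrite addrACA.
have [t0|[p pin [tp Ep]]] := Htau.
  rewrite -(Rintegral_inner_split o0 o0' Hseg Hn t0 oO bO tO tO' Lf cdphi dphi0).
  rewrite -(Rintegral_inner_split o0 o0' Hseg Hn t0 oO bO tO tO' Lg cphi phi0).
  have [_ _ ->] := wO; first by rewrite addNr.
  have NO : N `<=` Omega.
    rewrite -intO; rewrite -open_subsetE; last exact: open_facet_nbhd.
    move=> x /(facet_nbhd_hull o0 o0' Hseg Hn)[/vO//|]; rewrite t0 addr0; exact: vO'.
  split => //; have [_ [C [cC CN] C0]] := tphi; exists C => //; split => //.
  exact: subset_trans CN NO.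
rewrite -(Rintegral_glue_split o0 o0' Hseg Hn Lf1 Lf2 cdphi dphi0).
rewrite -(Rintegral_glue_split o0 o0' Hseg Hn Lg1 Lg2 cphi phi0).
have [|||||||_ _ W] := wper p pin (tri v) ((fun x => x + tau) @^-1` tri v') N.
- exact: open_tri.
- apply: (@open_comp _ _ (fun x : pt R => x + tau) (tri v')); last exact: open_tri.
  by move=> x _; apply: cvgD; [exact: cvg_id|exact: cvg_cst].
- exact: open_facet_nbhd.
- rewrite -subset0 => x [xv xv']; exact: (tri_facet_disjoint o0 o0' Hseg Hn xv).
- exact: tO.
- by move=> x; rewrite /= tp => /tO'.
- move=> x /(facet_nbhdP o0 o0' Hseg Hn)[xv|xv|[_ xs]].
  + by left; left.
  + by left; right.
  + right; apply: (open_segment_sub _ Ep) => //.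
    by rewrite eq_sym orient_edge_neq.
by move: (W phi tphi); rewrite -tp => ->; rewrite addNr.
Qed.

Lemma facet_test_jump (f : pt R -> R) (g : 'I_2 -> pt R -> R)
    (t t' : 'I_3 -> pt R -> R) (phi : pt R -> R) :
  L2 Omega f -> (forall d, L2 Omega (g d)) ->
  (forall d, weak_deriv_per Omega per d f (g d)) ->
  (forall j, is_trace v j f g (t j)) -> (forall j, is_trace v' j f g (t' j)) ->
  test_fun N phi ->
  \int[mu]_(s in `[0, 1]) (t i (edge_pt v i s) * phi (edge_pt v i s)) =
  \int[mu]_(s in `[0, 1]) (t' i' (edge_pt v i s + tau) * phi (edge_pt v i s)).
Proof.
move=> Lf Lg wfg tr tr' tphi.
have mO : measurable Omega by exact: open_measurable_plane.
have mt := measurable_tri o0; have mt' := measurable_tri o0'.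
have Cphi := tphi.1.
have phi0 x (Nx : ~ N x) : phi x = 0 := (test_fun_notin tphi Nx).1.
(* One direction is enough: the component of the normal in a direction where it is nonzero is a
   common factor of both facet terms and cancels at the end. *)
have [d nd] := normal_neq0 i o0.
pose phi' x := phi (x - tau).
have Cphi' : Cn 1 phi' by exact: Cn_shift.
have Lf1 := L2S mO mt tO Lf; have Lf2 := L2S mO mt' tO' Lf.
have Lg1 e := L2S mO mt tO (Lg e); have Lg2 e := L2S mO mt' tO' (Lg e).
have E1 := green d o0 Lf1 Lg1 tr (Cphi 1%N).
have Dphi' x : f x * 'D_(evec d) phi (x - tau) = f x * 'D_(evec d) phi' x.
  by rewrite derive_comp_shift//; exact: Cn_derivable (Cphi 1%N).
have E2 : \int[mu2]_(x in tri v') (f x * 'D_(evec d) phi (x - tau)) +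
    \int[mu2]_(x in tri v') (g d x * phi (x - tau)) =
    \sum_j normal v' j d 0 * seg_int (src v' j) (tgt v' j) (fun x => t' j x * phi' x).
  apply: etrans (green d o0' Lf2 Lg2 tr' Cphi').
  by apply: (f_equal2 +%R); first exact: eq_Rintegral.
have : \sum_j normal v j d 0 * seg_int (src v j) (tgt v j) (fun x => t j x * phi x) +
    \sum_j normal v' j d 0 * seg_int (src v' j) (tgt v' j) (fun x => t' j x * phi' x) = 0.
  apply: etrans (facet_weak_zero Lf (Lg d) (wfg d) tphi).
  by apply: (f_equal2 +%R); [exact: esym E1|exact: esym E2].
(* On each other edge of [v] one of the four functions [facet_cutoff] is 0, so that edge lies
   outside [N] and [phi] vanishes on it. The same holds for [v'] below. *)
rewrite (bigD1 i)//= [X in _ * _ + X]big1 ?addr0; last first.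
  move=> j ji; rewrite /seg_int [X in _ * (_ * X)](_ : _ = 0) ?mulr0//.
  rewrite /Rintegral integral0_eq// => s _; rewrite phi0 ?mulr0//.
  rewrite -/(edge_pt v j s) => Ns.
  have [b0 _ _] := edge_pt_bary j s o0.
  have [jE|jE] : j = i + 1 \/ j = i + 2.
    by move: j i ji {b0 Ns}; apply: I3P; apply: I3P; rewrite ?I3E ?eqxx//; auto.
  - by have := Ns (false, true); rewrite /facet_cutoff /= -jE b0 ltxx.
  - by have := Ns (false, false); rewrite /facet_cutoff /= -jE b0 ltxx.
rewrite (bigD1 i')//= [X in _ + (_ * _ + X)]big1 ?addr0; last first.
  move=> j ji; rewrite /seg_int [X in _ * (_ * X)](_ : _ = 0) ?mulr0//.
  rewrite /Rintegral integral0_eq// => s _; rewrite /phi' phi0 ?mulr0//.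
  rewrite -/(edge_pt v' j s) => Ns.
  have [b0 _ _] := edge_pt_bary j s o0'.
  have [jE|jE] : j = i' + 1 \/ j = i' + 2.
    by move: j i' ji {b0 Ns}; apply: I3P; apply: I3P; rewrite ?I3E ?eqxx//; auto.
  - by have := Ns (true, true); rewrite /facet_cutoff /= -jE subrK b0 ltxx.
  - by have := Ns (true, false); rewrite /facet_cutoff /= -jE subrK b0 ltxx.
have it' : mu.-integrable `[0, 1]
    (EFin \o (fun s => (t' i' (edge_pt v' i' s) * phi' (edge_pt v' i' s)))).
  have [mt1 mt2 _] := tr' i'.
  apply: (edge_L2_integrableM (h := fun s => phi' (edge_pt v' i' s))); first by split.
  move=> s; apply: (@continuous_comp _ _ _ (edge_pt v' i') phi').
    exact: continuous_edge_pt.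
  exact: (Cn_continuous Cphi').
rewrite (facet_seg_int o0 Hseg it').
have -> : normal v' i' d 0 = - normal v i d 0 by rewrite Hn !mxE.
rewrite mulNr -mulrBr => /eqP; rewrite mulf_eq0 (negbTE nd) /= subr_eq0 => /eqP.
rewrite /seg_int -/(edge_len v i) => /(mulfI (lt0r_neq0 (edge_len_gt0 i o0))) ->.
by apply: eq_Rintegral => s _; rewrite /phi' addrK.
Qed.

(* Green's formula on both elements turns the weak derivative across the facet
   into the vanishing of the jump against test functions; the cutoffs of
   facet_cutoff tend to 1 on the open facet. *)
Lemma facet_jump (f : pt R -> R) (g : 'I_2 -> pt R -> R)
    (t t' : 'I_3 -> pt R -> R) (P : pt R -> R) :
  L2 Omega f -> (forall d, L2 Omega (g d)) ->
  (forall d, weak_deriv_per Omega per d f (g d)) ->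
  (forall j, is_trace v j f g (t j)) -> (forall j, is_trace v' j f g (t' j)) ->
  (forall n, Cn n P) ->
  seg_int (src v i) (tgt v i) (fun x => (t i x - t' i' (x + tau)) * P x) = 0.
Proof.
move=> Lf Lg wfg tr tr' CP; rewrite /seg_int -[X in _ * Rintegral _ _ X]/(fun s => _).
have ci (q : pt R -> R) : continuous q -> continuous (fun s => q (edge_pt v i s)).
  move=> cq s; apply: (@continuous_comp _ _ _ (edge_pt v i) q); last exact: cq.
  exact: continuous_edge_pt.
have it (q : pt R -> R) : continuous q -> mu.-integrable `[0, 1]
    (EFin \o (fun s => t i (edge_pt v i s) * q (edge_pt v i s))).
  move=> cq; have [mt1 mt2 _] := tr i.
  by apply: (edge_L2_integrableM (h := fun s => q (edge_pt v i s))); [split|exact: ci].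
have it' (q : pt R -> R) : continuous q -> mu.-integrable `[0, 1]
    (EFin \o (fun s => t' i' (edge_pt v i s + tau) * q (edge_pt v i s))).
  move=> cq.
  have -> : (fun s => t' i' (edge_pt v i s + tau) * q (edge_pt v i s)) =
      (fun s => (fun y => t' i' y * q (y - tau)) (edge_pt v i s + tau)).
    by apply/funext => s; rewrite addrK.
  apply: (facet_integrable o0 Hseg (F := fun y => t' i' y * q (y - tau))).
  have [mt1 mt2 _] := tr' i'.
  apply: (edge_L2_integrableM (h := fun s => q (edge_pt v' i' s - tau))); first by split.
  move=> s; apply: (@continuous_comp _ _ _ (fun s => edge_pt v' i' s - tau) q); last exact: cq.
  by apply: cvgB; [exact: continuous_edge_pt|exact: cvg_cst].
have B (q : pt R -> R) : continuous q ->
    \int[mu]_(s in `[0, 1])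
      ((t i (edge_pt v i s) - t' i' (edge_pt v i s + tau)) * q (edge_pt v i s)) =
    \int[mu]_(s in `[0, 1]) (t i (edge_pt v i s) * q (edge_pt v i s)) -
    \int[mu]_(s in `[0, 1]) (t' i' (edge_pt v i s + tau) * q (edge_pt v i s)).
  move=> cq; rewrite -(RintegralB _ (it _ cq) (it' _ cq))//.
  by apply: eq_Rintegral => s _; rewrite mulrBl.
have cP : continuous P := Cn_continuous (CP 0%N).
pose h s := (t i (edge_pt v i s) - t' i' (edge_pt v i s + tau)) * P (edge_pt v i s).
have ih : mu.-integrable `[0, 1] (EFin \o h).
  have := @integrableB _ _ R mu _ (measurable_itv _) _ _ (it _ cP) (it' _ cP).
  by apply: eq_integrable => // s _; rewrite /= -EFinB -mulrBl.
(* Some of the affine functions in the cutoffs vanish at the end points of the facet, so the limit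
   has to be taken over the open parameter interval. *)
have oc (k : R -> R) : mu.-integrable `[0, 1] (EFin \o k) ->
    \int[mu]_(s in `]0, 1[) k s = \int[mu]_(s in `[0, 1]) k s.
  move=> ki; rewrite Rintegral_itv_obnd_cbnd ?Rintegral_itv_bndo_bndc//.
    by apply: integrableS ki => // s /=; rewrite !in_itv/= => /andP[-> /ltW ->].
  by apply: integrableS ki => // s /=; rewrite !in_itv/= => /andP[/ltW -> /ltW ->].
suff -> : \int[mu]_(s in `[0, 1]) h s = 0 by rewrite mulr0.
pose c (n : nat) x := \prod_p flat 1 (n%:R * facet_cutoff v v' i i' tau p x - 1).
have tphi n : test_fun N (fun x => P x * c n x).
  apply: test_fun_cutoff => //.
  - exact: facet_cutoff_affine.
  - exact: bounded_facet_nbhd o0 o0' Hseg Hn.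
have cPc n : continuous (fun x => P x * c n x) := Cn_continuous ((tphi n).1 0%N).
have hc n : (fun s => h s * c n (edge_pt v i s)) = (fun s => (t i (edge_pt v i s) -
    t' i' (edge_pt v i s + tau)) * (P (edge_pt v i s) * c n (edge_pt v i s))).
  by apply/funext => s; rewrite /h mulrA.
have z n : \int[mu]_(s in `]0, 1[) (h s * c n (edge_pt v i s)) = 0.
  have ihc : mu.-integrable `[0, 1] (EFin \o (fun s => h s * c n (edge_pt v i s))).
    rewrite hc.
    have := @integrableB _ _ R mu _ (measurable_itv _) _ _ (it _ (cPc n)) (it' _ (cPc n)).
    by apply: eq_integrable => // s _; rewrite /= -EFinB -mulrBl.
  rewrite oc// hc (B _ (cPc n)) (facet_test_jump Lf Lg wfg tr tr' (tphi n)).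
  by rewrite subrr.
rewrite -oc//.
have ih' : mu.-integrable `]0, 1[ (EFin \o h).
  by apply: integrableS ih => // s /=; rewrite !in_itv/= => /andP[/ltW -> /ltW ->].
have mfc p : measurable_fun (`]0, 1[%classic : set R)
    (fun s => facet_cutoff v v' i i' tau p (edge_pt v i s)).
  apply: measurable_funTS; apply: continuous_measurable_fun.
  by apply: ci; apply: is_affine_continuous; exact: facet_cutoff_affine.
have fc0 p s : (`]0, 1[%classic : set R) s ->
    0 < facet_cutoff v v' i i' tau p (edge_pt v i s).
  by rewrite /= in_itv/=; exact: facet_cutoff_edge.
have := @Rintegral_cutoff_cvg R _ _ mu `]0, 1[%classic _
  (fun p s => facet_cutoff v v' i i' tau p (edge_pt v i s)) h (measurable_itv _) ih' mfc fc0.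
have -> : (fun n : nat => \int[mu]_(s in `]0, 1[) (h s * \prod_p flat 1
    (n%:R * facet_cutoff v v' i i' tau p (edge_pt v i s) - 1))) = fun _ => 0.
  exact/funext.
by move=> H; have := cvg_lim (@Rhausdorff R) H; rewrite (lim_cst (@Rhausdorff R)) => <-.
Qed.

End jump_free.

(** * The Laplacian on an element *)

Section second_derivatives.
Context {R : realType} (Omega : set (pt R)).
Context (oO : open Omega) (bO : bounded_set Omega).
Let mO : measurable Omega. Proof. exact: open_measurable_plane. Qed.

Lemma test_fun_sub (N N' : set (pt R)) (phi : pt R -> R) : N `<=` N' ->
  test_fun N phi -> test_fun N' phi.
Proof.
by move=> NN' [Cphi [C [cC CN] C0]]; split => //; exists C => //; split => // x /CN /NN'.
Qed.

Lemma test_fun_derive (N : set (pt R)) (phi : pt R -> R) d :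
  test_fun N phi -> test_fun N ('D_(evec d) phi).
Proof.
move=> [Cphi [C [cC CN] C0]]; split; first by move=> n; exact: Cn_derive (Cphi n.+1).
exists C => // x Cx; have tC : test_fun C phi by split => //; exists C => //; split.
by have [_ ->] := test_fun_notin tC Cx.
Qed.

(** Both derivatives are moved onto [phi], where F = kappa f is a pointwise identity. The first
    derivatives [G'] and [kappa] times [G] are never compared. *)
Lemma weak_second_deriv (kappa : R) (f F G G' H H' phi : pt R -> R) d :
  (forall x, F x = kappa * f x) -> L2 Omega f -> L2 Omega G -> L2 Omega H ->
  weak_deriv Omega d f G -> weak_deriv Omega d G H ->
  weak_deriv Omega d F G' -> weak_deriv Omega d G' H' -> test_fun Omega phi ->
  \int[mu2]_(x in Omega) (H' x * phi x) = kappa * \int[mu2]_(x in Omega) (H x * phi x).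
Proof.
move=> FE Lf LG LH [_ _ fG] [_ _ GH] [_ _ FG] [_ _ GH'] tphi.
have tdphi := test_fun_derive d tphi; have tddphi := test_fun_derive d tdphi.
have cdd : continuous ('D_(evec d) ('D_(evec d) phi)) := Cn_continuous (tddphi.1 0%N).
have ifdd := L2_bounded_integrableM mO bO Lf cdd.
apply: oppr_inj; rewrite -GH'//; apply: oppr_inj; rewrite -FG//.
have -> : \int[mu2]_(x in Omega) (H x * phi x) =
    \int[mu2]_(x in Omega) (f x * 'D_(evec d) ('D_(evec d) phi) x).
  by rewrite fG// GH// opprK.
rewrite opprK -(@RintegralZl _ _ R mu2 Omega _ kappa mO ifdd).
by apply: eq_Rintegral => x _; rewrite FE mulrA.
Qed.

(* Weak derivatives are determined almost everywhere only; testing with w times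
   cutoffs tending to 1 on the element compares H' and kappa H without
   the fundamental lemma of the calculus of variations. *)
Lemma weak_second_deriv_tri (v : triangle R) (kappa : R) (f F G G' H H' w : pt R -> R) d :
  orient v != 0 -> tri v `<=` Omega -> (forall n, Cn n w) ->
  (forall x, F x = kappa * f x) -> L2 Omega f -> L2 Omega G -> L2 Omega H -> L2 Omega H' ->
  weak_deriv Omega d f G -> weak_deriv Omega d G H ->
  weak_deriv Omega d F G' -> weak_deriv Omega d G' H' ->
  \int[mu2]_(x in tri v) (H' x * w x) = kappa * \int[mu2]_(x in tri v) (H x * w x).
Proof.
move=> o0 vO Cw FE Lf LG LH LH' wfG wGH wFG wGH'.
have mt := measurable_tri o0.
have LH1 := L2S mO mt vO LH; have LH1' := L2S mO mt vO LH'.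
have cw : continuous w := Cn_continuous (Cw 0%N).
pose c (n : nat) x := \prod_j flat 1 (n%:R * bary v j x - 1).
have tphi n : test_fun (tri v) (fun x => w x * c n x).
  have sub : [set x | forall j, 0 < bary v j x] `<=` tri v.
    by move=> x bx; apply/tri_bary.
  apply: test_fun_cutoff => //; first by move=> j; exact: bary_affine.
  by apply: sub_boundedr (bounded_tri v) => A; apply: subset_trans.
have cwc n : continuous (fun x => w x * c n x) := Cn_continuous ((tphi n).1 0%N).
have restr h n : \int[mu2]_(x in Omega) (h x * (w x * c n x)) =
    \int[mu2]_(x in tri v) (h x * (w x * c n x)).
  rewrite (Rintegral_mkcond mu2 Omega) (Rintegral_mkcond mu2 (tri v)).
  apply: eq_Rintegral => x _; rewrite !patchE -[point]/(0 : R).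
  case: (boolP (x \in tri v)) => xv.
    by rewrite ifT// inE; apply: vO; move: xv; rewrite inE.
  case: ifP => // _.
  have [|-> _] := @test_fun_notin R _ _ x (tphi n); last by rewrite mulr0.
  by move: xv; rewrite notin_setE.
have E n : \int[mu2]_(x in tri v) (H' x * (w x * c n x)) =
    kappa * \int[mu2]_(x in tri v) (H x * (w x * c n x)).
  rewrite -!restr; apply: weak_second_deriv FE Lf LG LH wfG wGH wFG wGH' _.
  exact: test_fun_sub vO (tphi n).
have mb j : measurable_fun (tri v) (bary v j).
  apply: measurable_funTS; apply: continuous_measurable_plane.
  by apply: is_affine_continuous; exact: bary_affine.
have b0 j x : tri v x -> 0 < bary v j x by move/(tri_bary _ o0); exact.
have lim h : L2 (tri v) h -> \int[mu2]_(x in tri v) (h x * (w x * c n x)) @[n --> \oo] -->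
    \int[mu2]_(x in tri v) (h x * w x).
  move=> Lh; have := @Rintegral_cutoff_cvg R _ _ mu2 (tri v) _ (bary v)
    (fun x => h x * w x) mt (L2_tri_integrableM o0 Lh cw) mb b0.
  apply: cvg_trans; apply: near_eq_cvg; apply: nearW => n.
  by apply: eq_Rintegral => x _; rewrite mulrA.
have l1 := lim _ LH1'.
have l2 : kappa * \int[mu2]_(x in tri v) (H x * (w x * c n x)) @[n --> \oo] -->
    kappa * \int[mu2]_(x in tri v) (H x * w x).
  by apply: cvgMl_tmp; exact: lim.
have EE : (fun n => \int[mu2]_(x in tri v) (H' x * (w x * c n x))) =
    (fun n => kappa * \int[mu2]_(x in tri v) (H x * (w x * c n x))) by exact/funext.
by rewrite EE in l1; rewrite -(cvg_lim (@Rhausdorff R) l1) (cvg_lim (@Rhausdorff R) l2).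
Qed.

End second_derivatives.

(** * The NIPG identity *)

Section edge_integrals.
Context {R : realType}.
Notation mu := (@lebesgue_measure R).

Lemma integrable_sumR d (T : measurableType d) (m : {measure set T -> \bar R})
    (D : set T) (J : finType) (F : J -> T -> R) : measurable D ->
  (forall j, m.-integrable D (EFin \o F j)) ->
  m.-integrable D (EFin \o (fun x => \sum_j F j x)).
Proof.
move=> mD Fi; elim: (index_enum J) => [|j r IH].
  under eq_fun do rewrite big_nil; exact: integrable0.
under eq_fun do rewrite big_cons.
by have := integrableD mD (Fi j) IH; apply: eq_integrable.
Qed.

Lemma Rintegral_sum d (T : measurableType d) (m : {measure set T -> \bar R})
    (D : set T) (J : finType) (F : J -> T -> R) : measurable D ->
  (forall j, m.-integrable D (EFin \o F j)) ->
  \int[m]_(x in D) (\sum_j F j x) = \sum_j \int[m]_(x in D) F j x.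
Proof.
move=> mD Fi.
suff H r : m.-integrable D (EFin \o (fun x => \sum_(j <- r) F j x)) /\
    \int[m]_(x in D) (\sum_(j <- r) F j x) = \sum_(j <- r) \int[m]_(x in D) F j x.
  by have [] := H (index_enum J).
elim: r => [|j r [ir IH]].
  split; first by under eq_fun do rewrite big_nil; exact: integrable0.
  rewrite big_nil /Rintegral integral0_eq// => x _; by rewrite big_nil.
split.
  under eq_fun do rewrite big_cons.
  by have := integrableD mD (Fi j) ir; apply: eq_integrable.
rewrite big_cons -IH -RintegralD//.
by apply: eq_Rintegral => x _; rewrite big_cons.
Qed.

Definition edge_integrable (v : triangle R) (i : 'I_3) (F : pt R -> R) : Prop :=
  mu.-integrable `[0, 1] (EFin \o (fun s => F (edge_pt v i s))).

Context (v : triangle R) (i : 'I_3).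
Notation EI := (edge_integrable v i).
Notation SI := (seg_int (src v i) (tgt v i)).
Let m01 : measurable (`[0, 1]%classic : set (measurableTypeR R)) := measurable_itv _.

Lemma edge_integrableB F1 F2 : EI F1 -> EI F2 -> EI (fun x => F1 x - F2 x).
Proof. by move=> i1 i2; have := integrableB m01 i1 i2; apply: eq_integrable. Qed.

Lemma edge_integrableZ r F : EI F -> EI (fun x => r * F x).
Proof. by move=> iF; have := @integrableZl _ _ R mu _ m01 r _ iF; apply: eq_integrable. Qed.

Lemma edge_integrable_sum (J : finType) (F : J -> pt R -> R) :
  (forall j, EI (F j)) -> EI (fun x => \sum_j F j x).
Proof. by move=> Fi; exact: (integrable_sumR m01 Fi). Qed.

Lemma seg_intB F1 F2 : EI F1 -> EI F2 -> SI (fun x => F1 x - F2 x) = SI F1 - SI F2.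
Proof.
by move=> i1 i2; rewrite /seg_int -mulrBr -(RintegralB m01 i1 i2).
Qed.

Lemma seg_intD F1 F2 : EI F1 -> EI F2 -> SI (fun x => F1 x + F2 x) = SI F1 + SI F2.
Proof.
by move=> i1 i2; rewrite /seg_int -mulrDr -(RintegralD m01 i1 i2).
Qed.

Lemma seg_intZ r F : EI F -> SI (fun x => r * F x) = r * SI F.
Proof.
by move=> iF; rewrite /seg_int mulrCA -(RintegralZl r m01 iF).
Qed.

Lemma seg_int_sum (J : finType) (F : J -> pt R -> R) :
  (forall j, EI (F j)) -> SI (fun x => \sum_j F j x) = \sum_j SI (F j).
Proof.
by move=> Fi; rewrite /seg_int -mulr_sumr -(Rintegral_sum m01 Fi).
Qed.

Lemma seg_int_ext F1 F2 : F1 =1 F2 -> SI F1 = SI F2.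
Proof. by move=> /funext ->. Qed.

Lemma edge_integrable_trace f g t P : is_trace v i f g t -> continuous P ->
  EI (fun x => t x * P x).
Proof.
move=> [mt t2 _] cP; apply: (edge_L2_integrableM (h := fun s => P (edge_pt v i s))).
  by split.
move=> s; apply: (@continuous_comp _ _ _ (edge_pt v i) P); last exact: cP.
exact: continuous_edge_pt.
Qed.

End edge_integrals.

Section facet_avg_jump.
Context {R : realType}.
Context (v v' : triangle R) (i i' : 'I_3) (tau : pt R).
Context (o0 : orient v != 0) (o0' : orient v' != 0).
Context (Hseg : segment (src v' i') (tgt v' i') =
  [set x + tau | x in segment (src v i) (tgt v i)]).
Context (Hn : normal v' i' = - normal v i).
Context (Omega : set (pt R)) (per : seq (pt R * pt R * pt R)).
Context (oO : open Omega) (bO : bounded_set Omega)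
  (intO : interior (closure Omega) = Omega).
Context (vO : hull v setT `<=` closure Omega) (vO' : hull v' setT `<=` closure Omega).
Context (Htau : tau = 0 \/ exists2 p, p \in per &
  tau = p.2 /\ segment (src v i) (tgt v i) `<=` segment p.1.1 p.1.2).

Context (f : pt R -> R) (g : 'I_2 -> pt R -> R) (t t' : 'I_3 -> pt R -> R).
Context (Lf : L2 Omega f) (wg : weak_grad Omega per f g).
Context (tr : forall j, is_trace v j f g (t j)) (tr' : forall j, is_trace v' j f g (t' j)).

Lemma edge_integrable_trace_shift P : continuous P ->
  edge_integrable v i (fun x => t' i' (x + tau) * P x).
Proof.
move=> cP.
have -> : (fun x => t' i' (x + tau) * P x) =
    (fun x => (fun y => t' i' y * P (y - tau)) (x + tau)).
  by apply/funext => x; rewrite addrK.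
apply: (facet_integrable o0 Hseg (F := fun y => t' i' y * P (y - tau))).
apply: (edge_integrable_trace (P := fun y => P (y - tau)) (tr' i')).
move=> x; apply: (@continuous_comp _ _ _ (fun x : pt R => x - tau) P); last exact: cP.
by apply: cvgB; [exact: cvg_id|exact: cvg_cst].
Qed.

Lemma edge_integrable_jump P : continuous P ->
  edge_integrable v i (fun x => (t i x - t' i' (x + tau)) * P x).
Proof.
move=> cP; have := edge_integrableB (edge_integrable_trace (tr i) cP)
  (edge_integrable_trace_shift cP).
by apply: eq_integrable => // s _; rewrite /= mulrBl.
Qed.

Lemma seg_int_jump P : (forall n, Cn n P) ->
  seg_int (src v i) (tgt v i) (fun x => (t i x - t' i' (x + tau)) * P x) = 0.
Proof.
apply: (facet_jump o0 o0' Hseg Hn oO bO intO vO vO' Htau Lf _ _ tr tr').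
- by move=> d; case: (wg d).
- by move=> d; case: (wg d).
Qed.

(* t w - t' w' = {t} [w] + [t] {w}, and the jump [t] integrates to 0 against the
   smooth average {w}. *)
Lemma seg_int_avg_jump w w' : (forall n, Cn n w) -> (forall n, Cn n w') ->
  edge_integrable v i
    (fun x => 2^-1 * (t i x + t' i' (x + tau)) * (w x - w' (x + tau))) /\
  seg_int (src v i) (tgt v i) (fun x => t i x * w x) -
  seg_int (src v' i') (tgt v' i') (fun x => t' i' x * w' x) =
  seg_int (src v i) (tgt v i)
    (fun x => 2^-1 * (t i x + t' i' (x + tau)) * (w x - w' (x + tau))).
Proof.
move=> Cw Cw'; pose w1 x := w' (x + tau).
have Cw1 n : Cn n w1 by exact: Cn_shift.
pose P x := 2^-1 * (w x + w1 x).
have CP n : Cn n P by apply: CnM; [exact: Cn_cst|exact: CnD].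
have cw : continuous w := Cn_continuous (Cw 0%N).
have cw' : continuous w' := Cn_continuous (Cw' 0%N).
have cw1 : continuous w1 := Cn_continuous (Cw1 0%N).
have cP : continuous P := Cn_continuous (CP 0%N).
have i1 := edge_integrable_trace (tr i) cw.
have i2 := edge_integrable_trace_shift cw1.
have i3 := edge_integrable_jump cP.
have E x : 2^-1 * (t i x + t' i' (x + tau)) * (w x - w1 x) =
    t i x * w x - t' i' (x + tau) * w1 x - (t i x - t' i' (x + tau)) * P x.
  by rewrite /P; field.
have -> : (fun x => 2^-1 * (t i x + t' i' (x + tau)) * (w x - w' (x + tau))) =
    (fun x => t i x * w x - t' i' (x + tau) * w1 x - (t i x - t' i' (x + tau)) * P x).
  exact/funext.
have i12 := edge_integrableB i1 i2.
split; first exact: edge_integrableB.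
rewrite (seg_intB i12 i3) (seg_intB i1 i2) (seg_int_jump CP) subr0; congr (_ - _).
apply: (facet_seg_int o0 Hseg (F := fun x => t' i' x * w' x)).
exact: edge_integrable_trace (tr' i') cw'.
Qed.

End facet_avg_jump.

(** * Viscous fluxes through element boundaries *)

Section viscous_flux.
Context {R : realType}.
Implicit Types (v : triangle R) (i c : 'I_3) (d : 'I_2) (nuT : R).

Lemma inner_col (A B : 'cV[R]_3) : inner A B = \sum_c A c 0 * B c 0.
Proof. by apply: eq_bigr => c _; rewrite big_ord1. Qed.

(** The factor by which [visc] multiplies row c. With 0 for the mass equation, all three components
    follow the same computation. *)
Definition visc_coef nuT c : R := if c == 0 then 0 else nuT.

Lemma viscE nuT n (A : 'M[R]_(3, n)) c (j : 'I_n) :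
  visc nuT A c j = visc_coef nuT c * A c j.
Proof. by rewrite mxE /visc_coef; case: ifP => _; rewrite ?mul0r. Qed.

Lemma inner_visc_normal nuT (A : 'M[R]_(3, 2)) (n : 'cV[R]_2) (y : 'cV[R]_3) :
  inner (visc nuT A *m n) y =
  \sum_c \sum_d visc_coef nuT c * n d 0 * (A c d * y c 0).
Proof.
rewrite inner_col; apply: eq_bigr => c _; rewrite mxE mulr_suml.
by apply: eq_bigr => d _; rewrite viscE; ring.
Qed.

Definition visc_flux nuT v i (t : pt R -> 'M[R]_(3, 2)) (y : pt R -> 'cV[R]_3) : R :=
  seg_int (src v i) (tgt v i) (fun x => inner (visc nuT (t x) *m normal v i) (y x)).

Lemma visc_fluxE nuT v i (t : pt R -> 'M[R]_(3, 2)) (y : pt R -> 'cV[R]_3) :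
  (forall c d, edge_integrable v i (fun x => t x c d * y x c 0)) ->
  visc_flux nuT v i t y = \sum_c \sum_d visc_coef nuT c * normal v i d 0 *
    seg_int (src v i) (tgt v i) (fun x => t x c d * y x c 0).
Proof.
move=> ei; rewrite /visc_flux.
under [in LHS]seg_int_ext do rewrite inner_visc_normal.
rewrite seg_int_sum; last first.
  by move=> c; apply: edge_integrable_sum => d; apply: edge_integrableZ.
apply: eq_bigr => c _; rewrite seg_int_sum; last by move=> d; apply: edge_integrableZ.
by apply: eq_bigr => d _; rewrite seg_intZ.
Qed.

Context (Omega : set (pt R)) (per : seq (pt R * pt R * pt R)).
Context (oO : open Omega) (bO : bounded_set Omega).
Context (v : triangle R) (o0 : orient v != 0) (triO : tri v `<=` Omega) (nuT : R).
Context (q : pt R -> 'cV[R]_3) (G : 'I_3 -> 'I_2 -> pt R -> R).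
Context (H : 'I_3 -> 'I_2 -> 'I_2 -> pt R -> R).
Context (Lq : forall c, L2 Omega (fun x => q x c 0)).
Context (wG : forall c, weak_grad Omega per (fun x => q x c 0) (G c)).
Context (wH : forall c d, weak_grad Omega per (G c d) (H c d)).
Context (A : pt R -> 'M[R]_(3, 2)) (AG : forall x, tri v x -> forall c d, A x c d = G c d x).
Context (t : 'I_3 -> pt R -> 'M[R]_(3, 2)).
Context (tG : forall i c d, is_trace v i (G c d) (H c d) (fun x => t i x c d)).
Context (y : pt R -> 'cV[R]_3) (Cy : forall c n, Cn n (fun x => y x c 0)).
Context (lapS : pt R -> 'cV[R]_3).
Context (hlap : forall c, weak_laplacian Omega per
  (fun x => visc nuT (q x) c 0) (fun x => lapS x c 0)).

Let cy c : continuous (fun x => y x c 0). Proof. exact: (Cn_continuous (Cy c 0%N)). Qed.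
Let mtri : measurable (tri v). Proof. exact: measurable_tri. Qed.
Let mO : measurable Omega. Proof. exact: open_measurable_plane. Qed.
Let LGO c d : L2 Omega (G c d). Proof. by have [] := wG c d. Qed.
Let LHO c d d' : L2 Omega (H c d d'). Proof. by have [] := wH c d d'. Qed.
Let LG c d : L2 (tri v) (G c d). Proof. exact: L2S mO mtri triO (LGO c d). Qed.
Let LH c d d' : L2 (tri v) (H c d d'). Proof. exact: L2S mO mtri triO (LHO c d d'). Qed.

Lemma tri_int_visc_grad : \int[mu2]_(x in tri v) inner (visc nuT (A x)) (grad y x) =
  \sum_c \sum_d visc_coef nuT c *
    \int[mu2]_(x in tri v) (G c d x * 'D_(evec d) (fun x => y x c 0) x).
Proof.
have ci c d : continuous ('D_(evec d) (fun x => y x c 0)).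
  exact: (Cn_continuous (Cn_derive d (Cy c 1%N))).
have ii c d : mu2.-integrable (tri v)
    (EFin \o (fun x => G c d x * 'D_(evec d) (fun x => y x c 0) x)).
  exact: L2_tri_integrableM.
have iz c d : mu2.-integrable (tri v) (EFin \o (fun x => visc_coef nuT c *
    (G c d x * 'D_(evec d) (fun x => y x c 0) x))).
  by have := @integrableZl _ _ R mu2 (tri v) mtri (visc_coef nuT c) _ (ii c d);
     apply: eq_integrable.
transitivity (\int[mu2]_(x in tri v) (\sum_c \sum_d visc_coef nuT c *
    (G c d x * 'D_(evec d) (fun x => y x c 0) x))).
  apply: eq_Rintegral => x /set_mem tx; apply: eq_bigr => c _; apply: eq_bigr => d _.
  by rewrite viscE AG// mxE mulrA.
apply: etrans (@Rintegral_sum _ _ _ mu2 _ _ _ mtri _) _.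
  by move=> c; exact: (@integrable_sumR _ _ _ mu2 _ _ _ mtri (iz c)).
apply: eq_bigr => c _; apply: etrans (@Rintegral_sum _ _ _ mu2 _ _ _ mtri (iz c)) _.
by apply: eq_bigr => d _; exact (@RintegralZl _ _ R mu2 (tri v) _ (visc_coef nuT c) mtri (ii c d)).
Qed.

(** [hlap] comes with its own first and second derivatives of S(q), unrelated to [G] and [H]. They
    are matched under the integral, one pure second derivative at a time, with kappa =
    [visc_coef nuT c]. *)
Lemma tri_int_visc_laplacian : \int[mu2]_(x in tri v) inner (lapS x) (y x) =
  \sum_c \sum_d visc_coef nuT c * \int[mu2]_(x in tri v) (H c d d x * y x c 0).
Proof.
have lapP c : exists h : 'I_2 -> pt R -> R,
    [/\ forall d, L2 (tri v) (h d),
        forall d, \int[mu2]_(x in tri v) (h d x * y x c 0) =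
          visc_coef nuT c * \int[mu2]_(x in tri v) (H c d d x * y x c 0) &
        forall x, tri v x -> lapS x c 0 = \sum_d h d x].
  have [g [h [gP hP lE]]] := hlap c; exists (fun d => h d d); split.
  - by move=> d; have [Lh _] := hP d d; exact: L2S mO mtri triO Lh.
  - move=> d; have [Lh [wh _]] := hP d d; have [Lg [wg _]] := gP d.
    have [_ [wGd _]] := wG c d; have [_ [wHd _]] := wH c d d.
    apply: (@weak_second_deriv_tri _ _ oO bO v (visc_coef nuT c) _ _ _ _ _ _ _ d
      o0 triO (Cy c) _ (Lq c) (LGO c d) (LHO c d d) Lh wGd wHd wg wh).
    by move=> x; rewrite viscE.
  - by move=> x /triO; exact: lE.
have [h hP] := choice lapP.
have ii c d : mu2.-integrable (tri v) (EFin \o (fun x => h c d x * y x c 0)).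
  by apply: L2_tri_integrableM => //; have [Lh _ _] := hP c.
transitivity (\int[mu2]_(x in tri v) (\sum_c \sum_d h c d x * y x c 0)).
  apply: eq_Rintegral => x /set_mem tx; rewrite inner_col; apply: eq_bigr => c _.
  by have [_ _ ->//] := hP c; rewrite mulr_suml.
apply: etrans (@Rintegral_sum _ _ _ mu2 _ _ _ mtri _) _.
  by move=> c; exact: (@integrable_sumR _ _ _ mu2 _ _ _ mtri (ii c)).
apply: eq_bigr => c _; apply: etrans (@Rintegral_sum _ _ _ mu2 _ _ _ mtri (ii c)) _.
by apply: eq_bigr => d _; have [_ hE _] := hP c; exact: hE.
Qed.

Lemma tri_visc_green : \int[mu2]_(x in tri v) inner (visc nuT (A x)) (grad y x) =
  - (\int[mu2]_(x in tri v) inner (lapS x) (y x)) + \sum_i visc_flux nuT v i (t i) y.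
Proof.
rewrite tri_int_visc_grad tri_int_visc_laplacian.
have -> : \sum_i visc_flux nuT v i (t i) y = \sum_c \sum_d visc_coef nuT c *
    \sum_i normal v i d 0 *
      seg_int (src v i) (tgt v i) (fun x => t i x c d * y x c 0).
  under eq_bigr => i _.
    rewrite visc_fluxE; last first.
      move=> c d.
      exact (edge_integrable_trace (P := fun x => y x c 0) (tG i c d) (cy (c := c))).
    over.
  rewrite exchange_big; apply: eq_bigr => c _; rewrite exchange_big; apply: eq_bigr => d _.
  by rewrite mulr_sumr; apply: eq_bigr => i _; rewrite mulrA.
rewrite -sumrN -big_split; apply: eq_bigr => c _.
rewrite -sumrN -big_split; apply: eq_bigr => d _ /=.
rewrite -(green d o0 (LG c d) (LH c d) (fun i => tG i c d) (Cy c 1%N)) mulrDr addrCA.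
by rewrite addNr addr0.
Qed.

End viscous_flux.

Section interior_facet.
Context {R : realType}.
Context (v v' : triangle R) (i i' : 'I_3) (tau : pt R).
Context (o0 : orient v != 0) (o0' : orient v' != 0).
Context (Hseg : segment (src v' i') (tgt v' i') =
  [set x + tau | x in segment (src v i) (tgt v i)]).
Context (Hn : normal v' i' = - normal v i).
Context (Omega : set (pt R)) (per : seq (pt R * pt R * pt R)).
Context (oO : open Omega) (bO : bounded_set Omega)
  (intO : interior (closure Omega) = Omega).
Context (vO : hull v setT `<=` closure Omega) (vO' : hull v' setT `<=` closure Omega).
Context (Htau : tau = 0 \/ exists2 p, p \in per &
  tau = p.2 /\ segment (src v i) (tgt v i) `<=` segment p.1.1 p.1.2).
Context (nuT : R) (q : pt R -> 'cV[R]_3) (G : 'I_3 -> 'I_2 -> pt R -> R).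
Context (H : 'I_3 -> 'I_2 -> 'I_2 -> pt R -> R).
Context (Lq : forall c, L2 Omega (fun x => q x c 0)).
Context (wG : forall c, weak_grad Omega per (fun x => q x c 0) (G c)).
Context (wH : forall c d, weak_grad Omega per (G c d) (H c d)).

(** The opposite normals turn the sum of the two fluxes into a difference, so that
    [seg_int_avg_jump] applies to each entry of the gradient. *)
Lemma visc_flux_avg_jump (t t' : 'I_3 -> pt R -> 'M[R]_(3, 2)) (y y' : pt R -> 'cV[R]_3) :
  (forall j c d, is_trace v j (G c d) (H c d) (fun x => t j x c d)) ->
  (forall j c d, is_trace v' j (G c d) (H c d) (fun x => t' j x c d)) ->
  (forall c n, Cn n (fun x => y x c 0)) -> (forall c n, Cn n (fun x => y' x c 0)) ->
  visc_flux nuT v i (t i) y + visc_flux nuT v' i' (t' i') y' =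
  seg_int (src v i) (tgt v i) (fun x =>
    inner (2^-1 *: (visc nuT (t i x) + visc nuT (t' i' (x + tau))) *m normal v i)
          (y x - y' (x + tau))).
Proof.
move=> tG tG' Cy Cy'.
have cy c : continuous (fun x => y x c 0) := Cn_continuous (Cy c 0%N).
have cy' c : continuous (fun x => y' x c 0) := Cn_continuous (Cy' c 0%N).
pose a (x : pt R) : 'M[R]_(3, 2) := 2^-1 *: (t i x + t' i' (x + tau)).
pose b x : 'cV[R]_3 := y x - y' (x + tau).
have abE c d : (fun x => a x c d * b x c 0) = (fun x =>
    2^-1 * (t i x c d + t' i' (x + tau) c d) * (y x c 0 - y' (x + tau) c 0)).
  by apply/funext => x; rewrite !mxE.
have main c d := seg_int_avg_jump o0 o0' Hseg Hn oO bO intO vO vO' Htau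
  (let: conj L _ := wG c d in L) (wH c d) (fun j => tG j c d) (fun j => tG' j c d)
  (Cy c) (Cy' c).
have -> : (fun x => inner (2^-1 *: (visc nuT (t i x) + visc nuT (t' i' (x + tau)))
    *m normal v i) (y x - y' (x + tau))) =
    (fun x => inner (visc nuT (a x) *m normal v i) (b x)).
  apply/funext => x; congr (inner (_ *m _) _); apply/matrixP => c d.
  by rewrite viscE !mxE -!/(visc_coef _ _) /visc_coef; case: ifP => _; ring.
rewrite -/(visc_flux nuT v i a b) !visc_fluxE; last first.
- move=> c d; exact (edge_integrable_trace (P := fun x => y x c 0) (tG i c d) (cy c)).
- move=> c d; exact (edge_integrable_trace (P := fun x => y' x c 0) (tG' i' c d) (cy' c)).
- by move=> c d; rewrite abE; have [] := main c d.
rewrite -big_split; apply: eq_bigr => c _; rewrite -big_split; apply: eq_bigr => d _ /=.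
rewrite abE; have [_ <-] := main c d.
have -> : normal v' i' d 0 = - normal v i d 0 by rewrite Hn mxE.
by rewrite mulrN mulNr -mulrBr.
Qed.

Lemma seg_int_visc_jump (t t' : 'I_3 -> pt R -> 'cV[R]_3) (P : pt R -> 'cV[R]_3) :
  (forall j c, is_trace v j (fun x => q x c 0) (G c) (fun x => t j x c 0)) ->
  (forall j c, is_trace v' j (fun x => q x c 0) (G c) (fun x => t' j x c 0)) ->
  (forall c n, Cn n (fun x => P x c 0)) ->
  seg_int (src v i) (tgt v i) (fun x =>
    inner (P x) (visc nuT (t i x) - visc nuT (t' i' (x + tau)))) = 0.
Proof.
move=> tq tq' CP.
have cP c : continuous (fun x => P x c 0) := Cn_continuous (CP c 0%N).
have ei c : edge_integrable v i (fun x => visc_coef nuT c *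
    ((t i x c 0 - t' i' (x + tau) c 0) * P x c 0)).
  apply: edge_integrableZ.
  exact (edge_integrable_jump o0 Hseg (fun j => tq j c) (fun j => tq' j c) (cP c)).
have -> : (fun x => inner (P x) (visc nuT (t i x) - visc nuT (t' i' (x + tau)))) =
    (fun x => \sum_c visc_coef nuT c * ((t i x c 0 - t' i' (x + tau) c 0) * P x c 0)).
  apply/funext => x; rewrite inner_col; apply: eq_bigr => c _.
  by rewrite !mxE -!/(visc_coef _ _) /visc_coef; case: ifP => _; ring.
rewrite seg_int_sum//; apply: big1 => c _; rewrite seg_intZ; last first.
  exact (edge_integrable_jump o0 Hseg (fun j => tq j c) (fun j => tq' j c) (cP c)).
apply/eqP; rewrite mulf_eq0; apply/orP; right; apply/eqP.
exact (seg_int_jump o0 o0' Hseg Hn oO bO intO vO vO' Htau (Lq c) (wG c)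
  (fun j => tq j c) (fun j => tq' j c) (CP c)).
Qed.

End interior_facet.

(** * Dirichlet facets *)

Section dirichlet_facet.
Context {R : realType}.
Notation mu := (@lebesgue_measure R).
Context (v : triangle R) (i : 'I_3) (nuT : R).

Lemma edge_integrable_visc_col (P u : pt R -> 'cV[R]_3) :
  (forall c, edge_integrable v i (fun x => u x c 0 * P x c 0)) ->
  edge_integrable v i (fun x => inner (P x) (visc nuT (u x))).
Proof.
move=> ei.
have -> : (fun x => inner (P x) (visc nuT (u x))) =
    (fun x => \sum_c visc_coef nuT c * (u x c 0 * P x c 0)).
  by apply/funext => x; rewrite inner_col; apply: eq_bigr => c _; rewrite viscE; ring.
by apply: edge_integrable_sum => c; exact: edge_integrableZ.
Qed.

Lemma measurable_fun_edge_inner (P u : pt R -> 'cV[R]_3) :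
  (forall c, continuous (fun x => P x c 0)) ->
  (forall c, measurable_fun (`[0, 1] : set R) (fun s => u (edge_pt v i s) c 0)) ->
  measurable_fun (`[0, 1] : set R)
    (fun s => inner (P (edge_pt v i s)) (u (edge_pt v i s))).
Proof.
move=> cP mu_.
have -> : (fun s => inner (P (edge_pt v i s)) (u (edge_pt v i s))) =
    (fun s => \sum_c P (edge_pt v i s) c 0 * u (edge_pt v i s) c 0).
  by apply/funext => s; exact: inner_col.
apply: measurable_sum => c; apply: measurable_funM => //.
apply: measurable_funTS; apply: continuous_measurable_fun => s.
apply: (@continuous_comp _ _ _ (edge_pt v i) (fun x => P x c 0)); last exact: cP.
exact: continuous_edge_pt.
Qed.

Lemma measurable_fun_edge (D : set (pt R)) (f : pt R -> R) : closed D ->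
  segment (src v i) (tgt v i) `<=` D -> measurable_fun D f ->
  measurable_fun (`[0, 1] : set R) (f \o edge_pt v i).
Proof.
move=> cD sD mf; apply: (measurable_comp _ _ mf).
- by rewrite -[D]setCK; apply: measurableC; exact: open_measurable_plane (closed_openC cD).
- by move=> _ [s s01 <-]; apply: sD; exists s.
- apply: measurable_funTS; apply/measurable_fun_pairP; split.
    rewrite (_ : _ \o _ = fun s => ((tgt v i).1 - (src v i).1) * s + (src v i).1).
      exact: measurable_line_map.
    by apply/funext => s; rewrite /= /edge_pt /GRing.scale/=; ring.
  rewrite (_ : _ \o _ = fun s => ((tgt v i).2 - (src v i).2) * s + (src v i).2).
    exact: measurable_line_map.
  by apply/funext => s; rewrite /= /edge_pt /GRing.scale/=; ring.
Qed.

Lemma seg_int_ae (F1 F2 : pt R -> R) :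
  measurable_fun (`[0, 1] : set R) (F1 \o edge_pt v i) ->
  measurable_fun (`[0, 1] : set R) (F2 \o edge_pt v i) ->
  {ae mu, forall s, s \in `[0, 1] -> F1 (edge_pt v i s) = F2 (edge_pt v i s)} ->
  seg_int (src v i) (tgt v i) F1 = seg_int (src v i) (tgt v i) F2.
Proof.
move=> m1 m2 F12; rewrite /seg_int /Rintegral; congr (_ * fine _).
apply: ae_eq_integral => //; [exact/measurable_EFinP|exact/measurable_EFinP|].
case: F12 => A [mA A0 sA]; exists A; split => // s /= nF; apply: sA => /= F12.
by apply: nF => s01; rewrite /= F12.
Qed.

End dirichlet_facet.

Section smooth_vector_fields.
Context {R : realType}.
Implicit Types (y : pt R -> 'cV[R]_3) (nu : 'cV[R]_2).

Definition smooth_col y : Prop := forall c n, Cn n (fun x => y x c 0).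

Lemma smooth_colD y1 y2 : smooth_col y1 -> smooth_col y2 ->
  smooth_col (fun x => y1 x + y2 x).
Proof. by move=> C1 C2 c n; under eq_fun do rewrite mxE; exact: CnD. Qed.

Lemma smooth_colZ r y : smooth_col y -> smooth_col (fun x => r *: y x).
Proof. by move=> C c n; under eq_fun do rewrite mxE; exact: CnM (Cn_cst _ _) _. Qed.

Lemma smooth_colB y1 y2 : smooth_col y1 -> smooth_col y2 ->
  smooth_col (fun x => y1 x - y2 x).
Proof.
move=> C1 C2; rewrite (_ : (fun x => _) = fun x => y1 x + -1 *: y2 x).
  exact: smooth_colD C1 (smooth_colZ (-1) C2).
by apply/funext => x; rewrite scaleN1r.
Qed.

Lemma smooth_col_shift tau y : smooth_col y -> smooth_col (fun x => y (x + tau)).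
Proof. by move=> C c n; exact: Cn_shift (C c n). Qed.

Lemma smooth_grad_normal nu y : smooth_col y -> smooth_col (fun x => grad y x *m nu).
Proof.
move=> C c n.
have -> : (fun x => (grad y x *m nu) c 0) =
    (fun x => \sum_d nu d 0 * 'D_(evec d) (fun x => y x c 0) x).
  by apply/funext => x; rewrite mxE; apply: eq_bigr => d _; rewrite mxE mulrC.
by apply: Cn_sum => d; apply: CnM; [exact: Cn_cst|exact: Cn_derive (C c n.+1)].
Qed.

(** Both terms are linear in S(u) with smooth weights and combine into one integral. The boundary
    condition holds only almost everywhere along the edge, so both integrands are shown measurable
    before S(u) is exchanged for S(uD). *)
Lemma dirichlet_facet_int (D : set (pt R)) (v : triangle R) (i : 'I_3) (nuT p : R)
    (f : 'I_3 -> pt R -> R) (g : 'I_3 -> 'I_2 -> pt R -> R)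
    (u uD y : pt R -> 'cV[R]_3) nu :
  closed D -> segment (src v i) (tgt v i) `<=` D ->
  (forall c, measurable_fun D (fun x => visc nuT (uD x) c 0)) ->
  (forall c, is_trace v i (f c) (g c) (fun x => u x c 0)) ->
  {ae lebesgue_measure, forall s : R, s \in `[0, 1] ->
    visc nuT (u (edge_pt v i s)) = visc nuT (uD (edge_pt v i s))} ->
  smooth_col y ->
  seg_int (src v i) (tgt v i) (fun x => inner (grad y x *m nu) (visc nuT (u x))) +
  seg_int (src v i) (tgt v i) (fun x => p * inner (visc nuT (u x)) (y x)) =
  seg_int (src v i) (tgt v i)
    (fun x => inner (grad y x *m nu + p *: y x) (visc nuT (uD x))).
Proof.
move=> cD sD mD tu uuD Cy.
have C1 := smooth_grad_normal nu Cy; have C2 := smooth_colZ p Cy.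
have ei P : smooth_col P -> edge_integrable v i (fun x => inner (P x) (visc nuT (u x))).
  move=> CP; apply: edge_integrable_visc_col => c.
  exact (edge_integrable_trace (P := fun x => P x c 0) (tu c) (Cn_continuous (CP c 0%N))).
have -> : (fun x => p * inner (visc nuT (u x)) (y x)) =
    (fun x => inner (p *: y x) (visc nuT (u x))).
  apply/funext => x; rewrite !inner_col mulr_sumr; apply: eq_bigr => c _.
  have -> : (p *: y x) c 0 = p * y x c 0 by rewrite mxE.
  by ring.
rewrite -(seg_intD (ei _ C1) (ei _ C2)).
have -> : (fun x => inner (grad y x *m nu) (visc nuT (u x)) +
      inner (p *: y x) (visc nuT (u x))) =
    (fun x => inner (grad y x *m nu + p *: y x) (visc nuT (u x))).
  apply/funext => x; rewrite !inner_col -big_split; apply: eq_bigr => c _ /=.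
  have -> : (grad y x *m nu + p *: y x) c 0 =
    (grad y x *m nu) c 0 + (p *: y x) c 0 by rewrite mxE.
  by rewrite mulrDl.
have cP c : continuous (fun x => (grad y x *m nu + p *: y x) c 0).
  exact: (Cn_continuous (smooth_colD C1 C2 c 0%N)).
apply: seg_int_ae.
- apply: (measurable_fun_edge_inner (u := fun x => visc nuT (u x)) cP) => c.
  rewrite (_ : (fun s => _) = fun s => visc_coef nuT c * u (edge_pt v i s) c 0); last first.
    by apply/funext => s; rewrite viscE.
  by apply: measurable_funM; [exact: measurable_cst|have [] := tu c].
- apply: (measurable_fun_edge_inner (u := fun x => visc nuT (uD x)) cP) => c.
  exact: (measurable_fun_edge cD sD (mD c)).
- case: uuD => A [mA A0 sA]; exists A; split => // s /= nF; apply: sA => /= E.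
  by apply: nF => s01; rewrite E.
Qed.

End smooth_vector_fields.

Theorem lemma1 (R : realType)
  (Omega GammaD : set (pt R)) (per : seq (pt R * pt R * pt R))
  (T g fc nuT : R) (b : pt R -> R) (db : 'I_2 -> pt R -> R) (eta0 : pt R -> R)
  (q qD : R -> pt R -> 'cV[R]_3)
  (k : nat) (sigma beta : R) (I : Type) (Q : I -> mesh R) (t : R)
  (hOmega : polygonal_domain Omega)
  (hper : periodic_data Omega per)
  (hGammaD : closed GammaD /\ GammaD `<=` closure Omega `\` Omega)
  (hT : 0 < T) (hg : 0 < g) (hnuT : 0 < nuT)
  (hb : W1infty Omega b db)
  (heta0 : exists2 H0 : R, 0 < H0 &
     {ae mu2, forall x, Omega x -> H0 <= eta0 x + b x})
  (hmesh : forall h, triangulation Omega GammaD per (Q h))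
  (hshape : shape_regular Q) (hquasi : quasi_uniform Q)
  (hk : (1 <= k)%N) (hsigma : 0 < sigma) (hbeta : 1 <= beta)
  (hswe : swe_solution Omega T g fc nuT b db q)
  (ht : 0 < t <= T)
  (hreg : forall c, sobolev Omega per k.+1 (fun x => q t x c 0))
  (hqD : forall c, measurable_fun GammaD (fun x => visc nuT (qD t x) c 0))
  (h : I)
  (z : field R (msize (Q h))) (hz : represents Omega per (q t) z)
  (hDir : dirichlet_cond nuT z (qD t))
  (lapS : pt R -> 'cV[R]_3)
  (hlapS : forall c, weak_laplacian Omega per
     (fun x => visc nuT (q t x) c 0) (fun x => lapS x c 0))
  (w : 'I_(msize (Q h)) -> pt R -> 'cV[R]_3) (hw : in_Vh k w) :
  nipg sigma beta nuT z (dg_field w) =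
    - (\sum_K \int[mu2]_(x in tri (elt (Q h) K)) inner (lapS x) (w K x))
    + \sum_(e <- facets (Q h) | ~~ isSome (fminus e)) facet_int e (fun x =>
        inner (grad (w (fplus e).1) x *m facet_normal e
               + penalty sigma beta e *: w (fplus e).1 x)
              (visc nuT (qD t x))).
Proof.
have [oO _ _ bO [intO _]] := hOmega.
have [[nz cover _ _] perm conf] := hmesh h.
have [cG _] := hGammaD.
have hullO K : hull (elt (Q h) K) setT `<=` closure Omega.
  by rewrite -cover => x Kx; exists K.
have triO K := tri_sub intO (nz K) (hullO K).
have [G [H GH]] := hz.
have Lq c : L2 Omega (fun x => q t x c 0) by have [] := hreg c.
have wG c : weak_grad Omega per (fun x => q t x c 0) (G c) by have [] := GH c.
have wH c d : weak_grad Omega per (G c d) (H c d) by have [_ wH _ _ _] := GH c; exact: wH.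
have gradE K x : tri (elt (Q h) K) x -> forall c d, fgrad z K x c d = G c d x.
  by move=> Kx c d; have [_ _ gE _ _] := GH c; have [_ ->] := gE K x Kx.
have trq K i c : is_trace (elt (Q h) K) i (fun x => q t x c 0) (G c)
    (fun x => ftr z K i x c 0) by have [_ _ _ trq _] := GH c; exact: trq.
have trG K i c d : is_trace (elt (Q h) K) i (G c d) (H c d)
    (fun x => fgtr z K i x c d) by have [_ _ _ _ trG] := GH c; exact: trG.
have Cw K : smooth_col (w K) by move=> c n; exact: polyfun_Cn (hw K c).
pose X l := visc_flux nuT (elt (Q h) l.1) l.2 (fgtr z l.1 l.2) (w l.1).
(* Every local edge belongs to exactly one facet, so the boundary fluxes of the elements regroup
   facet by facet. *)
have XE : \sum_K \sum_i X (K, i) = \sum_(e <- facets (Q h)) \sum_(l <- ledges e) X l.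
  transitivity (\sum_(l <- flatten [seq ledges e | e <- facets (Q h)]) X l).
    rewrite (perm_big _ perm) /= big_enum /= pair_bigA /=.
    by apply: eq_bigr => l _; case: l.
  by rewrite big_flatten big_map.
have vol : \sum_K \int[mu2]_(x in tri (elt (Q h) K))
      inner (visc nuT (fgrad z K x)) (grad (w K) x) =
    - (\sum_K \int[mu2]_(x in tri (elt (Q h) K)) inner (lapS x) (w K x)) +
    \sum_K \sum_i X (K, i).
  rewrite -sumrN -big_split; apply: eq_bigr => K _.
  exact: (tri_visc_green oO bO (nz K) (triO K) Lq wG wH (gradE K) (trG K) (Cw K) hlapS).
pose Sz := visc_field nuT z.
pose A e := facet_int e (fun x =>
  inner (avg (fgtr Sz) e x *m facet_normal e) (jump (ftr (dg_field w)) e x)).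
pose B e := facet_int e (fun x =>
  inner (avg (fgtr (dg_field w)) e x *m facet_normal e) (jump (ftr Sz) e x)).
pose C e := facet_int e (fun x => penalty sigma beta e *
  inner (jump (ftr Sz) e x) (jump (ftr (dg_field w)) e x)).
pose D e := facet_int e (fun x =>
  inner (grad (w (fplus e).1) x *m facet_normal e
         + penalty sigma beta e *: w (fplus e).1 x) (visc nuT (qD t x))).
(* Once the volume terms are integrated by parts, the claim decouples into one identity per
   facet. *)
have facet_balance e : e \in facets (Q h) ->
    \sum_(l <- ledges e) X l - A e + B e + C e = if ~~ isSome (fminus e) then D e else 0.
  move=> he; have := conf e he; have := hDir e he.
  rewrite /A /B /C /D /ledges /avg /jump /facet_int /fsrc /ftgt /facet_normal /=.
  case: (fplus e) => K i /=; case: (fminus e) => [ [[K' i'] tau]|] /=.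
    move=> _ [Hseg Hn Htau].
    set p := penalty sigma beta e.
    rewrite big_cons big_seq1 /X /=.
    rewrite (visc_flux_avg_jump (nz K) (nz K') Hseg Hn oO bO intO (hullO K) (hullO K')
      Htau nuT wG wH (trG K) (trG K') (Cw K) (Cw K')) subrr add0r.
    (* The two remaining terms test the jump of S(q) with smooth weights built from [w]: [P1] is the
       average of its gradients applied to the normal, and [P2] is its jump times the penalty. *)
    pose P1 x := 2^-1 *: (grad (w K) x + grad (w K') (x + tau)) *m normal (elt (Q h) K) i.
    pose P2 x := p *: (w K x - w K' (x + tau)).
    have C1 : smooth_col P1.
      have := smooth_colZ 2^-1 (smooth_colD (smooth_grad_normal (normal (elt (Q h) K) i) (Cw K))
        (smooth_col_shift tau (smooth_grad_normal (normal (elt (Q h) K) i) (Cw K')))).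
      by rewrite /P1; under [in X in _ -> X]eq_fun do rewrite -scalemxAl mulmxDl.
    have C2 : smooth_col P2.
      exact (smooth_colZ p (smooth_colB (Cw K) (smooth_col_shift tau (Cw K')))).
    have jump0 P : smooth_col P -> seg_int (src (elt (Q h) K) i) (tgt (elt (Q h) K) i)
        (fun x => inner (P x) (visc nuT (ftr z K i x) - visc nuT (ftr z K' i' (x + tau)))) = 0.
      exact: (seg_int_visc_jump (nz K) (nz K') Hseg Hn oO bO intO (hullO K) (hullO K')
        Htau nuT Lq wG (trq K) (trq K')).
    rewrite [X in X + _](jump0 P1 C1) add0r -[RHS](jump0 P2 C2).
    apply: seg_int_ext => x; rewrite !inner_col mulr_sumr; apply: eq_bigr => c _.
    have -> : P2 x c 0 = p * (w K x - w K' (x + tau)) c 0 by rewrite mxE.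
    by ring.
  move=> /(_ isT) Dir sD.
  (* Average and jump are one-sided traces here, so the element flux and the consistency term are
     the same integral. *)
  rewrite big_seq1 /X /visc_flux subrr add0r.
  exact (dirichlet_facet_int (penalty sigma beta e) (normal (elt (Q h) K) i)
    cG sD hqD (trq K i) Dir (Cw K)).
rewrite /nipg [X in X - _ + _ + _]vol XE -!addrA; congr (_ + _).
rewrite [RHS]big_mkcond /= -(eq_big_seq _ facet_balance).
by rewrite -sumrN -!big_split; apply: eq_bigr => e _; rewrite -!addrA.
Qed.
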